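(* Let $p>q>0$ and $$\mathcal S_{p,q}(\delta)=p^{2+\delta}+q^{2+\delta}-1-\tfrac{2+\delta}{2}\,(p^2+q^2-1).$$ Let $\delta>0$ be such that $\mathcal S_{p,q}(\delta)<0$. Then the scaled Boltzmann equation (SB) (see context) has a unique stationary solution $g_\infty$ among probability measures with mean $0$, second moment $1$ and finite absolute moment of order $2+\delta$. Let $g(v,t)$ be the weak solution of (SB) corresponding to the initial density $f_0$, where $\int f_0\,dv=1$, $\int vf_0\,dv=0$, $\int v^2f_0\,dv=1$ and $$m_\delta:=\int_{\mathbb R}|v|^{2+\delta}f_0(v)\,dv<\infty .$$ Then there is a constant $c_\delta$ such that for all $t\ge 0$ $$\int_{\mathbb R}|v|^{2+\delta}g(v,t)\,dv\le c_\delta<\infty .$$ If $0<\delta\le1$ the constant is given by $$c_\delta=m_\delta+\frac{p^2q^\delta+q^2p^\delta}{|\mathcal S_{p,q}(\delta)|}.$$ Moreover, $g(v,t)$ converges exponentially fast in Fourier metric towards $g_\infty$, in the sense that for all $t\ge0$ $$d_{2+\delta}(g(t),g_\infty)\le d_{2+\delta}(f_0,g_\infty)\,\exp\{-|\mathcal S_{p,q}(\delta)|\,t\}.$$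
   Context: Measures on $\mathbb R$ are written as densities, $f(v)\,dv$. $\mathcal M_\alpha$ is the set of Borel probability measures on $\mathbb R$ with finite absolute moment of order $\alpha$, with the topology of weak convergence. A weak solution $f$ of the (unscaled) Boltzmann equation with initial datum $f_0\in\mathcal M_\alpha$, $\alpha>2$, is $f\in C^1([0,\infty),\mathcal M_\alpha)$ (i.e. $t\mapsto\int\phi f(v,t)dv$ is $C^1$ for each test function) such that for all $t>0$ and all smooth $\phi$ (bounded with all derivatives bounded) $$\frac d{dt}\int_{\mathbb R}\phi(v)f(v,t)\,dv=\int_{\mathbb R^2}f(v,t)f(w,t)\big(\phi(pv+qw)-\phi(v)\big)\,dv\,dw,$$ and $\lim_{t\to0}\int\phi f(v,t)dv=\int\phi f_0dv$. When $f_0$ has zero mean and unit second moment, $E(t)=\int v^2f(v,t)dv=\exp\{(p^2+q^2-1)t\}$. The weak solution of the scaled equation (SB) with initial value $f_0$ is $g(v,t)=\sqrt{E(t)}\,f\big(\sqrt{E(t)}\,v,t\big)$, where $f$ is the weak solution of the (unscaled) Boltzmann equation with initial datum $f_0$ and $E(t)=\exp\{(p^2+q^2-1)t\}$ (for measures: push-forward of $f(t)$ under $v\mapsto v/\sqrt{E(t)}$). The weak form of (SB) is $$\frac d{dt}\int\phi g\,dv+\tfrac12(p^2+q^2-1)\int\phi'(v)\,v\,g\,dv=\int_{\mathbb R^2}g(v)g(w)\big(\phi(pv+qw)-\phi(v)\big)dv\,dw .$$ A stationary solution is a probability measure $g_\infty$ such that for all $\phi\in C^1_c(\mathbb R)$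 $$\tfrac12(p^2+q^2-1)\int\phi'(v)\,v\,g_\infty(dv)=\int_{\mathbb R^2}\big(\phi(pv+qw)-\phi(v)\big)g_\infty(dv)g_\infty(dw).$$ $\widehat f(\xi)=\int_{\mathbb R}e^{-i\xi v}f(v)\,dv$; for $s>0$, $d_s(f,g)=\sup_{\xi\ne0}\frac{|\widehat f(\xi)-\widehat g(\xi)|}{|\xi|^s}\in[0,+\infty]$ (the inequality is trivial when the right-hand side is $+\infty$). *)

(* Defs.v *)
From HB Require Import structures.
From mathcomp Require Import all_boot all_order all_algebra.
From mathcomp Require Import all_classical all_reals all_analysis.
From mathcomp Require Import measurable_realfun complex.

Set Implicit Arguments.
Unset Strict Implicit.
Unset Printing Implicit Defensive.

Import Order.TTheory GRing.Theory Num.Theory.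
Import numFieldNormedType.Exports.

Local Open Scope classical_set_scope.
Local Open Scope ring_scope.
Local Open Scope complex_scope.

Notation borel_probability R := (probability R R).

Section Moments.
Context {R : realType}.
Implicit Types mu nu : borel_probability R.

Definition mean mu : \bar R := (\int[mu]_v v%:E)%E.

Definition second_moment mu : \bar R := (\int[mu]_v (v ^+ 2)%:E)%E.

Definition abs_moment (a : R) mu : \bar R := (\int[mu]_v (`|v| `^ a)%:E)%E.

Definition M_space (a : R) mu : Prop := (abs_moment a mu < +oo)%E.

Definition normalized mu : Prop := mean mu = 0%E /\ second_moment mu = 1%E.

(* Leibniz equality of measures would also compare their values on
   nonmeasurable sets. *)
Definition same_measure mu nu : Prop :=
  forall A : set R, measurable A -> mu A = nu A.

End Moments.

Section FourierMetric.
Context {R : realType}.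
Implicit Types mu nu : borel_probability R.

(* exp (- i x); complex-valued functions are integrated componentwise. *)
Definition cexpNi (x : R) : R[i] := cos x -i* sin x.

Definition Cintegral mu (F : R -> R[i]) : R[i] :=
  (\int[mu]_v complex.Re (F v)) +i* (\int[mu]_v complex.Im (F v)).

Definition fourier mu (xi : R) : R[i] := Cintegral mu (fun v => cexpNi (xi * v)).

Definition fourier_dist (s : R) mu nu : \bar R :=
  ereal_sup [set (ComplexField.Normc.normc (fourier mu xi - fourier nu xi)
                  / `|xi| `^ s)%:E | xi in [set xi : R | xi != 0]].

End FourierMetric.

Section Boltzmann.
Context {R : realType}.
Variables p q : R.
Implicit Types (mu : borel_probability R) (f : R -> borel_probability R).

Definition Spq (delta : R) : R :=
  p `^ (2 + delta) + q `^ (2 + delta) - 1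
  - (2 + delta) / 2 * (p ^+ 2 + q ^+ 2 - 1).

Definition energy (t : R) : R := expR ((p ^+ 2 + q ^+ 2 - 1) * t).

Definition collision mu (phi : R -> R) : R :=
  \int[(mu \x mu)%E]_vw (phi (p * vw.1 + q * vw.2) - phi vw.1).

Definition test_fun (phi : R -> R) : Prop :=
  forall n : nat, (forall x : R, derivable (phi^`(n))%classic x 1) /\
    exists K, forall x, `|(phi^`(n))%classic x| <= K.

Definition C1c (phi : R -> R) : Prop :=
  [/\ forall x : R, derivable phi x 1, continuous (phi^`())%classic &
      compact (closure [set x | phi x != 0])].

(* C^1 on the half-line; the derivative at 0 is one-sided. *)
Definition C1_halfline (F : R -> R) : Prop :=
  exists2 F' : R -> R, {within `[0, +oo[, continuous F'} &
    forall t : R, 0 <= t ->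
      (F s - F t) / (s - t) @[s --> within [set s : R | 0 <= s] t^'] --> F' t.

(* Only the values f t with 0 <= t are constrained. *)
Definition weak_solution (a : R) (f0 : borel_probability R) f : Prop :=
  [/\ M_space a f0,
      forall t : R, 0 <= t -> M_space a (f t),
      forall phi, test_fun phi -> C1_halfline (fun t => \int[f t]_v phi v),
      forall phi, test_fun phi -> forall t : R, 0 < t ->
        is_derive t 1 (fun s : R => \int[f s]_v phi v) (collision (f t) phi) &
      forall phi, test_fun phi ->
        \int[f t]_v phi v @[t --> 0^'+] --> \int[f0]_v phi v].

Definition dilation (c v : R) : R := v / c.

HB.instance Definition _ c := isMeasurableFun.Build _ _ R R
  (dilation c) (mulrr_measurable (D := setT) c^-1).

(* g(v,t) = sqrt (E t) * f(sqrt (E t) * v, t), written for measures. *)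
Definition scaled f (t : R) : borel_probability R :=
  distribution (f t) (dilation (Num.sqrt (energy t))).

Definition stationary mu : Prop :=
  forall phi, C1c phi ->
    2^-1 * (p ^+ 2 + q ^+ 2 - 1) * \int[mu]_v ((phi^`())%classic v * v)
    = collision mu phi.

Definition normalized_stationary (delta : R) mu : Prop :=
  [/\ normalized mu, M_space (2 + delta) mu & stationary mu].

End Boltzmann.

(* Main.v *)
From HB Require Import structures.
Require Import Defs.
From mathcomp Require Import all_boot all_order all_algebra.
From mathcomp Require Import all_classical all_reals all_analysis.
From mathcomp Require Import measurable_realfun complex ring lra.

Set Implicit Arguments.
Unset Strict Implicit.
Unset Printing Implicit Defensive.

Import Order.TTheory GRing.Theory Num.Theory.
Import numFieldNormedType.Exports.

Local Open Scope classical_set_scope.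
Local Open Scope ring_scope.


(* Tested on the phases cos (xi v + th), the Boltzmann equation says that the
   derivative of [phase (f t)] is [phase (conv (f t)) - phase (f t)], where
   [conv mu] is the law of p X + q Y for X, Y independent of law mu.  Since
   [conv] turns a bound D |xi|^s on the difference of two phases into
   (p^s + q^s) D |xi|^s, two solutions that start within D |xi|^s stay within
   D |xi|^s exp ((p^s + q^s - 1) t), and the rescaling by sqrt E turns the rate
   into Spq.  Testing stationarity on truncated cosines shows that the
   dilations of a stationary solution form such a solution; this yields the
   decay, and also uniqueness, at an order s in ]2, 3] where normalized laws
   are at finite distance by Taylor's formula (Spq is still negative there,
   being convex and vanishing at 0).

   Stationary solutions are fixed points of [collision_step], whose iterates
   are Cauchy in the Fourier metric and converge weakly, along an ultrafilter,
   by Helly's theorem.  The moment bound rests on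
   moment (conv mu) <= kappa * moment mu + K for normalized mu: by Bernoulli's
   inequality it is preserved by renormalized explicit Euler steps, the Euler
   scheme converges to the solution in phase, and moments are lower
   semicontinuous for this convergence. *)

(** * Integration of real functions *)

(** The moment of order 2 + delta cannot be differentiated along a weak solution: its integrand is
    not an admissible test function, and the definition only provides a moment of some order a > 2,
    unrelated to 2 + delta. Finiteness itself has to be produced, so the bound is proved on a
    discrete scheme and carried over by showing that the limit of the scheme has the phases of the
    solution. Since the laws are renormalized at every step, one threshold c is invariant whatever
    the step size, and nothing is lost in the limit.

    On the existence side, the Cauchy estimate does not provide a limit measure. Compactness does,
    and the estimate then yields both the fixed-point property and the normalization of the limit.
    Truncating the collision time keeps exp(- time) in [1/2, 1], so that all its powers are bounded,
    whatever the sign of p^2 + q^2 - 1 and the order of the moment. *)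

Section integration.
Context d (T : measurableType d) (R : realType) (P : probability T R).
Implicit Types f g : T -> R.

Lemma bounded_integrable f (M : R) :
  measurable_fun setT f -> (forall x, `|f x| <= M) ->
  P.-integrable setT (EFin \o f).
Proof.
move=> mf fM; apply: measurable_bounded_integrable => //.
  by apply: le_lt_trans (ltry 1); exact: probability_le1.
exists M; split; first exact: num_real.
by move=> x Mx y _ /=; rewrite (le_trans (fM y))// ltW.
Qed.

Lemma Rintegral_cst1 (r : R) : \int[P]_x r = r.
Proof.
by rewrite Rintegral_cst// (congr1 fine (probability_setT P)) mulr1.
Qed.

Lemma norm_Rintegral_le f (M : R) :
  measurable_fun setT f -> (forall x, `|f x| <= M) ->
  `|\int[P]_x f x| <= M.
Proof.
move=> mf fM; have fi := bounded_integrable mf fM.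
apply: le_trans (le_normr_Rintegral _ fi) _ => //.
rewrite -[leRHS]Rintegral_cst1; apply: le_Rintegral => //.
- exact: (integrable_norm fi).
- exact: (@bounded_integrable (cst M) `|M|).
Qed.

Lemma Rintegral_le f g :
  P.-integrable setT (EFin \o f) -> P.-integrable setT (EFin \o g) ->
  (forall x, f x <= g x) -> \int[P]_x f x <= \int[P]_x g x.
Proof. by move=> fi gi fg; apply: le_Rintegral. Qed.

Lemma ge0_EFin_Rintegral f : P.-integrable setT (EFin \o f) ->
  (\int[P]_x (f x)%:E)%E = (\int[P]_x f x)%:E.
Proof. by move=> fi; rewrite fineK//; exact: integrable_fin_num. Qed.

Lemma integrable_dominated f g : measurable_fun setT f ->
  P.-integrable setT (EFin \o g) -> (forall x, `|f x| <= `|g x|) ->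
  P.-integrable setT (EFin \o f).
Proof.
move=> mf gi fg; apply: (le_integrable _ _ _ gi) => //.
- exact/measurable_EFinP.
- by move=> x _; rewrite /= lee_fin.
Qed.

Lemma Rintegral_sub_le f g (M B : R) :
  measurable_fun setT f -> (forall x, `|f x| <= M) ->
  measurable_fun setT g -> (forall x, `|g x| <= M) ->
  (forall x, f x - g x <= B) -> \int[P]_x f x - \int[P]_x g x <= B.
Proof.
move=> mf fM mg gM fgB.
have fi := bounded_integrable mf fM; have gi := bounded_integrable mg gM.
rewrite -RintegralB// -[leRHS]Rintegral_cst1; apply: Rintegral_le => //.
  by have := integrableB measurableT fi gi; apply: eq_integrable => // x _; rewrite EFinB.
exact: (@bounded_integrable (cst B) `|B|).
Qed.

End integration.

Lemma Rintegral_distribution d1 d2 (T1 : measurableType d1)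
    (T2 : measurableType d2) (R : realType) (P : probability T1 R)
    (X : {mfun T1 >-> T2}) (f : T2 -> R) :
  measurable_fun setT f -> P.-integrable setT (EFin \o (f \o X)) ->
  \int[distribution P X]_y f y = \int[P]_x f (X x).
Proof.
move=> mf fi; rewrite /Rintegral integral_distribution//.
exact/measurable_EFinP.
Qed.

Lemma integrable_distribution d1 d2 (T1 : measurableType d1)
    (T2 : measurableType d2) (R : realType) (P : probability T1 R)
    (X : {mfun T1 >-> T2}) (f : T2 -> R) :
  measurable_fun setT f -> P.-integrable setT (EFin \o (f \o X)) ->
  (distribution P X).-integrable setT (EFin \o f).
Proof.
move=> mf /integrableP[mfX fi]; apply/integrableP; split.
  exact/measurable_EFinP.
rewrite ge0_integral_distribution//.
by apply: measurableT_comp => //; exact/measurable_EFinP.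
Qed.

Section product.
Context d1 d2 (T1 : measurableType d1) (T2 : measurableType d2) (R : realType).
Variables (P1 : probability T1 R) (P2 : probability T2 R).

Section bounded.
Variables (f : T1 * T2 -> R) (M : R).
Hypothesis mf : measurable_fun setT f.
Hypothesis fM : forall z, `|f z| <= M.

Let fi : (P1 \x P2)%E.-integrable setT (EFin \o f).
Proof. exact: (@bounded_integrable _ _ _ (P1 \x P2)%E _ M). Qed.

Let section1 x : P2.-integrable setT (EFin \o (fun y => f (x, y))).
Proof.
by apply: (@bounded_integrable _ _ _ _ _ M) => //; exact: measurableT_comp.
Qed.

Let section2 y : P1.-integrable setT (EFin \o (fun x => f (x, y))).
Proof.
by apply: (@bounded_integrable _ _ _ _ _ M) => //; exact: measurableT_comp.
Qed.

Lemma Rintegral_prod12 :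
  \int[(P1 \x P2)%E]_z f z = \int[P1]_x \int[P2]_y f (x, y).
Proof.
rewrite /Rintegral -(integral12_prod_meas1 fi); congr fine.
by apply: eq_integral => x _; exact: ge0_EFin_Rintegral.
Qed.

Lemma Rintegral_prod21 :
  \int[(P1 \x P2)%E]_z f z = \int[P2]_y \int[P1]_x f (x, y).
Proof.
rewrite /Rintegral -(integral21_prod_meas1 fi); congr fine.
by apply: eq_integral => x _; exact: ge0_EFin_Rintegral.
Qed.

Lemma measurable_Rintegral12 : measurable_fun setT (fun x => \int[P2]_y f (x, y)).
Proof.
apply/measurable_EFinP; apply: (eq_measurable_fun (fubini_F P2 (EFin \o f))).
  by move=> x _; exact: (ge0_EFin_Rintegral (section1 x)).
exact: (measurable_fubini_F fi).
Qed.

Lemma measurable_Rintegral21 : measurable_fun setT (fun y => \int[P1]_x f (x, y)).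
Proof.
apply/measurable_EFinP; apply: (eq_measurable_fun (fubini_G P1 (EFin \o f))).
  by move=> x _; exact: (ge0_EFin_Rintegral (section2 x)).
exact: (measurable_fubini_G fi).
Qed.

End bounded.

Section independent.
Variables (a : T1 -> R) (b : T2 -> R).
Hypothesis ai : P1.-integrable setT (EFin \o a).
Hypothesis bi : P2.-integrable setT (EFin \o b).

Lemma integrable_prodM :
  (P1 \x P2)%E.-integrable setT (EFin \o (fun z => a z.1 * b z.2)).
Proof.
have /measurable_EFinP ma := measurable_int _ ai.
have /measurable_EFinP mb := measurable_int _ bi.
apply/integrable12ltyP.
  apply/measurable_EFinP; apply: measurable_funM.
  - exact: measurableT_comp.
  - exact: measurableT_comp.
under eq_integral => x _.
  under eq_integral => y _ do rewrite /= normrM EFinM.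
  rewrite ge0_integralZl//; last first.
    by apply/measurable_EFinP; exact: measurableT_comp.
  over.
rewrite ge0_integralZr//=.
- have /integrableP[_ ai'] := ai; have /integrableP[_ bi'] := bi.
  by rewrite lte_mul_pinfty// ?integral_ge0// ge0_fin_numE// integral_ge0.
- by apply/measurable_EFinP; exact: measurableT_comp.
- exact: integral_ge0.
Qed.

Lemma Rintegral_prodM :
  \int[(P1 \x P2)%E]_z (a z.1 * b z.2) = (\int[P1]_x a x) * (\int[P2]_y b y).
Proof.
rewrite {1}/Rintegral -(integral12_prod_meas1 integrable_prodM) /fubini_F /=.
under eq_integral => x _.
  under eq_integral => y _ do rewrite EFinM.
  rewrite integralZl// ge0_EFin_Rintegral// -EFinM.
  over.
by rewrite -RintegralZr.
Qed.

End independent.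
End product.

(** * Phases and the collision operator *)

Section phase.
Context {R : realType}.
Implicit Types mu nu : borel_probability R.

(** The real part of e^(i th) times the characteristic function at xi. Leaving th free lets real
    integrals carry the whole complex number. *)
Definition phase mu (xi th : R) : R := \int[mu]_v cos (xi * v + th).

Lemma normr_cos_le1 (x : R) : `|cos x| <= 1.
Proof. by rewrite ler_norml cos_geN1 cos_le1. Qed.

Lemma continuous_cos_affine (xi th : R) : continuous (fun v : R => cos (xi * v + th)).
Proof.
move=> v; apply: continuous_comp; last exact: continuous_cos.
apply: cvgD; last exact: cvg_cst. exact: mulrl_continuous.
Qed.

Lemma measurable_cos_affine (xi th : R) :
  measurable_fun setT (fun v : R => cos (xi * v + th)).
Proof.
by apply: continuous_measurable_fun => v; exact: continuous_cos_affine.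
Qed.

Lemma integrable_cos_affine mu (xi th : R) :
  mu.-integrable setT (EFin \o (fun v : R => cos (xi * v + th))).
Proof.
apply: (@bounded_integrable _ _ _ _ _ 1) => [|x]; first exact: measurable_cos_affine.
exact: normr_cos_le1.
Qed.

Lemma normr_phase_le1 mu xi th : `|phase mu xi th| <= 1.
Proof.
apply: norm_Rintegral_le => [|x]; first exact: measurable_cos_affine.
exact: normr_cos_le1.
Qed.

(** Turns one-sided bounds that are uniform in th into bounds on absolute values. *)
Lemma phaseDpi mu xi th : phase mu xi (th + pi) = - phase mu xi th.
Proof.
rewrite /phase -mulN1r -RintegralZl//; last exact: integrable_cos_affine.
by apply: eq_Rintegral => v _; rewrite addrA cosDpi mulN1r.
Qed.

Lemma phase0 mu th : phase mu 0 th = cos th.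
Proof.
rewrite /phase -[RHS](Rintegral_cst1 mu).
by apply: eq_Rintegral => v _; rewrite mul0r add0r.
Qed.

(* |mu^ - nu^| <= B at xi, tested on all real phases of the complex number *)
Definition phase_close mu nu (xi B : R) :=
  forall th, phase mu xi th - phase nu xi th <= B.

Lemma phase_close_norm mu nu xi B : phase_close mu nu xi B ->
  forall th, `|phase mu xi th - phase nu xi th| <= B.
Proof.
move=> h th; rewrite ler_norml h andbT.
by have := h (th + pi); rewrite !phaseDpi; lra.
Qed.

Lemma phase_close_le mu nu xi B C : B <= C -> phase_close mu nu xi B ->
  phase_close mu nu xi C.
Proof. by move=> BC h th; apply: le_trans BC. Qed.

(** The trivial bound from which the iteration in [fourier_flow_contract] starts. *)
Lemma phase_close2 mu nu xi : phase_close mu nu xi 2.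
Proof.
move=> th; have := normr_phase_le1 mu xi th; have := normr_phase_le1 nu xi th.
by rewrite !ler_norml; lra.
Qed.

Definition dist_dilation (c : R) mu : borel_probability R :=
  distribution mu (dilation c).

Lemma phase_dilation c mu xi th :
  phase (dist_dilation c mu) xi th = phase mu (xi / c) th.
Proof.
rewrite /phase /dist_dilation Rintegral_distribution//.
- by apply: eq_Rintegral => v _; rewrite /dilation [in RHS]mulrAC mulrA.
- exact: measurable_cos_affine.
- rewrite (_ : _ \o _ = (fun v => cos (xi / c * v + th))).
    exact: integrable_cos_affine.
  by apply/funext => v; rewrite /= /dilation [in RHS]mulrAC mulrA.
Qed.

End phase.

Section convolution.
Context {R : realType}.
Variables p q : R.
Implicit Types mu nu : borel_probability R.

Definition collide (vw : R * R) : R := p * vw.1 + q * vw.2.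

Lemma measurable_collide : measurable_fun setT collide.
Proof.
apply: measurable_funD; apply: measurable_funM => //.
Qed.

HB.instance Definition _ :=
  isMeasurableFun.Build _ _ _ _ collide measurable_collide.

Definition conv mu : borel_probability R :=
  distribution (mu \x mu)%E collide.

Section bounded.
Variables (phi : R -> R) (M : R).
Hypotheses (mphi : measurable_fun setT phi) (phiM : forall x, `|phi x| <= M).

Lemma Rintegral_conv mu :
  \int[conv mu]_v phi v = \int[(mu \x mu)%E]_vw phi (p * vw.1 + q * vw.2).
Proof.
rewrite Rintegral_distribution//.
apply: (@bounded_integrable _ _ _ (mu \x mu)%E _ M) => [|x].
  by apply: measurableT_comp => //; exact: measurable_collide.
exact: phiM.
Qed.

Lemma collision_conv mu :
  collision p q mu phi = \int[conv mu]_v phi v - \int[mu]_v phi v.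
Proof.
rewrite Rintegral_conv /collision RintegralB//; last 2 first.
- apply: (@bounded_integrable _ _ _ (mu \x mu)%E _ M) => [|x]; last exact: phiM.
  by apply: measurableT_comp => //; exact: measurable_collide.
- apply: (@bounded_integrable _ _ _ (mu \x mu)%E _ M) => [|x]; last exact: phiM.
  exact: measurableT_comp.
congr (_ - _); rewrite (Rintegral_prod12 _ _ (M := M))//=.
  by apply: eq_Rintegral => x _; rewrite Rintegral_cst1.
exact: measurableT_comp.
Qed.

End bounded.

Lemma phase_conv mu xi th : phase (conv mu) xi th =
  \int[(mu \x mu)%E]_vw cos (xi * (p * vw.1 + q * vw.2) + th).
Proof.
rewrite /phase (@Rintegral_conv (fun v => cos (xi * v + th)) 1)//.
  exact: measurable_cos_affine.
by move=> x; exact: normr_cos_le1.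
Qed.

Let mcos xi th : measurable_fun setT
  (fun vw : R * R => cos (xi * (p * vw.1 + q * vw.2) + th)).
Proof.
apply: measurableT_comp (@measurable_cos_affine _ xi th) _.
exact: measurable_collide.
Qed.

(** The two factors of the product law are replaced one at a time, through nu x mu. While one
    variable is being replaced, the other only shifts the phase, so bounds uniform in th are what is
    needed, at the frequencies p xi and q xi. *)
Lemma phase_close_conv mu nu xi B1 B2 :
  phase_close mu nu (p * xi) B1 -> phase_close mu nu (q * xi) B2 ->
  phase_close (conv mu) (conv nu) xi (B1 + B2).
Proof.
move=> h1 h2 th; rewrite !phase_conv.
pose f (vw : R * R) := cos (xi * (p * vw.1 + q * vw.2) + th).
have mf : measurable_fun setT f by exact: mcos.
have f1 x : `|f x| <= 1 by exact: normr_cos_le1.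
rewrite -/f -[leLHS](subrKA (\int[(nu \x mu)%E]_vw f vw)) lerD//.
- rewrite (Rintegral_prod21 mu mu mf f1) (Rintegral_prod21 nu mu mf f1).
  apply: (@Rintegral_sub_le _ _ _ _ _ _ 1).
  + exact: (measurable_Rintegral21 mu mu mf f1).
  + by move=> w; apply: norm_Rintegral_le => //; exact: measurableT_comp.
  + exact: (measurable_Rintegral21 nu mu mf f1).
  + by move=> w; apply: norm_Rintegral_le => //; exact: measurableT_comp.
  + move=> w; have := h1 (q * xi * w + th); rewrite /phase /f.
    by congr (_ - _ <= _); apply: eq_Rintegral => v _ /=; congr cos; ring.
- rewrite (Rintegral_prod12 nu mu mf f1) (Rintegral_prod12 nu nu mf f1).
  apply: (@Rintegral_sub_le _ _ _ _ _ _ 1).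
  + exact: (measurable_Rintegral12 nu mu mf f1).
  + by move=> v; apply: norm_Rintegral_le => //; exact: measurableT_comp.
  + exact: (measurable_Rintegral12 nu nu mf f1).
  + by move=> v; apply: norm_Rintegral_le => //; exact: measurableT_comp.
  + move=> v; have := h2 (p * xi * v + th); rewrite /phase /f.
    by congr (_ - _ <= _); apply: eq_Rintegral => w _ /=; congr cos; ring.
Qed.

End convolution.

(** * Mixtures of two probability measures *)

Section mixture.
Context {R : realType}.
Variables (h : R) (h01 : 0 <= h <= 1) (mu nu : borel_probability R).

(** The absolute values make the weights nonnegative by construction; for h in [0, 1] they are 1 - h
    and h. *)
Definition mixture_weight1 : {nonneg R} := NngNum (normr_ge0 (1 - h)).
Definition mixture_weight2 : {nonneg R} := NngNum (normr_ge0 h).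

(** The proof of 0 <= h <= 1 is an argument so that the probability instance can be attached to the
    term. *)
Definition mixture of 0 <= h <= 1 :=
  measure_add (mscale mixture_weight1 mu) (mscale mixture_weight2 nu).

Let weight1E : mixture_weight1%:num = 1 - h.
Proof. by rewrite /= ger0_norm// subr_ge0; case/andP: h01. Qed.

Let weight2E : mixture_weight2%:num = h.
Proof. by rewrite /= ger0_norm//; case/andP: h01. Qed.

HB.instance Definition _ := Measure.on (mixture h01).

Let mixture_setT : mixture h01 setT = 1%E.
Proof.
rewrite /mixture measure_addE /mscale.
rewrite [X in (_ * X + _)%E](probability_setT mu).
rewrite [X in (_ + _ * X)%E](probability_setT nu).
by rewrite !mule1 -EFinD weight1E weight2E subrK.
Qed.

HB.instance Definition _ :=
  Measure_isProbability.Build _ _ _ (mixture h01) mixture_setT.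

Lemma ge0_integral_mixture (f : R -> \bar R) :
  measurable_fun setT f -> (forall x, 0 <= f x)%E ->
  (\int[mixture h01]_x f x =
   (1 - h)%:E * \int[mu]_x f x + h%:E * \int[nu]_x f x)%E.
Proof.
move=> mf f0; rewrite /mixture ge0_integral_measure_add//.
by rewrite !ge0_integral_mscale// weight1E weight2E.
Qed.

End mixture.

(** * Weak limits of tight sequences *)

Section cdf.
Context {R : realType}.
Implicit Types mu nu : borel_probability R.

(* transports to [R] the measures that the library builds on the syntactically
   different measurable type [measurableTypeR R] *)
Definition idTR : measurableTypeR R -> R := idfun.

HB.instance Definition _ :=
  @isMeasurableFun.Build _ _ _ _ idTR (@measurable_id _ _ setT).

Definition cdfR nu (x : R) : R := fine (nu `]-oo, x]%classic).

Section from_cdf.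
Variable F : R -> R.
Hypotheses (ndF : nondecreasing F) (rcF : right_continuous F)
  (FNy : F @ -oo --> (0 : R)) (Fy : F @ +oo --> (1 : R)).

#[local] HB.instance Definition _ := isCumulative.Build R _ R F ndF rcF.
#[local] HB.instance Definition _ := isCumulativeBounded.Build R 0 1 F FNy Fy.

Lemma exists_cdf : exists nu, forall x, cdfR nu x = F x.
Proof.
pose G : cumulativeBounded (0 : R) 1 := F.
pose P : probability (measurableTypeR R) R := lebesgue_stieltjes_measure G.
exists (distribution P idTR) => x.
by rewrite /cdfR (congr1 fine (cdf_lebesgue_stieltjes_id G x)).
Qed.

End from_cdf.

Lemma cdfR_fin nu x : (nu `]-oo, x]%classic = (cdfR nu x)%:E)%E.
Proof. by rewrite /cdfR fineK//; apply: fin_num_measure. Qed.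

Lemma cdfR_ge0 nu x : 0 <= cdfR nu x.
Proof. by rewrite fine_ge0. Qed.

Lemma cdfR_le1 nu x : cdfR nu x <= 1.
Proof. by rewrite -lee_fin -cdfR_fin probability_le1. Qed.

Lemma cdfR_le nu x y : x <= y -> cdfR nu x <= cdfR nu y.
Proof.
move=> xy; rewrite -lee_fin -!cdfR_fin; apply: le_measure; rewrite ?inE//.
exact: subitvPr.
Qed.

Lemma measure_itv_oc nu x y : x <= y ->
  nu `]x, y]%classic = (cdfR nu y - cdfR nu x)%:E.
Proof.
move=> xy; rewrite EFinB -!cdfR_fin.
have -> : `]x, y]%classic = `]-oo, y] `\` `]-oo, x].
  by rewrite -[RHS]setCK setCD setCitvl setUC -[LHS]setCK setCitv.
rewrite measureD ?setIidr//; first exact: subset_itvl.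
by apply: le_lt_trans (probability_le1 _ _) _ => //; rewrite ltry.
Qed.

Lemma measure_itv_gt nu x : nu `]x, +oo[%classic = (1 - cdfR nu x)%:E.
Proof.
rewrite EFinB -!cdfR_fin -(probability_setC nu)//; first by rewrite setCitvl.
Qed.

Lemma Rintegral_set_approx nu (phi : R -> R) (A : set R) (c B : R) :
  measurable_fun setT phi -> nu.-integrable setT (EFin \o phi) ->
  measurable A -> (forall x, A x -> `|phi x - c| <= B) ->
  `|\int[nu]_(x in A) phi x - c * fine (nu A)| <= B * fine (nu A).
Proof.
move=> mphi iphi mA phic.
have iA : nu.-integrable A (EFin \o phi) by exact: (@integrableS _ _ _ nu setT).
have icst (r : R) : nu.-integrable A (EFin \o cst r).
  apply: (@integrableS _ _ _ nu setT) => //.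
  exact: (@bounded_integrable _ _ _ nu (cst r) `|r|).
rewrite -!Rintegral_cst// -RintegralB//; last exact: (icst c).
have isub : nu.-integrable A (EFin \o (fun x => phi x - c)).
  by have := integrableB mA iA (icst c); apply: eq_integrable => // x _; rewrite EFinB.
apply: le_trans (le_normr_Rintegral _ isub) _ => //.
apply: le_Rintegral => //.
  exact: (integrable_norm isub).
exact: (icst B).
Qed.

(** The mesh costs K eta on ]x 0, x J], and the bound M pays for the mass outside. The sum only sees
    the distribution function at finitely many points, so pointwise limits of distribution functions
    pass through it. *)
Lemma riemann_sum_bound nu (phi : R -> R) (K M eta : R) (x : nat -> R) (J : nat) :
  measurable_fun setT phi -> (forall x, `|phi x| <= M) ->
  (forall x y, `|phi x - phi y| <= K * `|x - y|) -> 0 <= K -> 0 < eta ->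
  (forall j, x j <= x j.+1 <= x j + eta) ->
  `|\int[nu]_v phi v -
    \sum_(0 <= j < J) phi (x j) * (cdfR nu (x j.+1) - cdfR nu (x j))| <=
  K * eta + M * (cdfR nu (x 0%N) + (1 - cdfR nu (x J))).
Proof.
move=> mphi phiM phiK K0 eta0 xeta.
have iphi : nu.-integrable setT (EFin \o phi) by exact: bounded_integrable phiM.
have xS j : x j <= x j.+1 by have /andP[] := xeta j.
have x0x j : x 0%N <= x j by elim: j => // j /le_trans; apply.
have inner : `|\int[nu]_(v in `]x 0%N, x J]) phi v -
    \sum_(0 <= j < J) phi (x j) * (cdfR nu (x j.+1) - cdfR nu (x j))| <=
    K * eta * (cdfR nu (x J) - cdfR nu (x 0%N)).
  elim: J => [|J IH].
    rewrite big_geq// subr0 subrr mulr0 set_itv_ge ?bnd_simp ?ltxx//.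
    by rewrite Rintegral_set0 normr0.
  have -> : `]x 0%N, x J.+1]%classic = `]x 0%N, x J] `|` `]x J, x J.+1].
    by rewrite -itv_bndbnd_setU// bnd_simp.
  rewrite Rintegral_setU//; last 2 first.
  - by apply: (@integrableS _ _ _ nu setT) => //; exact: measurableU.
  - apply/disj_setPS => v [] /=; rewrite !in_itv/= => /andP[_ vx] /andP[xv _].
    by move: xv; rewrite ltNge vx.
  rewrite big_nat_recr//= opprD addrACA.
  apply: le_trans (ler_normD _ _) _.
  rewrite (_ : K * eta * (cdfR nu (x J.+1) - _) =
    K * eta * (cdfR nu (x J) - cdfR nu (x 0%N)) +
    K * eta * (cdfR nu (x J.+1) - cdfR nu (x J))); last by ring.
  apply: lerD => //.
  have -> : cdfR nu (x J.+1) - cdfR nu (x J) = fine (nu `]x J, x J.+1]%classic).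
    by rewrite measure_itv_oc.
  apply: Rintegral_set_approx => // v /=; rewrite in_itv/= => /andP[xv vx].
  apply: le_trans (phiK _ _) _; rewrite ler_wpM2l//.
  rewrite ger0_norm; last by rewrite subr_ge0 ltW.
  by have /andP[_] := xeta J; lra.
have left_part : `|\int[nu]_(v in `]-oo, x 0%N]) phi v| <= M * cdfR nu (x 0%N).
  have := @Rintegral_set_approx nu phi `]-oo, x 0%N] 0 M mphi iphi.
  by rewrite mul0r subr0; apply => // v _; rewrite subr0.
have right_part : `|\int[nu]_(v in `]x J, +oo[) phi v| <= M * (1 - cdfR nu (x J)).
  have := @Rintegral_set_approx nu phi `]x J, +oo[ 0 M mphi iphi.
  rewrite mul0r subr0 [fine _](congr1 fine (measure_itv_gt _ _)).
  by apply => // v _; rewrite subr0.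
have -> : \int[nu]_v phi v = \int[nu]_(v in `]-oo, x 0%N]) phi v +
    \int[nu]_(v in `]x 0%N, x J]) phi v + \int[nu]_(v in `]x J, +oo[) phi v.
  rewrite -Rintegral_setU//; last 2 first.
  - by apply: (@integrableS _ _ _ nu setT) => //; exact: measurableU.
  - apply/disj_setPS => v [] /=; rewrite !in_itv/= => vx /andP[xv _].
    by move: xv; rewrite ltNge vx.
  rewrite -itv_bndbnd_setU ?bnd_simp// -Rintegral_setU//; last 2 first.
  - by apply: (@integrableS _ _ _ nu setT) => //; exact: measurableU.
  - apply/disj_setPS => v [] /=; rewrite !in_itv/= andbT => vx xv.
    by move: xv; rewrite ltNge vx.
  by rewrite -itv_bndbnd_setU// set_itvNyy.
move: inner left_part right_part.
set S := \sum_(0 <= j < J) _.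
set a := \int[nu]_(v in `]-oo, x 0%N]) phi v.
set b := \int[nu]_(v in `]x 0%N, x J]) phi v.
set c := \int[nu]_(v in `]x J, +oo[) phi v => inner left_part right_part.
have -> : a + b + c - S = (b - S) + (a + c) by ring.
apply: le_trans (ler_normD _ _) _; apply: lerD.
  apply: le_trans inner _; rewrite -[leRHS]mulr1 ler_wpM2l//.
    by rewrite mulr_ge0// ltW.
  have := cdfR_le1 nu (x J); have := cdfR_ge0 nu (x 0%N); lra.
by apply: le_trans (ler_normD _ _) _; rewrite mulrDr lerD.
Qed.

End cdf.

Section helly.
Context {R : realType}.
Implicit Types mu : borel_probability R.

(** The image filter has a cluster point in a compact segment, and an ultrafilter converges to its
    cluster points. This takes the place of the diagonal extraction in Helly's theorem. *)
Lemma ultra_cvg_bounded (U : set_system nat) (a : nat -> R) (B : R) :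
  UltraFilter U -> (forall n, `|a n| <= B) -> cvg (a n @[n --> U]).
Proof.
move=> UU aB; have FU : ProperFilter U by exact: ultra_proper.
have /(_ (a @ U)) := @segment_compact R (- B) B.
case=> [|l [_ cl]].
  by apply: (@filterE _ U) => n; rewrite /= in_itv/= -ler_norml.
apply/cvg_ex; exists l => N Nl.
have [//|UN] := in_ultra_setVsetC (a @^-1` N) UU.
have [y []] := cl (~` N) N UN Nl; by [].
Qed.

Lemma lim_le_lim (U : set_system nat) (a b : nat -> R) (la lb : R) :
  ProperFilter U -> a n @[n --> U] --> la -> b n @[n --> U] --> lb ->
  (forall n, a n <= b n) -> la <= lb.
Proof.
move=> PU ala blb ab; apply: (ler_cvg_to ala blb); apply: filterE => n; exact: ab.
Qed.

Definition tight (mu_ : nat -> borel_probability R) := forall e : R, 0 < e ->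
  exists A : R, forall n, cdfR (mu_ n) (- A) <= e /\ 1 - cdfR (mu_ n) A <= e.

Section limit.
Variables (U : set_system nat) (UU : UltraFilter U).
Variables (mu_ : nat -> borel_probability R) (tmu : tight mu_).

Let PU : ProperFilter U. Proof. exact: ultra_proper. Qed.

Let G (x : R) : R := lim (cdfR (mu_ n) x @[n --> U]).

Let Gcvg x : cdfR (mu_ n) x @[n --> U] --> G x.
Proof.
apply: (@ultra_cvg_bounded U (fun n => cdfR (mu_ n) x) 1) => // n.
by rewrite ger0_norm ?cdfR_ge0// cdfR_le1.
Qed.

Let G_le x y : x <= y -> G x <= G y.
Proof. by move=> xy; apply: (lim_le_lim _ (@Gcvg x) (@Gcvg y)) => n; exact: cdfR_le. Qed.

Let G_ge0 x : 0 <= G x.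
Proof. by apply: (lim_le_lim _ (cvg_cst (0 : R)) (@Gcvg x)) => n; exact: cdfR_ge0. Qed.

Let G_le1 x : G x <= 1.
Proof. by apply: (lim_le_lim _ (@Gcvg x) (cvg_cst (1 : R))) => n; exact: cdfR_le1. Qed.

Let tG (e : R) : 0 < e -> exists A, [/\ G (- A) <= e, 1 - G A <= e &
  forall n, cdfR (mu_ n) (- A) <= e /\ 1 - cdfR (mu_ n) A <= e].
Proof.
move=> e0; have [A hA] := tmu e0; exists A; split=> //.
- by apply: (lim_le_lim _ (@Gcvg _) (cvg_cst e)) => n; case: (hA n).
- rewrite lerBlDr addrC -lerBlDr.
  apply: (lim_le_lim _ (cvg_cst (1 - e)) (@Gcvg A)) => n.
  by case: (hA n) => _; lra.
Qed.

(** The pointwise limit [G] is monotone but may fail to be right-continuous; [F] is its limit from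
    the right. *)
Let F (x : R) : R := inf (G @` `]x, +oo[).

Let FG x y : x < y -> F x <= G y.
Proof.
move=> xy; apply: ge_inf.
  by exists 0 => ? [z _ <-]; exact: G_ge0.
by exists y => //=; rewrite in_itv/= xy.
Qed.

Let le_F x (c : R) : (forall y, x < y -> c <= G y) -> c <= F x.
Proof.
move=> h; apply: lb_le_inf.
  by exists (G (x + 1)), (x + 1) => //=; rewrite in_itv/= andbT ltrDl.
by move=> ? [y /=]; rewrite in_itv/= andbT => xy <-; exact: h.
Qed.

Let GF x : G x <= F x.
Proof. by apply: le_F => y /ltW; exact: G_le. Qed.

Let F_le : nondecreasing F.
Proof. by move=> x y xy; apply: le_F => z yz; apply: FG; exact: le_lt_trans yz. Qed.

Let F_rc : right_continuous F.
Proof.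
move=> a; apply/cvgrPdist_le => e e0.
have : F a < F a + e by rewrite ltrDl.
move=> /inf_lt[|? [y /=]].
  by exists (G (a + 1)), (a + 1) => //=; rewrite in_itv/= andbT ltrDl.
rewrite in_itv/= andbT => ay <- Gy.
near=> x; have ax : a <= x by near: x; exact: nbhs_right_ge.
rewrite distrC ger0_norm ?subr_ge0; last exact: F_le.
rewrite lerBlDl; apply: le_trans (ltW Gy); apply: FG.
by near: x; exact: nbhs_right_lt.
Unshelve. all: by end_near. Qed.

Let F_Ny : F @ -oo --> (0 : R).
Proof.
apply/cvgrPdist_le => e e0; have [A [GA _ _]] := tG e0.
near=> x; rewrite sub0r normrN ger0_norm; last exact: le_trans (G_ge0 x) (GF x).
by apply: le_trans GA; apply: FG; near: x; apply: nbhs_ninfty_lt; exact: num_real.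
Unshelve. all: by end_near. Qed.

Let F_y : F @ +oo --> (1 : R).
Proof.
apply/cvgrPdist_le => e e0; have [A [_ GA _]] := tG e0.
near=> x; rewrite ger0_norm.
  apply: le_trans GA; rewrite lerB//; apply: le_trans (GF x).
  by apply: G_le; near: x; apply: nbhs_pinfty_ge; exact: num_real.
rewrite subr_ge0; apply: le_trans (FG (y := x + 1) _) (G_le1 _).
by rewrite ltrDl.
Unshelve. all: by end_near. Qed.

Lemma helly : exists mu, forall (phi : R -> R) (K M : R),
  measurable_fun setT phi -> (forall x, `|phi x| <= M) ->
  (forall x y, `|phi x - phi y| <= K * `|x - y|) ->
  \int[mu_ n]_v phi v @[n --> U] --> \int[mu]_v phi v.
Proof.
have [mu muF] := exists_cdf F_le F_rc F_Ny F_y.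
exists mu => phi K M mphi phiM phiK.
have K0 : 0 <= K by have := phiK 1 0; rewrite subr0 normr1 mulr1; exact: le_trans.
have M0 : 0 <= M by exact: le_trans (phiM 0).
apply/cvgrPdist_le => eps eps0.
(* Three errors of at most K e + 2 M e each (two Riemann sums and the passage from [F] to [G]), plus
   e for the convergence of the finite sums, add up to eps. *)
pose e := eps / (3 * K + 6 * M + 1).
have d0 : 0 < 3 * K + 6 * M + 1 by lra.
have e0 : 0 < e by rewrite divr_gt0.
have [A [GA1 GA2 hA]] := tG e0.
(* The grid starts strictly below - A because [FG] compares [F] with [G] only at a strictly larger
   point. *)
pose x (j : nat) := - A - 1 + j%:R * e.
have xe j : x j <= x j.+1 <= x j + e.
  by rewrite /x -natr1 mulrDl mul1r addrA lexx lerDl ltW.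
have xlt j : x j < x j.+1.
  by rewrite /x -natr1 mulrDl mul1r addrA ltrDl.
have [J xJ] : exists J, A <= x J.
  exists (Num.truncn ((2 * A + 1) / e)).+1; rewrite /x -lerBlDl.
  rewrite -ler_pdivrMr//; apply: le_trans (ltW (truncnS_gt _)).
  by rewrite ler_pM2r ?invr_gt0//; lra.
have x0 : x 0%N < - A by rewrite /x mul0r addr0; lra.
pose S (H : R -> R) := \sum_(0 <= j < J) phi (x j) * (H (x j.+1) - H (x j)).
have Fx0 : F (x 0%N) <= e by apply: le_trans GA1; exact: FG.
have GxJ : 1 - G (x J) <= e by apply: le_trans GA2; rewrite lerB// G_le.
have FxJ : 1 - F (x J) <= e by apply: le_trans GxJ; rewrite lerB.
have bmu : `|\int[mu]_v phi v - S F| <= K * e + M * (e + e).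
  have := riemann_sum_bound mu J mphi phiM phiK K0 e0 xe.
  under eq_bigr do rewrite !muF.
  rewrite !muF -/(S F) => /le_trans; apply; rewrite lerD2l ler_wpM2l//.
  exact: lerD.
have bn n : `|\int[mu_ n]_v phi v - S (cdfR (mu_ n))| <= K * e + M * (e + e).
  have := riemann_sum_bound (mu_ n) J mphi phiM phiK K0 e0 xe.
  move=> /le_trans; apply; rewrite lerD2l ler_wpM2l//.
  have [h1 h2] := hA n; apply: lerD.
    by apply: le_trans h1; apply: cdfR_le; exact: ltW.
  by apply: le_trans h2; rewrite lerB//; exact: cdfR_le.
have bFG : `|S F - S G| <= K * e + M * (e + e).
  pose D j := F (x j) - G (x j).
  have D0 j : 0 <= D j by rewrite subr_ge0.
  (* [G] may jump at a grid point, but the gap is at most the increment of [G] over the next cell,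
     and these increments telescope to at most 1. *)
  have D1 j : D j <= G (x j.+1) - G (x j) by rewrite lerB// FG.
  (* summation by parts *)
  have -> : S F - S G = phi (x J) * D J - phi (x 0%N) * D 0%N -
      \sum_(0 <= j < J) (phi (x j.+1) - phi (x j)) * D j.+1.
    rewrite -(telescope_sumr (fun j => phi (x j) * D j))// -!sumrB.
    by apply: eq_bigr => j _; rewrite /D; ring.
  apply: le_trans (ler_normB _ _) _; rewrite [leLHS]addrC lerD//.
    rewrite (le_trans (ler_norm_sum _ _ _))//.
    apply: (@le_trans _ _ (\sum_(0 <= j < J) K * e * (G (x j.+2) - G (x j.+1)))).
      apply: ler_sum => j _; rewrite normrM ler_pM//; last by rewrite ger0_norm.
      apply: le_trans (phiK _ _) _; rewrite ler_wpM2l//.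
      by have /andP[h1 h2] := xe j; rewrite ger0_norm ?subr_ge0//; lra.
    rewrite -mulr_sumr (telescope_sumr (fun j => G (x j.+1)))//.
    rewrite -[leRHS]mulr1 ler_wpM2l//; first by rewrite mulr_ge0// ltW.
    have := G_le1 (x J.+1); have := G_ge0 (x 1%N); lra.
  apply: le_trans (ler_normB _ _) _; rewrite [leRHS]mulrDr lerD// normrM ler_pM// ger0_norm//.
    rewrite /D; apply: le_trans GxJ; rewrite lerB//.
    by apply: le_trans (FG (xlt J)) _.
  by apply: le_trans Fx0; rewrite /D gerBl.
have Scvg : S (cdfR (mu_ n)) @[n --> U] --> S G.
  rewrite /S; apply: (@cvg_big _ _ +%R) => [|j _].
    exact: add_continuous.
  apply: cvgM; first exact: cvg_cst.
  by apply: cvgB; exact: (@Gcvg _).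
have /cvgrPdist_le/(_ e e0) := Scvg.
apply: filterS => n SGn.
have -> : eps = (K * e + M * (e + e)) + (K * e + M * (e + e)) + e + (K * e + M * (e + e)).
  have : e * (3 * K + 6 * M + 1) = eps by rewrite /e divfK// gt_eqF.
  lra.
have -> : \int[mu]_v phi v - \int[mu_ n]_v phi v =
  (\int[mu]_v phi v - S F) + (S F - S G) + (S G - S (cdfR (mu_ n)))
  - (\int[mu_ n]_v phi v - S (cdfR (mu_ n))) by ring.
rewrite (le_trans (ler_normB _ _))// lerD//.
rewrite (le_trans (ler_normD _ _))// lerD//.
by rewrite (le_trans (ler_normD _ _))// lerD.
Qed.

End limit.
End helly.

(** * Measures with equal phases are equal *)

Section dominated.
Context d (T : measurableType d) (R : realType) (P : probability T R).

Lemma dominated_cvg_Rintegral (f_ : nat -> T -> R) (f g : T -> R) :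
  (forall n, measurable_fun setT (f_ n)) ->
  (forall x, f_ n x @[n --> \oo] --> f x) ->
  P.-integrable setT (EFin \o g) -> (forall n x, `|f_ n x| <= g x) ->
  P.-integrable setT (EFin \o f) /\
  \int[P]_x f_ n x @[n --> \oo] --> \int[P]_x f x.
Proof.
move=> mf_ ff gi fg.
have mf : measurable_fun setT f.
  by apply: (@measurable_fun_cvg _ _ _ _ f_) => // x _; exact: ff.
have [|||||fi _ cv] := @dominated_convergence _ _ _ P setT measurableT
  (fun n => EFin \o f_ n) (EFin \o f) (EFin \o g).
- by move=> n; exact/measurable_EFinP.
- exact/measurable_EFinP.
- by apply: aeW => x _; apply/cvg_EFin; [exact: nearW|exact: ff].
- exact: gi.
- by apply: aeW => x n _; rewrite /= lee_fin.
split=> //; apply: fine_cvg; move: cv; rewrite ge0_EFin_Rintegral//; exact.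
Qed.

Lemma bounded_cvg_Rintegral (f_ : nat -> T -> R) (f : T -> R) (M : R) :
  (forall n, measurable_fun setT (f_ n)) -> (forall n x, `|f_ n x| <= M) ->
  (forall x, f_ n x @[n --> \oo] --> f x) ->
  \int[P]_x f_ n x @[n --> \oo] --> \int[P]_x f x.
Proof.
move=> mf fM ff; apply: (dominated_cvg_Rintegral mf ff (g := cst M) _ _).2 => //.
exact: (@bounded_integrable _ _ _ _ (cst M) `|M|).
Qed.

End dominated.

Section trigonometric_polynomials.
Context {R : realType}.
Implicit Types (mu nu : borel_probability R) (f g : R -> R).

Definition trigpoly f := exists l : seq (R * R * R), forall v,
  f v = \sum_(t <- l) t.1.1 * cos (t.1.2 * v + t.2).

Lemma trigpoly_cst c : trigpoly (fun=> c).
Proof.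
by exists [:: (c, 0, 0)] => v; rewrite big_seq1 mul0r addr0 cos0 mulr1.
Qed.

Lemma trigpoly_cos xi th : trigpoly (fun v => cos (xi * v + th)).
Proof. by exists [:: (1, xi, th)] => v; rewrite big_seq1 mul1r. Qed.

Lemma trigpolyD f g : trigpoly f -> trigpoly g -> trigpoly (fun v => f v + g v).
Proof. by move=> [l fl] [k gk]; exists (l ++ k) => v; rewrite big_cat fl gk. Qed.

Lemma trigpoly_sum (I : Type) (r : seq I) (F : I -> R -> R) :
  (forall i, trigpoly (F i)) -> trigpoly (fun v => \sum_(i <- r) F i v).
Proof.
move=> tF; elim: r => [|i r IH].
  have [l hl] := trigpoly_cst 0; exists l => v; rewrite big_nil -hl//.
have [l hl] := trigpolyD (tF i) IH; exists l => v; rewrite big_cons -hl//.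
Qed.

(** The product-to-sum formula keeps products of cosines in the span. *)
Lemma trigpolyM f g : trigpoly f -> trigpoly g -> trigpoly (fun v => f v * g v).
Proof.
move=> [l fl] [k gk].
have -> : (fun v => f v * g v) = (fun v => \sum_(t <- l) \sum_(u <- k)
    ((t.1.1 * u.1.1 / 2) * cos ((t.1.2 + u.1.2) * v + (t.2 + u.2)) +
     (t.1.1 * u.1.1 / 2) * cos ((t.1.2 - u.1.2) * v + (t.2 - u.2)))).
  apply/funext => v; rewrite fl gk mulr_suml; apply: eq_bigr => t _.
  rewrite mulr_sumr; apply: eq_bigr => u _.
  rewrite (_ : (t.1.2 + u.1.2) * v + (t.2 + u.2) =
    (t.1.2 * v + t.2) + (u.1.2 * v + u.2)); last by ring.
  rewrite (_ : (t.1.2 - u.1.2) * v + (t.2 - u.2) =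
    (t.1.2 * v + t.2) - (u.1.2 * v + u.2)); last by ring.
  move: (t.1.2 * v + t.2) (u.1.2 * v + u.2) => A B.
  by rewrite cosD cosB; field.
do 2 (apply: trigpoly_sum => ?); rewrite -/(trigpoly _).
apply: trigpolyD; eexists [:: (_, _, _)] => v; rewrite big_seq1//.
Qed.

Lemma trigpolyX f n : trigpoly f -> trigpoly (fun v => f v ^+ n).
Proof.
move=> tf; elim: n => [|n IH].
  have [l hl] := trigpoly_cst 1; exists l => v; rewrite expr0 -hl//.
have [l hl] := trigpolyM tf IH; exists l => v; rewrite exprS -hl//.
Qed.

Lemma trigpolyZ c f : trigpoly f -> trigpoly (fun v => c * f v).
Proof. by move=> /(trigpolyM (trigpoly_cst c)). Qed.

Lemma Rintegral_trigpoly mu nu f : (forall xi th, phase mu xi th = phase nu xi th) ->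
  trigpoly f -> \int[mu]_v f v = \int[nu]_v f v.
Proof.
move=> munu [l fl].
have key (P : borel_probability R) : \int[P]_v f v =
    \sum_(t <- l) t.1.1 * phase P t.1.2 t.2 /\ P.-integrable setT (EFin \o f).
  have -> : f = (fun v => \sum_(t <- l) t.1.1 * cos (t.1.2 * v + t.2)).
    exact/funext.
  elim: l {fl} => [|t l [IH1 IH2]].
    have -> : (fun v => \sum_(t <- [::]) t.1.1 * cos (t.1.2 * v + t.2)) =
        cst 0 :> (R -> R) by apply/funext => v; rewrite big_nil.
    rewrite big_nil Rintegral_cst1; split => //.
    apply: (@bounded_integrable _ _ _ P (cst (0 : R)) 0) => // x; by rewrite normr0.
  have -> : (fun v => \sum_(t <- t :: l) t.1.1 * cos (t.1.2 * v + t.2)) =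
      (fun v => t.1.1 * cos (t.1.2 * v + t.2) +
        \sum_(t <- l) t.1.1 * cos (t.1.2 * v + t.2)).
    by apply/funext => v; rewrite big_cons.
  have it : P.-integrable setT (EFin \o (fun v => t.1.1 * cos (t.1.2 * v + t.2))).
    have := integrableZl measurableT t.1.1 (integrable_cos_affine P t.1.2 t.2).
    by apply: eq_integrable => // x _; rewrite /= EFinM.
  rewrite big_cons RintegralD// IH1 RintegralZl//; last exact: integrable_cos_affine.
  split=> //.
  have := integrableD measurableT it IH2.
  by apply: eq_integrable => // x _; rewrite /= EFinD.
rewrite (key mu).1 (key nu).1; apply: eq_bigr => t _; by rewrite munu.
Qed.

Lemma bernoulli_ineq (x : R) n : -1 <= x -> 1 + n%:R * x <= (1 + x) ^+ n.
Proof.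
move=> x1; elim: n => [|n IH]; first by rewrite mul0r addr0 expr0.
rewrite exprS -natr1; apply: le_trans (ler_wpM2l _ IH); last by lra.
have : 0 <= n%:R * x ^+ 2 by rewrite mulr_ge0// sqr_ge0.
lra.
Qed.

(** With w = sqrt z, Bernoulli's inequality for 1 / w = 1 + h bounds n w^n by 1 / h, and the
    remaining factor w^n tends to 0. *)
Lemma cvg_mulrn_expr (z : R) : 0 <= z < 1 -> n%:R * z ^+ n @[n --> \oo] --> (0 : R).
Proof.
move=> /andP[z0 z1]; have [->|zn0] := eqVneq z 0.
  apply: cvg_near_cst; apply: nearW => -[|n]; first by rewrite mul0r.
  by rewrite expr0n mulr0.
pose w := Num.sqrt z.
have w0 : 0 < w by rewrite sqrtr_gt0 lt_neqAle eq_sym zn0.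
have w1 : w < 1 by rewrite -sqrtr1 ltr_sqrt.
pose h := w^-1 - 1.
have h0 : 0 < h by rewrite subr_gt0 invf_gt1.
have bnd n : n%:R * z ^+ n <= h^-1 * w ^+ n.
  have wn0 : 0 < w ^+ n by rewrite exprn_gt0.
  rewrite -[z]sqr_sqrtr// -/w expr2 exprMn mulrA ler_pM2r//.
  rewrite -[leRHS]mul1r ler_pdivlMr//.
  have h1 : -1 <= h by lra.
  have := bernoulli_ineq n h1; rewrite (_ : 1 + h = w^-1); last by rewrite /h addrC subrK.
  rewrite exprVn -[leRHS]div1r ler_pdivlMr// mulrDl mul1r; lra.
apply: (@squeeze_cvgr _ _ _ _ (fun=> 0) (fun n => h^-1 * w ^+ n)).
- by apply: nearW => n; rewrite bnd andbT mulr_ge0// exprn_ge0.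
- exact: cvg_cst.
- rewrite -[X in _ --> X](mulr0 h^-1); apply: cvgMr.
  by apply: cvg_expr; rewrite ger0_norm// ltW.
Qed.

(* Tends to the indicator of y < 1/2 and is a polynomial in y, hence a
   trigonometric polynomial in v when y is one. *)
Definition separator n (y : R) : R := (1 - y ^+ n) ^+ (n * 2 ^ n).

Lemma separator_itv n y : 0 <= y <= 1 -> 0 <= separator n y <= 1.
Proof.
move=> /andP[y0 y1]; have yn0 : 0 <= y ^+ n by rewrite exprn_ge0.
have yn1 : y ^+ n <= 1 by rewrite exprn_ile1.
by rewrite exprn_ge0 ?subr_ge0//= exprn_ile1// ?subr_ge0// gerBl.
Qed.

(** Bernoulli's inequality decides both cases, since the exponent times y^n is n (2 y)^n, which
    tends to 0 below 1/2 and is at least n from 1/2 on. In the second case it is applied to 1 + y^n,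
    whose product with 1 - y^n is at most 1. *)
Lemma cvg_separator y : 0 <= y <= 1 ->
  separator n y @[n --> \oo] --> ((y < 2^-1)%R%:R : R).
Proof.
move=> y01; have /andP[y0 y1] := y01.
have yn0 n : 0 <= y ^+ n by rewrite exprn_ge0.
have yn1 n : y ^+ n <= 1 by rewrite exprn_ile1.
have NE n : (n * 2 ^ n)%:R * y ^+ n = n%:R * (2 * y) ^+ n :> R.
  by rewrite natrM natrX exprMn mulrA.
have [yh|yh] := ltP y 2^-1.
  apply: (@squeeze_cvgr _ _ _ _ (fun n => 1 - n%:R * (2 * y) ^+ n) (fun=> 1)).
  - apply: nearW => n; have /andP[_ ->] := separator_itv n y01; rewrite andbT.
    rewrite -NE -mulrN; apply: bernoulli_ineq; by rewrite lerN2.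
  - rewrite -[X in _ --> X]subr0; apply: cvgB; first exact: cvg_cst.
    by apply: cvg_mulrn_expr; rewrite mulr_ge0//=; lra.
  - exact: cvg_cst.
apply: (@squeeze_cvgr _ _ _ _ (fun=> 0) (@harmonic R)).
- apply: nearW => n; have /andP[-> _] := separator_itv n y01 => /=.
  rewrite /harmonic -[leRHS]mul1r ler_pdivlMr//.
  apply: le_trans (_ : separator n y * (1 + y ^+ n) ^+ (n * 2 ^ n) <= 1).
    rewrite ler_wpM2l//; first by have /andP[] := separator_itv n y01.
    apply: le_trans (bernoulli_ineq (n * 2 ^ n) _); last by rewrite (le_trans _ (yn0 n)).
    rewrite NE -natr1 addrC lerD2l -[leLHS]mulr1 ler_wpM2l// exprn_ege1//; lra.
  rewrite /separator -exprMn exprn_ile1//.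
    by rewrite mulr_ge0// ?subr_ge0// addr_ge0.
  have : 0 <= y ^+ n * y ^+ n by rewrite mulr_ge0.
  lra.
- exact: cvg_cst.
- exact: cvg_harmonic.
Qed.

Section phase_inj.
Variables mu nu : borel_probability R.
Hypothesis munu : forall xi th, phase mu xi th = phase nu xi th.

Lemma Rintegral_cos_gt (c xi th : R) : -1 <= c <= 1 ->
  \int[mu]_v ((c < cos (xi * v + th))%R%:R) = \int[nu]_v ((c < cos (xi * v + th))%R%:R).
Proof.
move=> /andP[c0 c1].
(* An affine function of the cosine with values in [0, 1], below 1/2 exactly when the cosine exceeds
   c. *)
pose y v := 2^-1 + (c - cos (xi * v + th)) / 4.
have y01 v : 0 <= y v <= 1.
  by have := cos_geN1 (xi * v + th); have := cos_le1 (xi * v + th); rewrite /y; lra.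
have my : measurable_fun setT y.
  apply: measurable_funD => //; apply: measurable_funM => //.
  by apply: measurable_funB => //; exact: measurable_cos_affine.
have ms n : measurable_fun setT (fun v => separator n (y v)).
  rewrite /separator; apply: measurable_funX; apply: measurable_funB => //.
  exact: measurable_funX.
have s1 n v : `|separator n (y v)| <= 1.
  by have /andP[? ?] := separator_itv n (y01 v); rewrite ger0_norm.
have cs v : separator n (y v) @[n --> \oo] --> ((c < cos (xi * v + th))%R%:R : R).
  have -> : (c < cos (xi * v + th)) = (y v < 2^-1).
    by apply/idP/idP; rewrite /y; lra.
  exact: cvg_separator.
have eqn n : \int[mu]_v separator n (y v) = \int[nu]_v separator n (y v).
  apply: Rintegral_trigpoly => //; apply: trigpolyX.
  have : trigpoly (fun v => 1 + (-1) * y v ^+ n).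
    apply: trigpolyD; first exact: trigpoly_cst.
    apply: trigpolyZ; apply: trigpolyX.
    have -> : y = (fun v => (2^-1 + c / 4) + (- 4^-1) * cos (xi * v + th)).
      by apply/funext => v; rewrite /y; lra.
    apply: trigpolyD; first exact: trigpoly_cst.
    exact/trigpolyZ/trigpoly_cos.
  by congr trigpoly; apply/funext => v; rewrite mulN1r.
have := bounded_cvg_Rintegral (P := mu) ms s1 cs.
under eq_cvg do rewrite eqn.
move=> /cvg_unique; apply => //; exact: bounded_cvg_Rintegral.
Qed.

(** For small xi, the set where cos (xi (v - m)) exceeds cos (r xi) is the interval of centre m and
    radius r together with its translates by multiples of 2 pi / xi. As xi tends to 0 the translates
    leave every bounded region. *)
Lemma phase_inj_itv (x y : R) : mu `]x, y[%classic = nu `]x, y[%classic.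
Proof.
have [yx|xy] := leP y x; first by rewrite set_itv_ge ?measure0// bnd_simp -leNgt.
pose m := (x + y) / 2; pose r := (y - x) / 2.
have r0 : 0 < r by rewrite /r; lra.
pose xi (n : nat) : R := n.+1%:R^-1.
have xi0 n : 0 < xi n by rewrite invr_gt0.
pose f n v : R := (cos (r * xi n) < cos (xi n * v + (- m * xi n)))%R%:R.
have fcvg v : f n v @[n --> \oo] --> (\1_(`]x, y[%classic) v : R).
  have -> : \1_(`]x, y[%classic) v = (`|v - m| < r)%R%:R :> R.
    rewrite indicE mem_setE in_itv/= ltr_norml; congr ((nat_of_bool _)%:R).
    by apply/idP/idP; rewrite /m /r; lra.
  apply: cvg_near_cst; near=> n.
  (* Puts both arguments in [0, pi], where the cosine is decreasing. *)
  have bn : `|v - m| + r <= pi * n.+1%:R.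
    rewrite mulrC -ler_pdivrMr ?pi_gt0//.
    apply: (@le_trans _ _ n%:R); last by rewrite ler_nat.
    near: n.
    exact: nbhs_infty_ger.
  rewrite /f; congr ((nat_of_bool _)%:R).
  have -> : cos (xi n * v + - m * xi n) = cos (`|v - m| * xi n).
    have -> : xi n * v + - m * xi n = (v - m) * xi n by ring.
    have [vm|vm] := leP 0 (v - m); first by rewrite ger0_norm.
    by rewrite ltr0_norm// mulNr cosN.
  have le_pi a : 0 <= a -> a <= pi * n.+1%:R -> a * xi n \in `[0, pi].
    move=> a0 api; rewrite in_itv/=; apply/andP; split.
      by rewrite mulr_ge0// ltW.
    by rewrite ler_pdivrMr.
  have hr : r * xi n \in `[0, pi].
    by apply: le_pi; [exact: ltW|apply: le_trans bn; rewrite lerDr].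
  have hv : `|v - m| * xi n \in `[0, pi].
    by apply: le_pi => //; apply: le_trans bn; rewrite lerDl ltW.
  by rewrite ltr_cos// ltr_pM2r.
have mf n : measurable_fun setT (f n).
  apply: (@measurableT_comp _ _ _ _ _ _ (fun b : bool => b%:R : R)) => //.
  by apply: measurable_fun_ltr => //; exact: measurable_cos_affine.
have f1 n v : `|f n v| <= 1 by rewrite /f; case: (_ < _) => /=; rewrite ?normr1// normr0.
have eqn n : \int[mu]_v f n v = \int[nu]_v f n v.
  by apply: Rintegral_cos_gt; rewrite cos_geN1 cos_le1.
have : \int[mu]_v (\1_(`]x, y[%classic) v : R) = \int[nu]_v (\1_(`]x, y[%classic) v : R).
  have := bounded_cvg_Rintegral (P := mu) mf f1 fcvg.
  under eq_cvg do rewrite eqn.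
  by move=> /cvg_unique; apply => //; exact: bounded_cvg_Rintegral.
have indicE (P : borel_probability R) :
    \int[P]_v (\1_(`]x, y[%classic) v : R) = fine (P `]x, y[%classic).
  by rewrite /Rintegral integral_indic// setIT.
rewrite !indicE => h; have := congr1 EFin h.
by rewrite !fineK//; exact: fin_num_measure.
Unshelve. all: by end_near. Qed.

Lemma phase_inj : same_measure mu nu.
Proof.
move=> A mA.
pose g (n : nat) : set R := `](- (n%:R)), (n%:R)[%classic.
apply: (@measure_unique _ R _ (RGenOpens.G (R := R)) g _ _ _ _ mu nu) => //.
- exact: RGenOpens.measurableE.
- move=> _ _ [a [b ->]] [c [d ->]]; exists (Num.max a c), (Num.min b d).
  apply/seteqP; split=> z /=; rewrite !in_itv/= gt_max lt_min.
    by move=> [/andP[-> ->] /andP[-> ->]].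
  by move=> /andP[/andP[-> ->] /andP[-> ->]].
- by move=> n; exists (- n%:R), n%:R.
- rewrite -subTset => z _; exists (Num.truncn `|z|).+1 => //=.
  by rewrite /g/= in_itv/= -ltr_norml truncnS_gt.
- by move=> B [a [b ->]]; exact: (phase_inj_itv a b).
- by move=> n; apply: le_lt_trans (ltry 1); apply: probability_le1; exact: measurable_itv.
Qed.

End phase_inj.
End trigonometric_polynomials.

(** * Contraction of the Fourier flow *)

Section comparison.
Context {R : realType}.

Lemma is_derive_continuous (f : R -> R) (x df : R) :
  is_derive x 1 f df -> {for x, continuous f}.
Proof.
by move=> [dfx _]; apply/differentiable_continuous/derivable1_diffP.
Qed.

Lemma le_initial (k k' : R -> R) :
  k x @[x --> 0^'+] --> k 0 ->
  (forall x : R, 0 < x -> is_derive x 1 k (k' x)) ->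
  (forall x, 0 < x -> k' x <= 0) -> forall t, 0 <= t -> k t <= k 0.
Proof.
move=> k0 dk k'le0 t; rewrite le_eqVlt => /predU1P[<-//|t0].
have ck x : 0 < x -> {for x, continuous k} by move=> /dk; exact: is_derive_continuous.
have [||c] := @MVT R k k' 0 t t0.
- by move=> x; rewrite in_itv/= => /andP[x0 _]; exact: dk.
- apply/continuous_within_itvP => //; split => //.
    by move=> x; rewrite in_itv/= => /andP[x0 _]; exact: ck.
  by apply: cvg_at_left_filter; exact: ck.
rewrite in_itv/= => /andP[c0 ct]; rewrite subr0 => h.
rewrite -subr_le0 h mulr_le0_ge0//; [exact: k'le0|exact: ltW].
Qed.

Lemma is_derive_expRM (a x : R) :
  is_derive x 1 (fun t => expR (a * t)) (a * expR (a * x)).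
Proof.
have da : is_derive x (1 : R) (fun t : R => a * t) a.
  by apply: is_derive_eq (is_deriveZ a (is_derive_id x 1)) _; rewrite /GRing.scale/= mulr1.
have d := @is_derive1_comp R expR (fun t => a * t) x _ _ (is_derive_expR _) da.
by apply: is_derive_eq d _; exact: mulrC.
Qed.

(** Here exp_coeff (2 t) n is (2 t)^n / n!, the error left by the n-th Picard iterate below. *)
Lemma is_derive_exp_coeff n (x : R) :
  is_derive x 1 (fun t => exp_coeff (2 * t) n.+1) (2 * exp_coeff (2 * x) n).
Proof.
have -> : (fun t : R => exp_coeff (2 * t) n.+1) =
    (2 ^+ n.+1 / n.+1`!%:R) \*: (@id R ^+ n.+1).
  by apply/funext => t; rewrite /exp_coeff /= exprMn mulrAC fctE.
have d := @is_deriveZ _ _ _ _ (2 ^+ n.+1 / n.+1`!%:R) x 1 _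
  (@is_deriveX _ _ (@id R) n.+1 x 1 1 (is_derive_id _ _)).
apply: is_derive_eq d _.
rewrite /exp_coeff /= /GRing.scale/= mulr1 exprMn factS natrM exprS.
have h : n`!%:R != 0 :> R by rewrite pnatr_eq0 -lt0n fact_gt0.
by field; rewrite h nat1r pnatr_eq0.
Qed.

End comparison.

Section flow.
Context {R : realType}.
Variables p q : R.
Hypotheses (p0 : 0 < p) (q0 : 0 < q).
Implicit Types f g : R -> borel_probability R.

Definition fourier_flow f := forall xi th,
  phase (f t) xi th @[t --> 0^'+] --> phase (f 0) xi th /\
  forall t : R, 0 < t -> is_derive t 1 (fun s => phase (f s) xi th)
    (phase (conv p q (f t)) xi th - phase (f t) xi th).

(* Picard iteration: the n-th step leaves the error 2 (2t)^n / n!, starting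
   from the trivial bound 2 *)
Lemma fourier_flow_contract f g (s D : R) :
  fourier_flow f -> fourier_flow g -> 0 <= D ->
  (forall xi, phase_close (f 0) (g 0) xi (D * `|xi| `^ s)) ->
  forall t xi, 0 <= t -> phase_close (f t) (g t) xi
    (D * `|xi| `^ s * expR ((p `^ s + q `^ s - 1) * t)).
Proof.
move=> ff fg D0 init.
pose a := p `^ s + q `^ s.
pose c (xi : R) := D * `|xi| `^ s.
have c0 xi : 0 <= c xi by rewrite mulr_ge0// powR_ge0.
have step n : forall t xi : R, 0 <= t -> phase_close (f t) (g t) xi
    (c xi * expR ((a - 1) * t) + 2 * exp_coeff (2 * t) n).
  elim: n => [|n IH] t xi t0.
    apply: phase_close_le (@phase_close2 _ _ _ _).
    rewrite /exp_coeff /= expr0 divr1 mulr1 lerDr.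
    by rewrite mulr_ge0// expR_ge0.
  move=> th.
  pose w t := phase (f t) xi th - phase (g t) xi th.
  pose Q t := phase (conv p q (f t)) xi th - phase (conv p q (g t)) xi th.
  (* This is e^t times the bound claimed at rank n + 1. The factor e^t removes the loss term: the
     derivative of e^t w is e^t Q. *)
  pose B t := c xi * expR (a * t) + 2 * (expR t * exp_coeff (2 * t) n.+1).
  pose B' t := c xi * (a * expR (a * t)) +
    2 * (expR t * (2 * exp_coeff (2 * t) n) + exp_coeff (2 * t) n.+1 * expR t).
  have dw (x : R) : 0 < x -> is_derive x 1 w (Q x - w x).
    move=> x0; have [_ /(_ x x0) df] := ff xi th; have [_ /(_ x x0) dg] := fg xi th.
    by apply: is_derive_eq (is_deriveB df dg) _; rewrite /Q /w; ring.
  have dB (x : R) : is_derive x 1 B (B' x).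
    apply: is_deriveD.
      exact: (is_deriveZ (c xi) (is_derive_expRM a x)).
    have := is_deriveM (is_derive_expR x) (is_derive_exp_coeff n x).
    exact: is_deriveZ.
  pose k t := expR t * w t - B t.
  have dk (x : R) : 0 < x -> is_derive x 1 k (expR x * Q x - B' x).
    move=> /dw dwx.
    have := is_deriveB (is_deriveM (is_derive_expR x) dwx) (dB x).
    by move=> /is_derive_eq; apply; rewrite /GRing.scale/=; ring.
  (* The error terms at p xi and q xi add up to 4 (2 x)^n / n!, which is the derivative of 2 (2
     x)^(n+1) / (n+1)!. *)
  have Qle x : 0 < x -> expR x * Q x <= B' x.
    move=> x0.
    have := phase_close_conv (p := p) (q := q) (IH x (p * xi) (ltW x0)) (IH x (q * xi) (ltW x0)) th.
    have -> : c (p * xi) = c xi * p `^ s.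
      by rewrite /c normrM (gtr0_norm p0) powRM ?(ltW p0)//; ring.
    have -> : c (q * xi) = c xi * q `^ s.
      by rewrite /c normrM (gtr0_norm q0) powRM ?(ltW q0)//; ring.
    rewrite -/(Q x) => hQ.
    apply: le_trans (ler_wpM2l (expR_ge0 x) hQ) _.
    have eE : expR x * expR ((a - 1) * x) = expR (a * x).
      by rewrite -expRD; congr expR; ring.
    have : 0 <= exp_coeff (2 * x) n.+1 * expR x.
      by rewrite mulr_ge0 ?expR_ge0// exp_coeff_ge0// mulr_ge0// ltW.
    rewrite /B' -eE /a; nra.
  have k0cvg : k x @[x --> 0^'+] --> k 0.
    have [cf _] := ff xi th; have [cg _] := fg xi th.
    apply: cvgB; last first.
      by apply: cvg_at_right_filter; exact: is_derive_continuous (dB 0).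
    apply: cvgM; last exact: cvgB.
    by apply: cvg_at_right_filter; exact: continuous_expR.
  have := le_initial k0cvg dk _ t0.
  have k00 : k 0 <= 0.
    rewrite /k /B /exp_coeff /= !mulr0 expR0 exprS !(mul0r,mulr0,mul1r,mulr1,addr0).
    by rewrite subr_le0; exact: init.
  move=> /(_ _)/le_trans/(_ k00) h.
  have : k t <= 0 by apply: h => x x0; rewrite subr_le0; exact: Qle.
  rewrite /k /B subr_le0 => {}h.
  rewrite -(ler_pM2l (expR_gt0 t)); apply: le_trans h _.
  have -> : expR (a * t) = expR t * expR ((a - 1) * t).
    by rewrite -expRD; congr expR; ring.
  lra.
move=> t xi t0 th.
have : (c xi * expR ((a - 1) * t) + 2 * exp_coeff (2 * t) n) @[n --> \oo] -->
    c xi * expR ((a - 1) * t) + 2 * 0.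
  by apply: cvgD; [exact: cvg_cst|apply: cvgMr; exact: cvg_exp_coeff].
rewrite mulr0 addr0 => cv.
apply: (ler_cvg_to (cvg_cst (phase (f t) xi th - phase (g t) xi th)) cv).
by apply: nearW => n; exact: step.
Qed.

End flow.

(** * Phases and the complex Fourier transform *)

Section fourier.
Context {R : realType}.
Implicit Types mu nu : borel_probability R.

Lemma exists_polar (a b : R) : exists th,
  a = Num.sqrt (a ^+ 2 + b ^+ 2) * cos th /\ b = Num.sqrt (a ^+ 2 + b ^+ 2) * sin th.
Proof.
set r := Num.sqrt _.
have r2 : r ^+ 2 = a ^+ 2 + b ^+ 2 by rewrite sqr_sqrtr// addr_ge0 ?sqr_ge0.
have [r0|r0] := eqVneq r 0.
  have /eqP : a ^+ 2 + b ^+ 2 = 0 by rewrite -r2 r0 expr0n.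
  rewrite paddr_eq0 ?sqr_ge0// !sqrf_eq0 => /andP[/eqP -> /eqP ->].
  by exists 0; rewrite r0 !mul0r.
have rp : 0 < r by rewrite lt_neqAle eq_sym r0 sqrtr_ge0.
have ar : -1 <= a / r <= 1.
  rewrite -ler_norml -(@ler_pXn2r _ 2)// ?nnegrE// expr1n real_normK ?num_real//.
  rewrite expr_div_n r2 ler_pdivrMr ?mul1r ?lerDl ?sqr_ge0// -r2 exprn_gt0//.
have br : Num.sqrt (1 - (a / r) ^+ 2) = `|b| / r.
  have -> : 1 - (a / r) ^+ 2 = (b / r) ^+ 2.
    rewrite !expr_div_n -[1](@divff _ (r ^+ 2)) ?expf_neq0// -mulrBl; congr (_ / _).
    by rewrite r2 addrC addKr.
  by rewrite sqrtr_sqr normrM normfV (gtr0_norm rp).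
have cosE : r * cos (acos (a / r)) = a by rewrite acosK// mulrC divfK.
have sinE : r * sin (acos (a / r)) = `|b| by rewrite sin_acos// br mulrC divfK.
have [b0|b0] := leP 0 b.
  by exists (acos (a / r)); rewrite cosE sinE ger0_norm.
exists (- acos (a / r)); rewrite cosN sinN mulrN cosE sinE.
by rewrite ltr0_norm// opprK.
Qed.

Lemma cos_sin_le_sqrt (a b th : R) :
  a * cos th + b * sin th <= Num.sqrt (a ^+ 2 + b ^+ 2).
Proof.
have [u []] := exists_polar a b.
have : 0 <= Num.sqrt (a ^+ 2 + b ^+ 2) by exact: sqrtr_ge0.
move: (Num.sqrt _) => r r0 -> ->.
have -> : r * cos u * cos th + r * sin u * sin th = r * cos (u - th).
  by rewrite cosB; ring.
by rewrite ler_piMr// cos_le1.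
Qed.

Lemma phase_fourier mu xi th : phase mu xi th =
  complex.Re (fourier mu xi) * cos th + complex.Im (fourier mu xi) * sin th.
Proof.
have ic : mu.-integrable setT (EFin \o (fun v => cos (xi * v))).
  by have := integrable_cos_affine mu xi 0; under [X in EFin \o X]eq_fun do rewrite addr0.
have is_ : mu.-integrable setT (EFin \o (fun v => - sin (xi * v))).
  have := integrable_cos_affine mu xi (pi / 2).
  by under [X in EFin \o X]eq_fun do rewrite cosDpihalf.
rewrite /fourier /Cintegral /cexpNi /= -!RintegralZr//.
rewrite -RintegralD//.
- by apply: eq_Rintegral => v _; rewrite cosD mulNr.
- have := integrableZr measurableT (cos th) ic.
  by apply: eq_integrable => // v _; rewrite /= EFinM.
- have := integrableZr measurableT (sin th) is_.
  by apply: eq_integrable => // v _; rewrite /= EFinM.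
Qed.

(** When th is the polar angle of the complex difference, the difference of phases equals its
    modulus. *)
Lemma phase_closeP mu nu xi B : phase_close mu nu xi B <->
  ComplexField.Normc.normc (fourier mu xi - fourier nu xi) <= B.
Proof.
have E th : phase mu xi th - phase nu xi th =
  (complex.Re (fourier mu xi) - complex.Re (fourier nu xi)) * cos th +
  (complex.Im (fourier mu xi) - complex.Im (fourier nu xi)) * sin th.
  by rewrite !phase_fourier; ring.
rewrite /phase_close; under eq_forall do rewrite E.
case: (fourier mu xi) => a1 b1; case: (fourier nu xi) => a2 b2 /=.
split=> [h|h th]; last exact: le_trans (cos_sin_le_sqrt _ _ _) h.
have [th [ha hb]] := exists_polar (a1 - a2) (b1 - b2).
have := h th.
set r := Num.sqrt _ in ha hb *; rewrite {1}ha {1}hb.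
suff -> : r * cos th * cos th + r * sin th * sin th = r by [].
by rewrite -!mulrA -mulrDr -!expr2 cos2Dsin2 mulr1.
Qed.

Lemma fourier_distP (s C : R) mu nu : s != 0 ->
  (fourier_dist s mu nu <= C%:E)%E <->
  (0 <= C /\ forall xi, phase_close mu nu xi (C * `|xi| `^ s)).
Proof.
move=> s0; split=> [h|[C0 h]].
  have hx xi : xi != 0 -> ComplexField.Normc.normc (fourier mu xi - fourier nu xi)
      <= C * `|xi| `^ s.
    move=> xi0; rewrite -ler_pdivrMr ?powR_gt0 ?normr_gt0//.
    rewrite -lee_fin; apply: le_trans h; apply: ereal_sup_ubound.
    by exists xi.
  split.
    have := hx 1 (oner_neq0 _); rewrite normr1 powR1 mulr1; apply: le_trans.
    by case: (_ - _) => a b; exact: sqrtr_ge0.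
  (* The supremum leaves out xi = 0, where both phases are cos th and the bound is 0 because s is
     nonzero. *)
  move=> xi; have [->|xi0] := eqVneq xi 0; last exact/phase_closeP/hx.
  by move=> th; rewrite !phase0 subrr normr0 powR0// mulr0.
apply: ge_ereal_sup => _ [xi xi0 <-].
rewrite lee_fin ler_pdivrMr ?powR_gt0 ?normr_gt0//; exact/phase_closeP.
Qed.

Lemma fourier_dist_ge0 (s : R) mu nu : (0 <= fourier_dist s mu nu)%E.
Proof.
apply: ereal_sup_ge; exists ((ComplexField.Normc.normc (fourier mu 1 - fourier nu 1)
  / `|1| `^ s)%:E); first by exists 1 => //=; exact: oner_neq0.
rewrite lee_fin divr_ge0 ?powR_ge0//.
by case: (_ - _) => a b; exact: sqrtr_ge0.
Qed.

End fourier.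

(** * Weak solutions tested on cosines *)

Section weak_solution_flow.
Context {R : realType}.
Variables p q : R.

(** Each derivative shifts the phase by pi / 2, so a single formula covers all n and bounds every
    derivative. *)
Lemma derive1n_cos_affine (xi th : R) n : ((fun v : R => cos (xi * v + th))^`(n))%classic =
  (fun v => xi ^+ n * cos (xi * v + (th + n%:R * (pi / 2)))).
Proof.
elim: n => [|n IH].
  by rewrite derive1n0; apply/funext => v; rewrite expr0 mul1r mul0r addr0.
rewrite derive1nS IH; apply/funext => v; rewrite derive1E.
have da : is_derive v (1 : R) (fun v : R => xi * v + (th + n%:R * (pi / 2))) (xi + 0).
  apply: is_deriveD.
  by apply: is_derive_eq (is_deriveZ xi (is_derive_id v 1)) _; rewrite /GRing.scale/= mulr1.
have dc := @is_derive1_comp R cos _ v _ _ (is_derive_cos _) da.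
have dd := is_deriveZ (xi ^+ n) dc.
have [_ e] := dd; rewrite [LHS]e /GRing.scale/= addr0 exprS.
have -> : xi * v + (th + n.+1%:R * (pi / 2)) =
  (xi * v + (th + n%:R * (pi / 2))) + pi / 2 by rewrite -natr1; ring.
by rewrite cosDpihalf; ring.
Qed.

Lemma test_fun_cos (xi th : R) : test_fun (fun v : R => cos (xi * v + th)).
Proof.
move=> n; rewrite derive1n_cos_affine; split=> [x|].
  have da : is_derive x (1 : R) (fun v : R => xi * v + (th + n%:R * (pi / 2))) (xi + 0).
    apply: is_deriveD.
    by apply: is_derive_eq (is_deriveZ xi (is_derive_id x 1)) _; rewrite /GRing.scale/= mulr1.
  have dc := @is_derive1_comp R cos _ x _ _ (is_derive_cos _) da.
  by have [] := is_deriveZ (xi ^+ n) dc.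
by exists `|xi ^+ n| => x; rewrite normrM ler_piMr// normr_cos_le1.
Qed.

Lemma weak_solution_flow a (f0 : borel_probability R) f :
  weak_solution p q a f0 f ->
  fourier_flow p q f /\ forall xi th, phase (f 0) xi th = phase f0 xi th.
Proof.
move=> [_ _ hC1 hd h0].
(* Convergence of the difference quotient at 0 gives right-continuity there; compared with the limit
   prescribed by the initial condition, it gives [f 0] the phases of [f0]. *)
have cont xi th : phase (f t) xi th @[t --> 0^'+] --> phase (f 0) xi th.
  have [F' _ /(_ 0 (lexx _)) dF] := hC1 _ (test_fun_cos xi th).
  have sub : (0 : R)^'+ `=>` within [set s : R | 0 <= s] 0^'.
    move=> A hA.
    have {}hA : nbhs (0 : R) [set x | x != 0 -> 0 <= x -> A x] := hA.
    suff : nbhs (0 : R) [set x | 0 < x -> A x] by [].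
    apply: filterS hA => x /= h x0.
    by apply: h; [rewrite gt_eqF|exact: ltW].
  have {}dF := cvg_trans (cvg_app _ sub) dF.
  have cid : (s - 0 : R) @[s --> 0^'+] --> (0 : R).
    under eq_cvg do rewrite subr0.
    by apply: cvg_at_right_filter; exact: cvg_id.
  have : (phase (f s) xi th - phase (f 0) xi th) / (s - 0) * (s - 0) +
      phase (f 0) xi th @[s --> 0^'+] --> F' 0 * 0 + phase (f 0) xi th.
    by apply: cvgD; [exact: cvgM|exact: cvg_cst].
  rewrite mulr0 add0r; apply: cvg_trans; apply: near_eq_cvg; near=> s.
  by rewrite subr0 divfK ?subrK// gt_eqF.
split=> [xi th|xi th].
  split=> // t t0; have := hd _ (test_fun_cos xi th) t t0.
  rewrite (@collision_conv _ _ _ _ 1)//; first exact: measurable_cos_affine.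
  by move=> x; exact: normr_cos_le1.
have := h0 _ (test_fun_cos xi th); exact: cvg_unique (cont xi th).
Unshelve. all: by end_near. Qed.

End weak_solution_flow.

(** * Moments *)

Section power_inequalities.
Context {R : realType}.
Implicit Types a b s r : R.

Lemma measurable_powR_norm s : measurable_fun setT (fun v : R => `|v| `^ s).
Proof. by apply: (measurableT_comp (measurable_powR s)); exact: normr_measurable. Qed.

Lemma powRS1 a s : 0 <= a -> 1 <= s -> a `^ s = a * a `^ (s - 1).
Proof. by move=> a0 s1; rewrite mulr_powRB1//; lra. Qed.

Lemma powR2D a r : 0 <= a -> 0 <= r -> a `^ (2 + r) = a ^+ 2 * a `^ r.
Proof.
move=> a0 r0; rewrite powRD ?powR_mulrn//.
by apply/implyP => /eqP; lra.
Qed.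

(** The fractions a / (a + b) and b / (a + b) add up to 1 and, lying in [0, 1], do not decrease when
    raised to a power r <= 1. *)
Lemma powR_subadditive a b r : 0 <= a -> 0 <= b -> 0 < r <= 1 ->
  (a + b) `^ r <= a `^ r + b `^ r.
Proof.
move=> a0 b0 /andP[r0 r1]; have [ab0|ab0] := eqVneq (a + b) 0.
  by rewrite ab0 powR0 ?gt_eqF// addr_ge0// powR_ge0.
have abp : 0 < a + b by rewrite lt_neqAle eq_sym ab0 addr_ge0.
have aux c : 0 <= c -> c <= a + b -> c / (a + b) * (a + b) `^ r <= c `^ r.
  rewrite le_eqVlt => /predU1P[<-|c0] cab; first by rewrite !mul0r powR_ge0.
  have u0 : 0 < c / (a + b) by rewrite divr_gt0.
  rewrite -[X in _ <= X `^ _](divfK ab0) powRM ?(ltW u0) ?(ltW abp)//.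
  by rewrite ler_wpM2r ?powR_ge0// ger1_powR// u0 ler_pdivrMr// mul1r.
apply: le_trans (_ : a / (a + b) * (a + b) `^ r + b / (a + b) * (a + b) `^ r <= _).
  by rewrite -mulrDl -mulrDl divff// mul1r.
by apply: lerD; apply: aux => //; rewrite ?lerDl ?lerDr.
Qed.

(** Mean value theorem: the intermediate point is at most a + b <= 2 a, whence the factor 2^(s -
    1). *)
Lemma powR_tangent_le a b s : 0 <= b <= a -> 1 <= s ->
  (a + b) `^ s <= a `^ s + s * 2 `^ (s - 1) * (a `^ (s - 1) * b).
Proof.
move=> /andP[b0 ba] s1; move: b0; rewrite le_eqVlt => /predU1P[<-|b0].
  by rewrite addr0 !mulr0 addr0.
have a0 : 0 < a by exact: lt_le_trans ba.
have s0 : 0 < s by lra.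
have d x : x \in `]a, a + b[%R -> is_derive x (1 : R) (fun y : R => y `^ s) (s * x `^ (s - 1)).
  by rewrite in_itv/= => /andP[ax _]; apply: is_derive1_powR; exact: lt_trans ax.
have cont : {within `[a, a + b], continuous (fun y : R => y `^ s)}.
  apply: continuous_in_subspaceT => x /set_mem/=; rewrite in_itv/= => /andP[ax _].
  have : is_derive x (1 : R) (fun y : R => y `^ s) (s * x `^ (s - 1)).
    by apply: is_derive1_powR; exact: lt_le_trans ax.
  exact: is_derive_continuous.
have [|c] := MVT _ d cont; first by rewrite ltrDl.
rewrite in_itv/= => /andP[ac cab] /eqP; rewrite subr_eq => /eqP ->.
rewrite addrC lerD2l addrAC subrr add0r -!mulrA ler_pM2l// mulrA ler_pM2r//.
rewrite -powRM ?(ltW a0)//.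
have [h1 h2 h3] : [/\ 0 <= c, 0 <= 2 * a & c <= 2 * a] by split; lra.
by apply: (ge0_ler_powR _ _ _ h3); rewrite ?nnegrE ?subr_ge0.
Qed.

(** The cross terms carry the power s - 1 in one variable and 1 in the other, so that they integrate
    to moments of lower order. *)
Lemma powR_add_le a b s : 0 <= a -> 0 <= b -> 1 <= s ->
  (a + b) `^ s <= a `^ s + b `^ s +
    s * 2 `^ (s - 1) * (a `^ (s - 1) * b + a * b `^ (s - 1)).
Proof.
move=> a0 b0 s1.
have c0 : 0 <= s * 2 `^ (s - 1) by rewrite mulr_ge0 ?powR_ge0//; lra.
have h1 : 0 <= s * 2 `^ (s - 1) * (a `^ (s - 1) * b) by rewrite mulr_ge0// mulr_ge0// powR_ge0.
have h2 : 0 <= s * 2 `^ (s - 1) * (a * b `^ (s - 1)) by rewrite mulr_ge0// mulr_ge0// powR_ge0.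
have [ba|ab] := leP b a.
  have := @powR_tangent_le a b s; rewrite b0 ba => /(_ isT s1).
  have := powR_ge0 b s; lra.
have := @powR_tangent_le b a s; rewrite a0 (ltW ab) => /(_ isT s1).
rewrite [b + a]addrC [_ * a]mulrC; have := powR_ge0 a s; lra.
Qed.

Lemma powR_le_1D a r s : 0 <= a -> 0 <= r <= s -> a `^ r <= 1 + a `^ s.
Proof.
move=> a0 /andP[r0 rs]; have [a1|a1] := leP a 1.
  apply: (@le_trans _ _ (1 `^ r)); first by apply: ge0_ler_powR; rewrite ?nnegrE.
  by rewrite powR1 lerDl powR_ge0.
apply: (@le_trans _ _ (a `^ s)); first by apply: ler_powR => //; exact: ltW.
by rewrite lerDr.
Qed.

(** Cut at a = 1 / e: below it the constant suffices, above it one factor a is worth at least 1 /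
    e. *)
Lemma powR_young a s (e : R) : 0 <= a -> 1 <= s -> 0 < e ->
  a `^ (s - 1) <= e * a `^ s + e^-1 `^ (s - 1).
Proof.
move=> a0 s1 e0; have [ae|ae] := leP a e^-1.
  apply: (@le_trans _ _ (e^-1 `^ (s - 1))).
    by apply: ge0_ler_powR; rewrite ?nnegrE// ?subr_ge0// invr_ge0 ltW.
  by rewrite lerDr mulr_ge0 ?powR_ge0// ltW.
apply: (@le_trans _ _ (e * a `^ s)); last by rewrite lerDl powR_ge0.
rewrite (powRS1 a0 s1) mulrA ler_peMl ?powR_ge0//.
by rewrite mulrC -ler_pdivrMr// div1r ltW.
Qed.

(** A concave power lies below its tangent at 1; this is Young's inequality with second factor 1. *)
Lemma powR_le_affine a r : 0 <= a -> 0 < r < 1 -> a `^ r <= r * a + (1 - r).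
Proof.
move=> a0 /andP[r0 r1].
have r0' : 0 < 1 - r by lra.
have := @conjugate_powR R (a `^ r) 1 r^-1 (1 - r)^-1.
rewrite powR1 mulr1 !invrK -powRrM mulfV ?gt_eqF// powRr1//.
rewrite invr_gt0 r0 invr_gt0 r0' subrKC powR_ge0 => /(_ isT ler01 isT isT erefl).
lra.
Qed.

(** The previous inequality with exponent 1 / r, applied to (1 + x)^r. *)
Lemma powR_bernoulli (x r : R) : 0 <= 1 + x -> 1 <= r -> 1 + r * x <= (1 + x) `^ r.
Proof.
move=> x0; rewrite le_eqVlt => /predU1P[<-|r1]; first by rewrite mul1r powRr1.
have r0 : 0 < r by exact: lt_trans r1.
have i01 : 0 < r^-1 < 1 by rewrite invr_gt0 r0 invf_lt1.
have := powR_le_affine (powR_ge0 (1 + x) r) i01.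
rewrite -powRrM divff ?gt_eqF// powRr1//.
rewrite -(ler_pM2l r0) mulrDr mulr1 mulrDr mulrA divff ?gt_eqF// mul1r mulrBr mulr1 divff ?gt_eqF//.
lra.
Qed.

End power_inequalities.

Section moments.
Context {R : realType}.
Implicit Types mu nu : borel_probability R.

Lemma M_spaceP (a : R) mu :
  M_space a mu <-> mu.-integrable setT (EFin \o (fun v => `|v| `^ a)).
Proof.
rewrite /M_space /abs_moment; split=> [h|/integrableP[_]].
  apply/integrableP; split; first by apply/measurable_EFinP; exact: measurable_powR_norm.
  by under eq_integral do rewrite /= ger0_norm ?powR_ge0//.
by under eq_integral do rewrite /= ger0_norm ?powR_ge0//.
Qed.

Lemma abs_moment_EFin (a : R) mu : M_space a mu ->
  abs_moment a mu = (\int[mu]_v (`|v| `^ a))%:E.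
Proof. by move=> /M_spaceP; exact: ge0_EFin_Rintegral. Qed.

Lemma integrable_lower_moment mu (r s : R) : 0 <= r <= s ->
  mu.-integrable setT (EFin \o (fun v => `|v| `^ s)) ->
  mu.-integrable setT (EFin \o (fun v => `|v| `^ r)).
Proof.
move=> rs si.
have i1 : mu.-integrable setT (EFin \o (fun v => 1 + `|v| `^ s)).
  have i1 : mu.-integrable setT (EFin \o (cst (1 : R))).
    exact: (@bounded_integrable _ _ _ _ (cst (1 : R)) `|1|).
  have := integrableD measurableT i1 si.
  by apply: eq_integrable => // v _; rewrite /= EFinD.
apply: integrable_dominated i1 _; first exact: measurable_powR_norm.
move=> v; rewrite [leRHS]ger0_norm ?addr_ge0 ?powR_ge0// [leLHS]ger0_norm ?powR_ge0//.
exact: powR_le_1D.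
Qed.

(** The real integral is total and says nothing about a non-integrable function, so integrability is
    recorded with the values. *)
Record centered mu (m2 : R) : Prop := Centered {
  centered_int1 : mu.-integrable setT (EFin \o (fun v : R => v));
  centered_mean : \int[mu]_v v = 0;
  centered_int2 : mu.-integrable setT (EFin \o (fun v : R => v ^+ 2));
  centered_var : \int[mu]_v (v ^+ 2) = m2 }.

Lemma integrable_id mu : mu.-integrable setT (EFin \o (fun v : R => v ^+ 2)) ->
  mu.-integrable setT (EFin \o (fun v : R => v)).
Proof.
move=> i2.
have i1 : mu.-integrable setT (EFin \o (fun v : R => 1 + v ^+ 2)).
  have i1 : mu.-integrable setT (EFin \o (cst (1 : R))).
    exact: (@bounded_integrable _ _ _ _ (cst (1 : R)) `|1|).
  have := integrableD measurableT i1 i2.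
  by apply: eq_integrable => // v _; rewrite /= EFinD.
apply: integrable_dominated i1 _; first exact: measurable_id.
move=> v; rewrite [leRHS]ger0_norm ?addr_ge0 ?sqr_ge0//.
by have := sqr_ge0 (`|v| - 1); rewrite sqrrB1 real_normK ?num_real//; have := normr_ge0 v; lra.
Qed.

Lemma normalizedP mu : normalized mu <-> centered mu 1.
Proof.
rewrite /normalized /mean /second_moment; split=> [[h1 h2]|[i1 e1 i2 e2]].
  have i2 : mu.-integrable setT (EFin \o (fun v : R => v ^+ 2)).
    apply/integrableP; split; first by apply/measurable_EFinP; exact: measurable_funX.
    under eq_integral do rewrite /= ger0_norm ?sqr_ge0//.
    by rewrite h2 ltry.
  split=> //; [exact: integrable_id|by rewrite /Rintegral h1|by rewrite /Rintegral h2].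
by rewrite !ge0_EFin_Rintegral// e1 e2.
Qed.

End moments.

Section real_integrable.
Context d (T : measurableType d) (R : realType) (P : probability T R).
Implicit Types f g : T -> R.

Lemma integrable_addR f g : P.-integrable setT (EFin \o f) ->
  P.-integrable setT (EFin \o g) -> P.-integrable setT (EFin \o (fun x => f x + g x)).
Proof.
move=> fi gi; have := integrableD measurableT fi gi.
by apply: eq_integrable => // x _; rewrite /= EFinD.
Qed.

Lemma integrable_mulR (c : R) f : P.-integrable setT (EFin \o f) ->
  P.-integrable setT (EFin \o (fun x => c * f x)).
Proof.
move=> fi; have := integrableZl measurableT c fi.
by apply: eq_integrable => // x _; rewrite /= EFinM.
Qed.

Lemma integrable_cstR (c : R) : P.-integrable setT (EFin \o (fun=> c)).
Proof. exact: (@bounded_integrable _ _ _ _ (cst c) `|c|). Qed.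

End real_integrable.

Section product_moments.
Context {R : realType}.
Variables (mu : borel_probability R).

Lemma integrable_prod_fst (a : R -> R) : mu.-integrable setT (EFin \o a) ->
  (mu \x mu)%E.-integrable setT (EFin \o (fun z => a z.1)) /\
  \int[(mu \x mu)%E]_z a z.1 = \int[mu]_v a v.
Proof.
move=> ai; have b1 := integrable_cstR mu 1.
have E : (fun z : R * R => a z.1) = (fun z => a z.1 * 1).
  by apply/funext => z; rewrite mulr1.
rewrite E; split; first exact: (integrable_prodM ai b1).
by rewrite (Rintegral_prodM ai b1) Rintegral_cst1 mulr1.
Qed.

Lemma integrable_prod_snd (a : R -> R) : mu.-integrable setT (EFin \o a) ->
  (mu \x mu)%E.-integrable setT (EFin \o (fun z => a z.2)) /\
  \int[(mu \x mu)%E]_z a z.2 = \int[mu]_v a v.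
Proof.
move=> ai; have b1 := integrable_cstR mu 1.
have E : (fun z : R * R => a z.2) = (fun z => 1 * a z.2).
  by apply/funext => z; rewrite mul1r.
rewrite E; split; first exact: (integrable_prodM b1 ai).
by rewrite (Rintegral_prodM b1 ai) Rintegral_cst1 mul1r.
Qed.

End product_moments.

(** * Moments after one collision *)

Section conv_moments.
Context {R : realType}.
Variables p q : R.
Implicit Types mu nu : borel_probability R.

Lemma Rintegral_conv_integrable mu (f : R -> R) : measurable_fun setT f ->
  (mu \x mu)%E.-integrable setT (EFin \o (fun z => f (p * z.1 + q * z.2))) ->
  (conv p q mu).-integrable setT (EFin \o f) /\
  \int[conv p q mu]_v f v = \int[(mu \x mu)%E]_z f (p * z.1 + q * z.2).
Proof.
by move=> mf fi; split; [exact: integrable_distribution|rewrite Rintegral_distribution].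
Qed.

Lemma centered_conv mu m2 : centered mu m2 ->
  centered (conv p q mu) ((p ^+ 2 + q ^+ 2) * m2).
Proof.
move=> [i1 e1 i2 e2].
have [a1 a1e] := integrable_prod_fst i1; have [b1 b1e] := integrable_prod_snd i1.
have [a2 a2e] := integrable_prod_fst i2; have [b2 b2e] := integrable_prod_snd i2.
have c := integrable_prodM i1 i1; have ce := Rintegral_prodM i1 i1.
have pa := integrable_mulR p a1; have qb := integrable_mulR q b1.
have [|j1 je1] := @Rintegral_conv_integrable mu (fun v => v) (@measurable_id _ _ _).
  exact: (integrable_addR pa qb).
have pa2 := integrable_mulR (p ^+ 2) a2; have qb2 := integrable_mulR (q ^+ 2) b2.
have pqc := integrable_mulR (2 * p * q) c.
have sum2 := integrable_addR pa2 qb2.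
have E : (fun z : R * R => (p * z.1 + q * z.2) ^+ 2) =
  (fun z => p ^+ 2 * z.1 ^+ 2 + q ^+ 2 * z.2 ^+ 2 + 2 * p * q * (z.1 * z.2)).
  by apply/funext => z; ring.
have [||j2 je2] := @Rintegral_conv_integrable mu (fun v => v ^+ 2).
- exact: measurable_funX.
- by rewrite E; exact: (integrable_addR sum2 pqc).
split=> //.
  by rewrite je1 RintegralD// !RintegralZl// a1e b1e e1 !mulr0 addr0.
rewrite je2 E RintegralD// RintegralD// !RintegralZl// a2e b2e ce e1 e2.
by rewrite !mulr0 addr0 mulrDl.
Qed.

Hypotheses (p0 : 0 < p) (q0 : 0 < q).

Definition has_moment (s : R) mu :=
  mu.-integrable setT (EFin \o (fun v => `|v| `^ s)).

Definition moment (s : R) mu := \int[mu]_v (`|v| `^ s).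

Lemma moment_ge0 s mu : 0 <= moment s mu.
Proof. by apply: Rintegral_ge0 => v _; exact: powR_ge0. Qed.

Lemma moment_conv_dominated (s B : R) mu (g : R * R -> R) :
  (mu \x mu)%E.-integrable setT (EFin \o g) ->
  (forall x y, `|p * x + q * y| `^ s <= g (x, y)) ->
  \int[(mu \x mu)%E]_z g z <= B ->
  has_moment s (conv p q mu) /\ moment s (conv p q mu) <= B.
Proof.
move=> gi hg gB.
have fi : (mu \x mu)%E.-integrable setT (EFin \o (fun z => `|p * z.1 + q * z.2| `^ s)).
  apply: integrable_dominated gi _ => [|[x y] /=].
    by apply: (measurableT_comp (measurable_powR_norm s)); exact: measurable_collide.
  by rewrite ger0_norm ?powR_ge0//; apply: le_trans (hg x y) _; exact: ler_norm.
have [h1 h2] := Rintegral_conv_integrable (measurable_powR_norm s) fi.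
split=> //; rewrite /moment h2; apply: le_trans gB.
by apply: (Rintegral_le fi gi) => -[x y] /=.
Qed.

(** Split the power as (p v + q w)^2 times the power delta, which is subadditive. In the expansion
    the terms coming from 2 p q v w have a factor of mean 0, and the mixed terms pair the unit
    second moment with a moment of order delta, which is at most 1. This is where the explicit
    constant comes from. *)
Lemma moment_conv_le1 (delta : R) mu : 0 < delta <= 1 -> centered mu 1 ->
  has_moment (2 + delta) mu ->
  has_moment (2 + delta) (conv p q mu) /\
  moment (2 + delta) (conv p q mu) <=
    (p `^ (2 + delta) + q `^ (2 + delta)) * moment (2 + delta) mu +
    (p ^+ 2 * q `^ delta + q ^+ 2 * p `^ delta).
Proof.
move=> /andP[d0 d1] [i1 e1 i2 e2] is_.
have id : has_moment delta mu by apply: integrable_lower_moment is_; lra.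
(* The factor that multiplies a mean-zero variable in the cross terms. *)
have ix : mu.-integrable setT (EFin \o (fun v : R => v * `|v| `^ delta)).
  apply: (@integrable_dominated _ _ _ mu _ (fun v : R => 1 + `|v| `^ (2 + delta))).
  - by apply: measurable_funM => //; exact: measurable_powR_norm.
  - exact: integrable_addR (integrable_cstR _ 1) is_.
  - move=> v; rewrite normrM [X in _ * X]ger0_norm ?powR_ge0//.
    rewrite [leRHS]ger0_norm ?addr_ge0 ?powR_ge0//.
    have := @powR_le_1D R `|v| (1 + delta) (2 + delta) (normr_ge0 v).
    rewrite (@powRS1 _ _ (1 + delta)) ?normr_ge0//; last by lra.
    rewrite (_ : 1 + delta - 1 = delta); last by ring.
    by apply; lra.
(* Concavity of the power delta / 2 at v^2, whose integral is 1. *)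
have dle : moment delta mu <= 1.
  have i2' := integrable_addR (integrable_mulR (delta / 2) i2)
    (integrable_cstR mu (1 - delta / 2)).
  apply: le_trans (Rintegral_le id i2' _) _ => [v /=|].
    have := @powR_le_affine R (v ^+ 2) (delta / 2) (sqr_ge0 v).
    have -> : (v ^+ 2) `^ (delta / 2) = `|v| `^ delta.
      by rewrite [delta / 2]mulrC powRrM powR12_sqrt ?sqr_ge0// sqrtr_sqr.
    by apply; lra.
  rewrite RintegralD//; last 2 first.
  - exact: integrable_mulR.
  - exact: integrable_cstR.
  by rewrite RintegralZl// e2 Rintegral_cst1; lra.
have [a_s a_se] := integrable_prod_fst is_; have [b_s b_se] := integrable_prod_snd is_.
have c1 := integrable_prodM i2 id; have c1e := Rintegral_prodM i2 id.
have c2 := integrable_prodM id i2; have c2e := Rintegral_prodM id i2.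
have c3 := integrable_prodM ix i1; have c3e := Rintegral_prodM ix i1.
have c4 := integrable_prodM i1 ix; have c4e := Rintegral_prodM i1 ix.
have t1 := integrable_mulR (p `^ (2 + delta)) a_s.
have t2 := integrable_mulR (q `^ (2 + delta)) b_s.
have t3 := integrable_mulR (p ^+ 2 * q `^ delta) c1.
have t4 := integrable_mulR (q ^+ 2 * p `^ delta) c2.
have t5 := integrable_mulR (2 * p * q * p `^ delta) c3.
have t6 := integrable_mulR (2 * p * q * q `^ delta) c4.
have u2 := integrable_addR t1 t2; have u3 := integrable_addR u2 t3.
have u4 := integrable_addR u3 t4; have u5 := integrable_addR u4 t5.
have u6 := integrable_addR u5 t6.
apply: moment_conv_dominated u6 _ _ => [x y /=|].
  rewrite powR2D ?normr_ge0 ?(ltW d0)// real_normK ?num_real//.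
  have sub : `|p * x + q * y| `^ delta <= p `^ delta * `|x| `^ delta + q `^ delta * `|y| `^ delta.
    rewrite -!powRM ?normr_ge0 ?(ltW p0) ?(ltW q0)//.
    apply: le_trans (_ : (p * `|x| + q * `|y|) `^ delta <= _); last first.
      by apply: powR_subadditive; rewrite ?mulr_ge0 ?(ltW p0) ?(ltW q0) ?d0.
    apply: ge0_ler_powR; rewrite ?nnegrE ?(ltW d0)//.
      by rewrite addr_ge0// mulr_ge0// ltW.
    apply: le_trans (ler_normD _ _) _.
    by rewrite !normrM (gtr0_norm p0) (gtr0_norm q0).
  apply: le_trans (ler_wpM2l (sqr_ge0 _) sub) _.
  rewrite !powR2D ?normr_ge0 ?(ltW d0) ?(ltW p0) ?(ltW q0)// !real_normK ?num_real//.
  by rewrite le_eqVlt; apply/orP; left; apply/eqP; ring.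
rewrite (RintegralD _ u5 t6)// (RintegralD _ u4 t5)// (RintegralD _ u3 t4)//.
rewrite (RintegralD _ u2 t3)// (RintegralD _ t1 t2)// !RintegralZl//.
rewrite a_se b_se c1e c2e c3e c4e e1 e2 !(mulr0, mul0r, addr0) mul1r mulr1 -/(moment _ _).
rewrite -/(moment _ _) mulrDl -addrA lerD2l.
by apply: lerD; rewrite ler_piMr// mulr_ge0// ?sqr_ge0// powR_ge0.
Qed.

(** Without subadditivity, the cross terms of order s - 1 are absorbed by [powR_young] into an
    arbitrarily small multiple of the moment of order s plus a constant. The choice e = eps / c
    makes their total weight exactly eps. *)
Lemma moment_conv_gt1 (s eps : R) : 2 <= s -> 0 < eps -> exists2 K, 0 <= K &
  forall mu, centered mu 1 -> has_moment s mu ->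
  has_moment s (conv p q mu) /\
  moment s (conv p q mu) <= (p `^ s + q `^ s + eps) * moment s mu + K.
Proof.
move=> s2 eps0.
have s1 : 1 <= s by lra.
have s0 : 0 <= s by lra.
pose c := s * 2 `^ (s - 1) * (p `^ (s - 1) * q + p * q `^ (s - 1)).
have c0 : 0 < c.
  by rewrite mulr_gt0// ?mulr_gt0 ?addr_gt0 ?mulr_gt0 ?powR_gt0//; lra.
pose e := eps / c.
have e0 : 0 < e by rewrite divr_gt0.
exists (c * e^-1 `^ (s - 1)); first by rewrite mulr_ge0 ?powR_ge0// ltW.
move=> mu [i1 e1 i2 e2] is_.
have is1 : has_moment (s - 1) mu by apply: integrable_lower_moment is_; lra.
have ia : mu.-integrable setT (EFin \o (fun v : R => `|v|)) by exact: (integrable_norm i1).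
have ale : \int[mu]_v `|v| <= 1.
  have i2' := integrable_addR (integrable_mulR 2^-1 i2) (integrable_cstR mu 2^-1).
  apply: le_trans (Rintegral_le ia i2' _) _ => [v /=|].
    have := sqr_ge0 (`|v| - 1); rewrite sqrrB1 real_normK ?num_real//; lra.
  rewrite RintegralD//; last 2 first.
  - exact: integrable_mulR.
  - exact: integrable_cstR.
  by rewrite RintegralZl// e2 Rintegral_cst1; lra.
have s1le : moment (s - 1) mu <= e * moment s mu + e^-1 `^ (s - 1).
  have i' := integrable_addR (integrable_mulR e is_) (integrable_cstR mu (e^-1 `^ (s - 1))).
  apply: le_trans (Rintegral_le is1 i' _) _ => [v /=|].
    by apply: powR_young; rewrite ?normr_ge0//; lra.
  rewrite RintegralD//; last 2 first.
  - exact: integrable_mulR.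
  - exact: integrable_cstR.
  by rewrite RintegralZl// Rintegral_cst1.
have [a_s a_se] := integrable_prod_fst is_; have [b_s b_se] := integrable_prod_snd is_.
have c1 := integrable_prodM is1 ia; have c1e := Rintegral_prodM is1 ia.
have c2 := integrable_prodM ia is1; have c2e := Rintegral_prodM ia is1.
have t1 := integrable_mulR (p `^ s) a_s.
have t2 := integrable_mulR (q `^ s) b_s.
have t3 := integrable_mulR (s * 2 `^ (s - 1) * (p `^ (s - 1) * q)) c1.
have t4 := integrable_mulR (s * 2 `^ (s - 1) * (p * q `^ (s - 1))) c2.
have u2 := integrable_addR t1 t2; have u3 := integrable_addR u2 t3.
have u4 := integrable_addR u3 t4.
apply: moment_conv_dominated u4 _ _ => [x y /=|].
  apply: (@le_trans _ _ ((p * `|x| + q * `|y|) `^ s)).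
    apply: ge0_ler_powR; rewrite ?nnegrE//.
      by rewrite addr_ge0// mulr_ge0// ltW.
    apply: le_trans (ler_normD _ _) _.
    by rewrite !normrM (gtr0_norm p0) (gtr0_norm q0).
  have px : 0 <= p * `|x| by rewrite mulr_ge0// ltW.
  have qy : 0 <= q * `|y| by rewrite mulr_ge0// ltW.
  apply: le_trans (powR_add_le px qy s1) _.
  rewrite !powRM ?normr_ge0 ?(ltW p0) ?(ltW q0)//.
  by rewrite le_eqVlt; apply/orP; left; apply/eqP; ring.
rewrite (RintegralD _ u3 t4)//.
rewrite (RintegralD _ u2 t3)// (RintegralD _ t1 t2)// !RintegralZl//.
rewrite a_se b_se c1e c2e -/(moment s mu) -/(moment (s - 1) mu).
have a0 : 0 <= \int[mu]_v `|v| by apply: Rintegral_ge0.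
have m0 := moment_ge0 s mu; have m1 := moment_ge0 (s - 1) mu.
have prod : moment (s - 1) mu * (\int[mu]_v `|v|) <= e * moment s mu + e^-1 `^ (s - 1).
  by apply: le_trans s1le; rewrite ler_piMr.
have -> : eps = c * e by rewrite /e mulrCA divff ?mulr1// gt_eqF.
have := ler_wpM2l (ltW c0) prod.
rewrite {1}/c; clear; lra.
Qed.

End conv_moments.

Section dilation_moments.
Context {R : realType}.
Implicit Types mu nu : borel_probability R.

Lemma Rintegral_dilation (c : R) mu (f : R -> R) : measurable_fun setT f ->
  mu.-integrable setT (EFin \o (fun v => f (v / c))) ->
  (dist_dilation c mu).-integrable setT (EFin \o f) /\
  \int[dist_dilation c mu]_v f v = \int[mu]_v f (v / c).
Proof.
by move=> mf fi; split; [exact: integrable_distribution|rewrite Rintegral_distribution].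
Qed.

Lemma centered_dilation c mu m2 : centered mu m2 ->
  centered (dist_dilation c mu) (m2 / c ^+ 2).
Proof.
move=> [i1 e1 i2 e2].
have E1 : (fun v : R => v / c) = (fun v => c^-1 * v) by apply/funext => v; rewrite mulrC.
have E2 : (fun v : R => (v / c) ^+ 2) = (fun v => (c ^+ 2)^-1 * v ^+ 2).
  by apply/funext => v; rewrite expr_div_n mulrC.
have [|j1 je1] := @Rintegral_dilation c mu (fun v => v) (@measurable_id _ _ _).
  by rewrite E1; exact: integrable_mulR.
have [||j2 je2] := @Rintegral_dilation c mu (fun v => v ^+ 2).
- exact: measurable_funX.
- by rewrite E2; exact: integrable_mulR.
split=> //.
  by rewrite je1 E1 RintegralZl// e1 mulr0.
by rewrite je2 E2 RintegralZl// e2 mulrC.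
Qed.

Lemma moment_dilation s c mu : 0 < c -> has_moment s mu ->
  has_moment s (dist_dilation c mu) /\
  moment s (dist_dilation c mu) = moment s mu / c `^ s.
Proof.
move=> c0 is_.
have E : (fun v : R => `|v / c| `^ s) = (fun v => (c `^ s)^-1 * `|v| `^ s).
  apply/funext => v; rewrite normrM powRM// normfV (gtr0_norm c0) mulrC.
  by rewrite -[c^-1]powR_inv1 ?(ltW c0)// -powRrM mulN1r powRN.
have [|j je] := @Rintegral_dilation c mu (fun v => `|v| `^ s) (measurable_powR_norm s).
  by rewrite E; exact: integrable_mulR.
by split=> //; rewrite /moment je E RintegralZl// mulrC.
Qed.

End dilation_moments.

Section mixture_moments.
Context {R : realType}.
Variables (h : R) (h01 : 0 <= h <= 1) (mu nu : borel_probability R).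

Lemma Rintegral_mixture (f : R -> R) :
  mu.-integrable setT (EFin \o f) -> nu.-integrable setT (EFin \o f) ->
  (mixture mu nu h01).-integrable setT (EFin \o f) /\
  \int[mixture mu nu h01]_v f v = (1 - h) * (\int[mu]_v f v) + h * (\int[nu]_v f v).
Proof.
move=> fmu fnu; have /andP[h0 h1] := h01; have mf := measurable_int _ fmu.
have fmix : (mixture mu nu h01).-integrable setT (EFin \o f).
  apply/integrableP; split=> //; rewrite ge0_integral_mixture//; last first.
    exact: measurableT_comp.
  have /integrableP[_ a] := fmu; have /integrableP[_ b] := fnu.
  by apply: lte_add_pinfty; apply: lte_mul_pinfty => //; rewrite lee_fin; lra.
split=> //; apply: EFin_inj; rewrite EFinD !EFinM -!ge0_EFin_Rintegral//.
have pn (P : borel_probability R) : P.-integrable setT (EFin \o f) ->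
    [/\ (\int[P]_x (f x)%:E = \int[P]_x ((EFin \o f)^\+ x) - \int[P]_x ((EFin \o f)^\- x))%E,
     (\int[P]_x ((EFin \o f)^\+ x))%E \is a fin_num &
     (\int[P]_x ((EFin \o f)^\- x))%E \is a fin_num].
  move=> fP; split; first by rewrite integralE.
    by apply: integral_fune_fin_num => //; exact: integrable_funepos.
  by apply: integral_fune_fin_num => //; exact: integrable_funeneg.
have [-> _ _] := pn _ fmix; have [-> a1 a2] := pn _ fmu; have [-> b1 b2] := pn _ fnu.
rewrite !ge0_integral_mixture//; last 2 first.
- exact: measurable_funeneg.
- exact: measurable_funepos.
have aux (A B C D : \bar R) : A \is a fin_num -> B \is a fin_num ->
    C \is a fin_num -> D \is a fin_num ->
    ((1 - h)%:E * A + h%:E * C - ((1 - h)%:E * B + h%:E * D) =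
     (1 - h)%:E * (A - B) + h%:E * (C - D))%E.
  move: A B C D => [x1||] [x2||] [x3||] [x4||] // _ _ _ _.
  by rewrite -?(EFinN, EFinM, EFinD); congr EFin; ring.
exact: aux.
Qed.

Lemma phase_mixture xi th : phase (mixture mu nu h01) xi th =
  (1 - h) * phase mu xi th + h * phase nu xi th.
Proof.
exact: (Rintegral_mixture (integrable_cos_affine mu xi th)
  (integrable_cos_affine nu xi th)).2.
Qed.

Lemma centered_mixture m1 m2 : centered mu m1 -> centered nu m2 ->
  centered (mixture mu nu h01) ((1 - h) * m1 + h * m2).
Proof.
move=> [i1 e1 i2 e2] [j1 f1 j2 f2].
have [k1 k1e] := Rintegral_mixture i1 j1; have [k2 k2e] := Rintegral_mixture i2 j2.
split=> //; first by rewrite k1e e1 f1 !mulr0 addr0.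
by rewrite k2e e2 f2.
Qed.

Lemma moment_mixture s : has_moment s mu -> has_moment s nu ->
  has_moment s (mixture mu nu h01) /\
  moment s (mixture mu nu h01) = (1 - h) * moment s mu + h * moment s nu.
Proof. by move=> a b; exact: Rintegral_mixture. Qed.

End mixture_moments.

(** * Tightness from second moments *)

Section tightness.
Context {R : realType}.
Implicit Types mu nu : borel_probability R.

Lemma cdfR_chebyshev mu m2 (A : R) : centered mu m2 -> 0 < A ->
  cdfR mu (- A) <= m2 / A ^+ 2 /\ 1 - cdfR mu A <= m2 / A ^+ 2.
Proof.
move=> [_ _ i2 e2] A0.
have i2' := integrable_mulR (A ^+ 2)^-1 i2.
have key (B : set R) : measurable B -> (forall v, B v -> A ^+ 2 <= v ^+ 2) ->
    fine (mu B) <= m2 / A ^+ 2.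
  move=> mB hB.
  have -> : fine (mu B) = \int[mu]_v (\1_B v : R) by rewrite /Rintegral integral_indic// setIT.
  rewrite mulrC -e2 -RintegralZl//; apply: Rintegral_le => //.
    apply: (@bounded_integrable _ _ _ _ _ 1) => // v.
    by rewrite indicE; case: (_ \in _); rewrite ?normr1// normr0.
  move=> v; rewrite indicE mulrC ler_pdivlMr ?exprn_gt0//.
  have [/set_mem Bv|_] := boolP (v \in B); first by rewrite mul1r; exact: hB.
  by rewrite mul0r sqr_ge0.
have sq v : A <= `|v| -> A ^+ 2 <= v ^+ 2.
  move=> Av; rewrite -[v ^+ 2]real_normK ?num_real//.
  by rewrite ler_pXn2r// nnegrE// ltW.
split.
  apply: key => // v /=; rewrite in_itv/= => vA; apply: sq.
  by rewrite ler_normr; apply/orP; right; rewrite lerNr.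
rewrite -[X in X <= _]/(fine (_%:E)) -measure_itv_gt; apply: key => // v /=.
rewrite in_itv/= andbT => Av; apply: sq.
by rewrite ler_normr (ltW Av).
Qed.

Lemma tight_centered (mu_ : nat -> borel_probability R) (m_ : nat -> R) (m2 : R) :
  (forall n, centered (mu_ n) (m_ n)) -> (forall n, m_ n <= m2) -> tight mu_.
Proof.
move=> h hm e e0.
have m_0 n : 0 <= m_ n.
  by have [_ _ _ <-] := h n; apply: Rintegral_ge0 => v _; exact: sqr_ge0.
have m20 : 0 <= m2 := le_trans (m_0 0%N) (hm 0%N).
(* Makes m2 / A^2 at most e; the added 1 keeps A positive when m2 is 0. *)
pose A := Num.sqrt ((m2 + 1) / e).
have Ae : 0 < (m2 + 1) / e by rewrite divr_gt0//; lra.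
have A0 : 0 < A by rewrite sqrtr_gt0.
exists A => n; have [h1 h2] := cdfR_chebyshev (h n) A0.
have le_e : m2 / A ^+ 2 <= e.
  rewrite sqr_sqrtr ?(ltW Ae)// invf_div mulrA ler_pdivrMr; last by lra.
  nra.
have le_n : m_ n / A ^+ 2 <= e.
  by apply: le_trans le_e; rewrite ler_wpM2r// invr_ge0 sqr_ge0.
by split; [exact: le_trans h1 _|exact: le_trans h2 _].
Qed.

End tightness.

(** * Taylor expansion of phases *)

Section taylor_trigo.
Context {R : realType}.
Implicit Types x : R.

(** This starts a chain of four inequalities: in each of the next three, the derivative of the
    difference is the difference estimated just before. *)
Lemma sin_le_id x : 0 <= x -> sin x <= x.
Proof.
move=> x0; rewrite -subr_le0.
suff : (fun x => sin x - x) x <= (fun x => sin x - x) 0 by rewrite /= sin0 subr0.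
apply: (@le_initial R (fun x => sin x - x) (fun x => cos x - 1)) x0.
- apply: cvg_at_right_filter; apply: cvgB; [exact: continuous_sin|exact: cvg_id].
- by move=> y _; rewrite subr_le0 cos_le1.
Qed.

Lemma cos_ge_taylor2 x : 0 <= x -> 1 - x ^+ 2 / 2 <= cos x.
Proof.
move=> x0; rewrite -subr_le0.
suff : (fun x => 1 - x ^+ 2 / 2 - cos x) x <= (fun x => 1 - x ^+ 2 / 2 - cos x) 0
  by rewrite /= cos0 expr0n mul0r subr0 subrr.
apply: (@le_initial R (fun x => 1 - x ^+ 2 / 2 - cos x) (fun x => sin x - x)) x0.
- apply: cvg_at_right_filter; apply: cvgB; last exact: continuous_cos.
  apply: cvgB; first exact: cvg_cst.
  by apply: cvgMl; exact: exprn_continuous.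
- move=> y _.
  have d := is_deriveB (is_deriveB (is_derive_cst (1 : R) y 1)
    (is_deriveZ (2^-1) (is_deriveX 2 (is_derive_id y (1 : R))))) (is_derive_cos y).
  have -> : (fun x : R => 1 - x ^+ 2 / 2 - cos x) =
      (cst 1 - 2^-1 \*: (id : R -> R) ^+ 2 - cos).
    by apply/funext => z; rewrite !fctE /GRing.scale/= mulrC.
  by apply: is_derive_eq d _; rewrite /GRing.scale/=; field.
- by move=> y y0; rewrite subr_le0 sin_le_id// ltW.
Qed.

Lemma sin_ge_taylor3 x : 0 <= x -> x - x ^+ 3 / 6 <= sin x.
Proof.
move=> x0; rewrite -subr_le0.
suff : (fun x => x - x ^+ 3 / 6 - sin x) x <= (fun x => x - x ^+ 3 / 6 - sin x) 0
  by rewrite /= sin0 expr0n mul0r !subr0.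
apply: (@le_initial R (fun x => x - x ^+ 3 / 6 - sin x) (fun x => 1 - x ^+ 2 / 2 - cos x)) x0.
- apply: cvg_at_right_filter; apply: cvgB; last exact: continuous_sin.
  apply: cvgB; first exact: cvg_id.
  by apply: cvgMl; exact: exprn_continuous.
- move=> y _.
  have d := is_deriveB (is_deriveB (is_derive_id y (1 : R))
    (is_deriveZ (6^-1) (is_deriveX 3 (is_derive_id y (1 : R))))) (is_derive_sin y).
  have -> : (fun x : R => x - x ^+ 3 / 6 - sin x) =
      (id - 6^-1 \*: (id : R -> R) ^+ 3 - sin).
    by apply/funext => z; rewrite !fctE /GRing.scale/= mulrC.
  by apply: is_derive_eq d _; rewrite /GRing.scale/=; field.
- by move=> y y0; rewrite subr_le0 cos_ge_taylor2// ltW.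
Qed.

Lemma cos_le_taylor4 x : 0 <= x -> cos x <= 1 - x ^+ 2 / 2 + x ^+ 4 / 24.
Proof.
move=> x0; rewrite -subr_le0.
suff : (fun x => cos x - (1 - x ^+ 2 / 2 + x ^+ 4 / 24)) x <=
    (fun x => cos x - (1 - x ^+ 2 / 2 + x ^+ 4 / 24)) 0 by rewrite /= cos0 !expr0n !mul0r subr0 addr0 subrr.
apply: (@le_initial R (fun x => cos x - (1 - x ^+ 2 / 2 + x ^+ 4 / 24))
  (fun x => x - x ^+ 3 / 6 - sin x)) x0.
- apply: cvg_at_right_filter; apply: cvgB; first exact: continuous_cos.
  apply: cvgD.
    by apply: cvgB; [exact: cvg_cst|apply: cvgMl; exact: exprn_continuous].
  by apply: cvgMl; exact: exprn_continuous.
- move=> y _.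
  have d := is_deriveB (is_derive_cos y) (is_deriveD (is_deriveB (is_derive_cst (1 : R) y 1)
    (is_deriveZ (2^-1) (is_deriveX 2 (is_derive_id y (1 : R)))))
    (is_deriveZ (24^-1) (is_deriveX 4 (is_derive_id y (1 : R))))).
  have -> : (fun x : R => cos x - (1 - x ^+ 2 / 2 + x ^+ 4 / 24)) =
      (cos - (cst 1 - 2^-1 \*: (id : R -> R) ^+ 2 + 24^-1 \*: (id : R -> R) ^+ 4)).
    by apply/funext => z; rewrite !fctE /GRing.scale/= [_ / 2]mulrC [_ / 24]mulrC.
  by apply: is_derive_eq d _; rewrite /GRing.scale/=; field.
- by move=> y y0; rewrite subr_le0 sin_ge_taylor3// ltW.
Qed.

(** Taylor remainders are taken at order 3 up to 1 and at order 2 beyond, and both are then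
    dominated by x^s. *)
Lemma powR_interp x (s : R) : 0 <= x -> 2 <= s <= 3 ->
  (x <= 1 -> x ^+ 3 <= x `^ s) /\ (1 <= x -> x ^+ 2 <= x `^ s).
Proof.
move=> x0 /andP[s2 s3]; rewrite -!powR_mulrn//; split=> x1; last exact: ler_powR.
move: x0; rewrite le_eqVlt => /predU1P[<-|x0].
  by rewrite !powR0//; apply/eqP; lra.
by apply: ger_powR => //; rewrite x0.
Qed.

Lemma cos_taylor_powR x (s : R) : 2 <= s <= 3 ->
  `|cos x - (1 - x ^+ 2 / 2)| <= `|x| `^ s.
Proof.
move=> s23.
have -> : cos x = cos `|x| by case: (ger0P x) => ?; rewrite ?cosN.
rewrite -[x ^+ 2]real_normK ?num_real//.
move: (normr_ge0 x); move: (`|x|) => {}x x0.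
have [h3 h2] := powR_interp x0 s23.
have g2 := cos_ge_taylor2 x0.
rewrite ger0_norm; last by lra.
have [x1|x1] := leP x 1.
  apply: le_trans (h3 x1); have := cos_le_taylor4 x0.
  have : x ^+ 4 <= x ^+ 3.
    by rewrite exprS ler_piMl// exprn_ge0.
  have := exprn_ge0 3 x0; lra.
apply: le_trans (h2 (ltW x1)); have := cos_le1 x; have := sqr_ge0 x; lra.
Qed.

Lemma sin_taylor_powR x (s : R) : 2 <= s <= 3 -> `|sin x - x| <= 2 * `|x| `^ s.
Proof.
move=> s23.
have -> : `|sin x - x| = `|sin `|x| - `|x| |.
  case: (ger0P x) => [//|?].
  by rewrite sinN -opprD normrN.
move: (normr_ge0 x); move: (`|x|) => {}x x0.
have [h3 h2] := powR_interp x0 s23.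
have g1 := sin_le_id x0.
rewrite distrC ger0_norm; last by lra.
have [x1|x1] := leP x 1.
  apply: le_trans (_ : 2 * x ^+ 3 <= _); last by rewrite ler_pM2l// h3.
  have := sin_ge_taylor3 x0; have := exprn_ge0 3 x0; lra.
apply: le_trans (_ : 2 * x ^+ 2 <= _); last by rewrite ler_pM2l// h2// ltW.
have := sin_geN1 x; have : x * 1 <= x * x by rewrite ler_pM2l; lra.
rewrite expr2; lra.
Qed.

Lemma cosD_taylor_powR x th (s : R) : 2 <= s <= 3 ->
  `|cos (x + th) - (cos th * (1 - x ^+ 2 / 2) - sin th * x)| <= 3 * `|x| `^ s.
Proof.
move=> s23; have hc := cos_taylor_powR x s23; have hs := sin_taylor_powR x s23.
rewrite cosD.
have -> : cos x * cos th - sin x * sin th - (cos th * (1 - x ^+ 2 / 2) - sin th * x) =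
  cos th * (cos x - (1 - x ^+ 2 / 2)) - sin th * (sin x - x) by ring.
apply: le_trans (ler_normB _ _) _; rewrite !normrM.
have : `|cos th| * `|cos x - (1 - x ^+ 2 / 2)| <= 1 * `|x| `^ s.
  by apply: ler_pM => //; exact: normr_cos_le1.
have : `|sin th| * `|sin x - x| <= 1 * (2 * `|x| `^ s).
  by apply: ler_pM => //; rewrite ler_norml sin_geN1 sin_le1.
lra.
Qed.

End taylor_trigo.

Section taylor_phase.
Context {R : realType}.
Implicit Types mu nu : borel_probability R.

Lemma phase_taylor mu (s xi th : R) : 2 <= s <= 3 ->
  mu.-integrable setT (EFin \o (fun v : R => v ^+ 2)) -> has_moment s mu ->
  `|phase mu xi th - (cos th * (1 - xi ^+ 2 / 2 * (\int[mu]_v (v ^+ 2))) -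
                      sin th * xi * (\int[mu]_v v))| <=
  3 * moment s mu * `|xi| `^ s.
Proof.
move=> s23 i2 is_; have i1 := integrable_id i2.
have t1 := integrable_cstR mu (cos th).
have t2 := integrable_mulR (- cos th * xi ^+ 2 / 2) i2.
have t3 := integrable_mulR (- sin th * xi) i1.
have t12 := integrable_addR t1 t2; have t123 := integrable_addR t12 t3.
have tc := integrable_mulR (-1) (integrable_cos_affine mu xi th).
have t := integrable_addR t123 tc.
have E : \int[mu]_v (cos th + (- cos th * xi ^+ 2 / 2) * v ^+ 2 + (- sin th * xi) * v +
    -1 * cos (xi * v + th)) =
  (cos th * (1 - xi ^+ 2 / 2 * (\int[mu]_v (v ^+ 2))) - sin th * xi * (\int[mu]_v v))
  - phase mu xi th.
  rewrite (RintegralD _ t123 tc)// (RintegralD _ t12 t3)// (RintegralD _ t1 t2)//.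
  rewrite !RintegralZl//; last exact: integrable_cos_affine.
  by rewrite Rintegral_cst1 /phase; ring.
rewrite distrC -E; apply: le_trans (le_normr_Rintegral _ t) _ => //.
have is' := integrable_mulR (3 * `|xi| `^ s) is_.
apply: le_trans (Rintegral_le _ is' _) _ => [|v /=|].
- exact: (integrable_norm t).
- have := cosD_taylor_powR (xi * v) th s23.
  rewrite distrC normrM powRM// [3 * (_ * _)]mulrA; apply: le_trans.
  by rewrite le_eqVlt; apply/orP; left; apply/eqP; congr `| _ |; ring.
- by rewrite RintegralZl// /moment mulrAC.
Qed.

(** Normalized laws have the same Taylor polynomial of degree two, so only the remainders of order s
    contribute. *)
Lemma phase_close_centered mu nu (s : R) : 2 <= s <= 3 ->
  centered mu 1 -> centered nu 1 -> has_moment s mu -> has_moment s nu ->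
  forall xi, phase_close mu nu xi (3 * (moment s mu + moment s nu) * `|xi| `^ s).
Proof.
move=> s23 [i1 e1 i2 e2] [j1 f1 j2 f2] imu inu xi th.
have := phase_taylor xi th s23 i2 imu; have := phase_taylor xi th s23 j2 inu.
rewrite e1 e2 f1 f2 !ler_norml => /andP[a1 a2] /andP[b1 b2].
lra.
Qed.

Lemma le0_of_powR_bound (a C r : R) : 0 < r ->
  (forall xi, 0 < xi -> a <= C * xi `^ r) -> a <= 0.
Proof.
move=> r0 h.
have cv : C * xi `^ r @[xi --> 0^'+] --> C * 0.
  by apply: cvgMr; exact: powR_cvg0.
rewrite mulr0 in cv.
apply: (ler_cvg_to (cvg_cst a) cv).
by near=> xi; apply: h.
Unshelve. all: by end_near. Qed.

(** A bound of order s > 2 at small frequencies forces the Taylor coefficients up to degree two to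
    agree. This is how the limit of the iterates inherits their normalization. *)
Lemma centered_of_phase_close mu nu (s D : R) : 2 < s <= 3 ->
  centered mu 1 -> has_moment s mu -> has_moment s nu ->
  (forall xi, phase_close mu nu xi (D * `|xi| `^ s)) -> centered nu 1.
Proof.
move=> /andP[s2 s3] [i1 e1 i2 e2] imu inu clo.
have s23 : 2 <= s <= 3 by rewrite s3 ltW.
have j2 : nu.-integrable setT (EFin \o (fun v : R => v ^+ 2)).
  have : has_moment 2 nu by apply: integrable_lower_moment inu; rewrite ler0n ltW.
  apply: eq_integrable => // v _.
  by rewrite /= powR_mulrn// real_normK ?num_real.
have j1 := integrable_id j2.
pose C := 3 * moment s mu + 3 * moment s nu + D.
have bound xi th : `|cos th * (xi ^+ 2 / 2 * (\int[nu]_v (v ^+ 2) - 1)) +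
    sin th * xi * (\int[nu]_v v)| <= C * `|xi| `^ s.
  have := phase_taylor xi th s23 i2 imu; have := phase_taylor xi th s23 j2 inu.
  have := phase_close_norm (clo xi) th.
  rewrite e1 e2 /C !ler_norml => /andP[a1 a2] /andP[b1 b2] /andP[c1 c2].
  lra.
(* The angle pi / 2 isolates the mean, the angle 0 the second moment. *)
have m1 : `|\int[nu]_v v| <= 0.
  apply: (@le0_of_powR_bound _ C (s - 1)) => [|xi xi0]; first by lra.
  have := bound xi (pi / 2); rewrite cos_pihalf sin_pihalf mul0r add0r mul1r.
  rewrite normrM (gtr0_norm xi0) (@powRS1 _ _ s)//; [|exact: ltW|lra].
  by rewrite mulrCA ler_pM2l.
have m2 : `|\int[nu]_v (v ^+ 2) - 1| <= 0.
  apply: (@le0_of_powR_bound _ (2 * C) (s - 2)) => [|xi xi0]; first by lra.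
  have := bound xi 0; rewrite cos0 sin0 !mul0r addr0 mul1r normrM.
  have -> : `|xi| `^ s = xi ^+ 2 * xi `^ (s - 2).
    by rewrite (gtr0_norm xi0) -powR2D ?(ltW xi0)// ?subrKC//; lra.
  rewrite ger0_norm; last by rewrite mulr_ge0 ?sqr_ge0.
  have x2 : 0 < xi ^+ 2 by rewrite exprn_gt0.
  rewrite mulrCA -mulrA ler_pM2l//; lra.
split=> //; first by apply/eqP; rewrite -normr_le0.
by apply/eqP; rewrite -subr_eq0 -normr_le0.
Qed.

End taylor_phase.

(** * Existence of a stationary solution *)

Section uniform_half.
Context {R : realType}.

Lemma half_lt1 : 2^-1 < 1 :> R. Proof. lra. Qed.

Definition unif : borel_probability R := distribution (uniform_prob half_lt1) idTR.

(** The projection onto [1/2, 1]: powers of a clipped sample are continuous and bounded on the whole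
    line, for exponents of either sign. *)
Definition clip (x : R) : R := Num.min 1 (Num.max 2^-1 x).

Lemma clip_itv x : 2^-1 <= clip x <= 1.
Proof. by rewrite /clip le_min ge_min lexx le_max lexx /= andbT; lra. Qed.

Lemma clip_gt0 x : 0 < clip x.
Proof. by have := clip_itv x; lra. Qed.

Lemma clip_id x : 2^-1 <= x <= 1 -> clip x = x.
Proof. by move=> /andP[x1 x2]; rewrite /clip max_r// min_r. Qed.

Lemma continuous_clip : continuous clip.
Proof.
move=> x; apply: continuous_min; first exact: cst_continuous.
by apply: continuous_max; [exact: cst_continuous|exact: cvg_id].
Qed.

Lemma measurable_comp_clip (f : R -> R) :
  (forall x, 2^-1 <= x <= 1 -> {for x, continuous f}) ->
  measurable_fun setT (fun x => f (clip x)).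
Proof.
move=> cf; apply: continuous_measurable_fun => x.
apply: continuous_comp; first exact: continuous_clip.
by apply: cf; exact: clip_itv.
Qed.

Lemma Rintegral_unif_FTC (f F : R -> R) (M : R) :
  (forall x, 2^-1 <= x <= 1 -> {for x, continuous f}) ->
  (forall x, 2^-1 <= x <= 1 -> `|f x| <= M) ->
  (forall x : R, 2^-1 <= x <= 1 -> is_derive x 1 F (f x)) ->
  \int[unif]_x f (clip x) = 2 * (F 1 - F 2^-1).
Proof.
move=> cf fM dF.
have mf := measurable_comp_clip cf.
have fM' x : `|f (clip x)| <= M by apply: fM; exact: clip_itv.
have fi := bounded_integrable unif mf fM'.
(* Adding M makes the integrand nonnegative; the primitive gains M x, and the constant is removed at
   the end. *)
have -> : \int[unif]_x f (clip x) = \int[unif]_x (f (clip x) + M) - M.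
  by rewrite (RintegralD _ fi (integrable_cstR unif M))// Rintegral_cst1 addrK.
have g0 x : 0 <= f (clip x) + M.
  by have := fM' x; rewrite ler_norml => /andP[]; lra.
rewrite /Rintegral ge0_integral_distribution; last 2 first.
- by apply/measurable_EFinP; apply: measurable_funD.
- by move=> x; rewrite lee_fin.
rewrite integral_uniform; last 2 first.
- by apply/measurable_EFinP; apply: measurable_funD.
- by move=> x; rewrite lee_fin.
rewrite [X in (_ * X)%E](_ : _ =
    \int[lebesgue_measure]_(x in `[2^-1%R, 1%R]) (f x + M)%:E)%E; last first.
  apply: eq_integral => x /set_mem/=; rewrite in_itv/= => xh.
  by rewrite /idTR /= clip_id.
rewrite (@continuous_FTC2 _ _ (fun x => F x + M * x))//; last 4 first.
- exact: half_lt1.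
- apply: continuous_in_subspaceT => x /set_mem/=; rewrite in_itv/= => xh.
  by apply: cvgD; [exact: cf|exact: cvg_cst].
- have c x : 2^-1 <= x <= 1 -> {for x, continuous (fun x => F x + M * x)}.
    move=> /dF/is_derive_continuous cFx; apply: cvgD => //; exact: mulrl_continuous.
  split.
  + move=> x; rewrite in_itv/= => /andP[x1 x2].
    have xh : 2^-1 <= x <= 1 by rewrite !ltW.
    have dFx := dF x xh.
    by have [] := is_deriveD dFx (is_deriveZ M (is_derive_id x (1 : R))).
  + by apply: cvg_at_right_filter; apply: c; rewrite lexx/=; lra.
  + by apply: cvg_at_left_filter; apply: c; rewrite lexx andbT; lra.
- move=> x; rewrite in_itv/= => /andP[x1 x2].
  have xh : 2^-1 <= x <= 1 by rewrite !ltW.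
  have dFx := dF x xh.
  have [_ e] := is_deriveD dFx (is_deriveZ M (is_derive_id x (1 : R))).
  by rewrite derive1E [LHS]e /GRing.scale/= mulr1.
by rewrite -EFinB -EFinM /=; field.
Qed.

Lemma powR_half_bound (x s : R) : 2^-1 <= x <= 1 -> x `^ s <= 1 + 2^-1 `^ s.
Proof.
move=> /andP[x1 x2]; have x0 : 0 < x by lra.
have [h|h] := leP 0 s.
  apply: (@le_trans _ _ (1 `^ s)); last by rewrite powR1 lerDl powR_ge0.
  by apply: (ge0_ler_powR h _ _ x2); rewrite nnegrE ?ler01// ltW.
apply: (@le_trans _ _ (2^-1 `^ s)); last by rewrite lerDr.
have h' : 0 <= - s by rewrite oppr_ge0 ltW.
rewrite -[s]opprK 2!(powRN _ (- s)) lef_pV2 ?posrE ?powR_gt0//.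
by apply: (ge0_ler_powR h' _ _ x1); rewrite nnegrE ?invr_ge0// ltW.
Qed.

Lemma Rintegral_unif_powR (c : R) : c != 0 ->
  \int[unif]_x (clip x `^ (c - 1)) = 2 * (1 - 2^-1 `^ c) / c.
Proof.
move=> c0.
have d (x : R) : 2^-1 <= x <= 1 ->
    is_derive x 1 (fun y => c^-1 * y `^ c) (x `^ (c - 1)).
  move=> /andP[x1 x2]; have x0 : 0 < x by lra.
  have := is_deriveZ c^-1 (is_derive1_powR c x0).
  by move=> /is_derive_eq; apply; rewrite /GRing.scale/= mulKf.
rewrite (@Rintegral_unif_FTC (fun x => x `^ (c - 1)) (fun y => c^-1 * y `^ c)
  (1 + 2^-1 `^ (c - 1)) _ _ d).
- by rewrite powR1; field.
- move=> x /andP[x1 x2]; have x0 : 0 < x by lra.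
  exact: is_derive_continuous (is_derive1_powR (c - 1) x0).
- move=> x /andP[x1 x2]; have x0 : 0 < x by lra.
  by rewrite ger0_norm ?powR_ge0// powR_half_bound// x1.
Qed.

End uniform_half.

(** * Averaging over random dilations *)

Section relax.
Context {R : realType}.
Variable r : R.
Implicit Types mu nu : borel_probability R.

(** With x = exp (- tau) and r half of p^2 + q^2 - 1, this is the dilation that the rescaling by 1 /
    sqrt E performs during a time tau. *)
Definition weight (x : R) : R := clip x `^ r.

Definition relax_map (xz : R * R) : R := weight xz.1 * xz.2.

Lemma weight_gt0 x : 0 < weight x.
Proof. by rewrite powR_gt0// clip_gt0. Qed.

Lemma weight_powR (s : R) x : weight x `^ s = clip x `^ (r * s).
Proof. by rewrite powRrM. Qed.

Let cont (s x : R) : 2^-1 <= x <= 1 -> {for x, continuous (fun y => y `^ s)}.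
Proof.
move=> /andP[x1 x2]; have x0 : 0 < x by lra.
exact: is_derive_continuous (is_derive1_powR s x0).
Qed.

Lemma measurable_weight : measurable_fun setT weight.
Proof. by apply: (@measurable_comp_clip _ (fun y => y `^ r)) => x; exact: cont. Qed.

Lemma weight_powR_bound (s : R) : exists M, forall x, `|weight x `^ s| <= M.
Proof.
exists (1 + 2^-1 `^ (r * s)) => x.
rewrite weight_powR ger0_norm ?powR_ge0//.
exact/powR_half_bound/clip_itv.
Qed.

Lemma integrable_weight_powR (s : R) :
  unif.-integrable setT (EFin \o (fun x => weight x `^ s)).
Proof.
have [M hM] := weight_powR_bound s; apply: (@bounded_integrable _ _ _ unif _ M) => //.
exact: (measurableT_comp (measurable_powR s) measurable_weight).
Qed.

Lemma Rintegral_weight_powR (s : R) : r * s + 1 != 0 ->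
  \int[unif]_x (weight x `^ s) = 2 * (1 - 2^-1 `^ (r * s + 1)) / (r * s + 1).
Proof.
move=> c0; rewrite -(Rintegral_unif_powR c0) addrK.
by apply: eq_Rintegral => x _; exact: weight_powR.
Qed.

Lemma measurable_relax_map : measurable_fun setT relax_map.
Proof.
by apply: measurable_funM => //; exact: (measurableT_comp measurable_weight).
Qed.

HB.instance Definition _ :=
  isMeasurableFun.Build _ _ _ _ relax_map measurable_relax_map.

Definition relax nu : borel_probability R :=
  distribution (unif \x nu)%E relax_map.

Lemma Rintegral_relax nu (f : R -> R) : measurable_fun setT f ->
  (unif \x nu)%E.-integrable setT (EFin \o (fun z => f (weight z.1 * z.2))) ->
  (relax nu).-integrable setT (EFin \o f) /\
  \int[relax nu]_v f v = \int[(unif \x nu)%E]_z f (weight z.1 * z.2).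
Proof.
by move=> mf fi; split; [exact: integrable_distribution|rewrite Rintegral_distribution].
Qed.

Lemma Rintegral_relax_bounded nu (f : R -> R) (M : R) : measurable_fun setT f ->
  (forall v, `|f v| <= M) ->
  \int[relax nu]_v f v = \int[nu]_z \int[unif]_x f (weight x * z) /\
  \int[relax nu]_v f v = \int[unif]_x \int[nu]_z f (weight x * z).
Proof.
move=> mf fM.
have m : measurable_fun setT (fun z : R * R => f (weight z.1 * z.2)).
  by apply: measurableT_comp => //; exact: measurable_relax_map.
have b (z : R * R) : `|f (weight z.1 * z.2)| <= M by exact: fM.
have [|_ ->] := @Rintegral_relax nu f mf.
  exact: (@bounded_integrable _ _ _ (unif \x nu)%E _ M).
by rewrite {1}(Rintegral_prod21 unif nu m b) (Rintegral_prod12 unif nu m b).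
Qed.

Lemma centered_relax nu m2 : 2 * r + 1 != 0 -> centered nu m2 ->
  centered (relax nu) (2 * (1 - 2^-1 `^ (2 * r + 1)) / (2 * r + 1) * m2).
Proof.
move=> c0 [i1 e1 i2 e2].
have w1 : unif.-integrable setT (EFin \o weight).
  have := integrable_weight_powR 1; apply: eq_integrable => // x _.
  by rewrite /= powRr1// ltW// weight_gt0.
have w2 : unif.-integrable setT (EFin \o (fun x => weight x ^+ 2)).
  have := integrable_weight_powR 2; apply: eq_integrable => // x _.
  by rewrite /= powR_mulrn// ltW// weight_gt0.
have w2e : \int[unif]_x (weight x ^+ 2) = 2 * (1 - 2^-1 `^ (2 * r + 1)) / (2 * r + 1).
  rewrite [2 * r]mulrC -Rintegral_weight_powR; last by rewrite mulrC.
  by apply: eq_Rintegral => x _; rewrite powR_mulrn// ltW// weight_gt0.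
have [|j1 je1] := @Rintegral_relax nu (fun v => v) (@measurable_id _ _ _).
  exact: (integrable_prodM w1 i1).
have E : (fun z : R * R => (weight z.1 * z.2) ^+ 2) =
  (fun z => weight z.1 ^+ 2 * z.2 ^+ 2) by apply/funext => z; rewrite exprMn.
have [||j2 je2] := @Rintegral_relax nu (fun v => v ^+ 2).
- exact: measurable_funX.
- by rewrite E; exact: (integrable_prodM w2 i2).
split=> //; first by rewrite je1 (Rintegral_prodM w1 i1) e1 mulr0.
by rewrite je2 E (Rintegral_prodM w2 i2) w2e e2.
Qed.

Lemma moment_relax s nu : r * s + 1 != 0 -> has_moment s nu ->
  has_moment s (relax nu) /\ moment s (relax nu) =
    2 * (1 - 2^-1 `^ (r * s + 1)) / (r * s + 1) * moment s nu.
Proof.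
move=> c0 is_; have ws := integrable_weight_powR s.
have E : (fun z : R * R => `|weight z.1 * z.2| `^ s) =
    (fun z => weight z.1 `^ s * `|z.2| `^ s).
  apply/funext => z; rewrite normrM (gtr0_norm (weight_gt0 _)) powRM//.
  exact/ltW/weight_gt0.
have [|j je] := @Rintegral_relax nu (fun v => `|v| `^ s) (measurable_powR_norm s).
  by rewrite E; exact: (integrable_prodM ws is_).
split=> //; rewrite /moment je E (Rintegral_prodM ws is_).
by rewrite Rintegral_weight_powR.
Qed.

Lemma phase_relax nu xi th :
  phase (relax nu) xi th = \int[unif]_x phase nu (weight x * xi) th.
Proof.
rewrite /phase.
have [_ ->] := @Rintegral_relax_bounded nu (fun v => cos (xi * v + th)) 1
  (measurable_cos_affine xi th) (fun v => normr_cos_le1 _).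
apply: eq_Rintegral => x _; apply: eq_Rintegral => z _; congr (cos (_ + _)); ring.
Qed.

Lemma phase_close_relax mu nu (s D : R) : r * s + 1 != 0 ->
  (forall xi, phase_close mu nu xi (D * `|xi| `^ s)) ->
  forall xi, phase_close (relax mu) (relax nu) xi
    (2 * (1 - 2^-1 `^ (r * s + 1)) / (r * s + 1) * D * `|xi| `^ s).
Proof.
move=> c0 h xi th; rewrite !phase_relax.
have iph (P : borel_probability R) :
    unif.-integrable setT (EFin \o (fun x => phase P (weight x * xi) th)).
  pose f (z : R * R) := cos (xi * (weight z.1 * z.2) + th).
  have m : measurable_fun setT f.
    exact: (measurableT_comp (measurable_cos_affine xi th) measurable_relax_map).
  have b (z : R * R) : `|f z| <= 1 by exact: normr_cos_le1.
  have -> : (fun x => phase P (weight x * xi) th) = (fun x => \int[P]_z f (x, z)).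
    apply/funext => x; apply: eq_Rintegral => z _.
    by rewrite /f /=; congr (cos (_ + _)); ring.
  apply: (@bounded_integrable _ _ _ _ _ 1) => [|x].
    exact: (measurable_Rintegral12 unif P m b).
  by apply: norm_Rintegral_le => //; exact: measurableT_comp.
have iD := integrable_mulR (D * `|xi| `^ s) (integrable_weight_powR s).
rewrite -RintegralB//.
have isub : unif.-integrable setT
    (EFin \o (fun x => phase mu (weight x * xi) th - phase nu (weight x * xi) th)).
  have := integrable_addR (iph mu) (integrable_mulR (-1) (iph nu)).
  by apply: eq_integrable => // x _; rewrite /= mulN1r.
apply: le_trans (Rintegral_le isub iD _) _ => [x /=|].
  apply: le_trans (h _ th) _.
  rewrite normrM (gtr0_norm (weight_gt0 _)) powRM ?(ltW (weight_gt0 _))//.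
  by rewrite le_eqVlt; apply/orP; left; apply/eqP; ring.
rewrite RintegralZl//; last exact: integrable_weight_powR.
by rewrite Rintegral_weight_powR// mulrC mulrA.
Qed.

End relax.

Section relaxed_collision.
Context {R : realType}.
Variables p q : R.
Hypotheses (p0 : 0 < p) (q0 : 0 < q).
Implicit Types mu nu : borel_probability R.

Let lam := p ^+ 2 + q ^+ 2 - 1.

Lemma half01 : 0 <= (2^-1 : R) <= 1.
Proof. by lra. Qed.

(* The measures with T mu = mu are the stationary ones: T samples the scaled
   dynamics at the first of the collision time and an independent truncation,
   with exp(- time) uniform on [1/2, 1]. *)
Definition collision_step mu : borel_probability R :=
  mixture (dist_dilation (2 `^ (lam / 2)) mu) (relax (lam / 2) (conv p q mu)) half01.

Lemma powR_half_compl (c : R) : c > 0 -> 0 < 2^-1 `^ c < 1.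
Proof.
move=> c0; rewrite powR_gt0//=.
have h : 2^-1 < 1 :> R by lra.
have := gt0_ltr_powR c0 _ _ h; rewrite powR1; apply; rewrite nnegrE; lra.
Qed.

Lemma powR_dilation (s : R) : (2 `^ (lam / 2)) `^ s = (2^-1 `^ (lam / 2 * s))^-1.
Proof.
have h c : 2^-1 `^ c = (2 `^ c)^-1 :> R.
  by rewrite -[2^-1]powR_inv1 ?ler0n// -powRrM mulN1r powRN.
by rewrite h invrK -powRrM.
Qed.

(** With c = p^2 + q^2 the two halves contribute 2^(- c) and 1 - 2^(- c) to the variance: the factor
    c gained in a collision cancels the 1 / c in the average of the squared weights. *)
Lemma centered_collision_step mu : centered mu 1 -> centered (collision_step mu) 1.
Proof.
move=> h.
have c0 : 0 < 2 * (lam / 2) + 1.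
  have : 0 < p ^+ 2 by rewrite exprn_gt0.
  have : 0 < q ^+ 2 by rewrite exprn_gt0.
  rewrite /lam; lra.
have d := centered_dilation (2 `^ (lam / 2)) h.
have rl := centered_relax (negbT (gt_eqF c0)) (centered_conv p q h).
have := centered_mixture half01 d rl.
congr centered.
have -> : (2 `^ (lam / 2)) ^+ 2 = 2^-1 * (2^-1 `^ (2 * (lam / 2) + 1))^-1 :> R.
  rewrite -powR_mulrn ?powR_ge0// powR_dilation powRD ?powRr1; last 2 first.
  - by rewrite invr_ge0.
  - by rewrite invr_eq0 pnatr_eq0 implybT.
  by rewrite invfM invrK mulrCA mulVf ?pnatr_eq0// mulr1 [lam / 2 * 2]mulrC.
have /andP[b0 b1] := powR_half_compl c0.
have -> : 2 * (lam / 2) + 1 = p ^+ 2 + q ^+ 2 by rewrite /lam; field.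
have e0 : 2 * (lam / 2) + 1 != 0 by rewrite gt_eqF.
move: b0 b1 e0; rewrite (_ : 2 * (lam / 2) + 1 = p ^+ 2 + q ^+ 2); last by rewrite /lam; field.
move=> b0 b1 e0.
by field; rewrite e0 gt_eqF.
Qed.

(** With c = lam s / 2 + 1, the new moment is the convex combination, with weights 2^(- c) and 1 -
    2^(- c), of the old moment and of the moment after collision divided by c. The level m is kept
    because kappa m + K <= c m. *)
Lemma moment_collision_step (s kappa K m : R) mu :
  kappa < lam / 2 * s + 1 -> 0 < lam / 2 * s + 1 -> 0 <= kappa ->
  has_moment s mu -> has_moment s (conv p q mu) ->
  moment s (conv p q mu) <= kappa * moment s mu + K ->
  K <= (lam / 2 * s + 1 - kappa) * m ->
  moment s mu <= m ->
  has_moment s (collision_step mu) /\ moment s (collision_step mu) <= m.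
Proof.
move=> kc c0 k0 imu iconv mconv Km mm.
have t0 : 0 < 2 `^ (lam / 2) :> R by rewrite powR_gt0.
have [d de] := moment_dilation t0 imu.
have [rl rle] := moment_relax (negbT (gt_eqF c0)) iconv.
have [hm ->] := moment_mixture half01 d rl; split=> //.
rewrite de rle powR_dilation invrK.
set c := lam / 2 * s + 1 in kc c0 Km rle *.
have /andP[b0 b1] := powR_half_compl c0.
have bE : 2^-1 `^ (lam / 2 * s) = 2 * 2^-1 `^ c.
  rewrite /c powRD ?powRr1 ?invr_ge0//; first by rewrite mulrCA mulfV ?mulr1 ?pnatr_eq0.
  by rewrite invr_eq0 pnatr_eq0 implybT.
rewrite bE; set b := 2^-1 `^ c in b0 b1 *.
have mc : moment s (conv p q mu) / c <= m.
  rewrite ler_pdivrMr//; apply: le_trans mconv _.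
  have := ler_wpM2l k0 mm; lra.
have h1 : (1 - 2^-1) * (moment s mu * (2 * b)) = b * moment s mu by field.
have h2 : 2^-1 * (2 * (1 - b) / c * moment s (conv p q mu)) =
  (1 - b) * (moment s (conv p q mu) / c) by field; rewrite gt_eqF.
rewrite h1 h2.
have := ler_wpM2l (ltW b0) mm.
have b1' : 0 <= 1 - b by lra.
have := ler_wpM2l b1' mc.
lra.
Qed.

(** The same convex combination, now of 1 and (p^s + q^s) / c. It is below 1 once p^s + q^s < c,
    that is, once [Spq] at s - 2 is negative. *)
Definition contraction (s : R) : R :=
  2^-1 `^ (lam / 2 * s + 1) + (1 - 2^-1 `^ (lam / 2 * s + 1)) *
    ((p `^ s + q `^ s) / (lam / 2 * s + 1)).

Lemma contraction_lt1 s : p `^ s + q `^ s < lam / 2 * s + 1 -> 0 <= contraction s < 1.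
Proof.
move=> h.
have k0 : 0 <= p `^ s + q `^ s by rewrite addr_ge0 ?powR_ge0.
have c0 : 0 < lam / 2 * s + 1 by exact: le_lt_trans h.
have /andP[b0 b1] := powR_half_compl c0.
have h1 : (p `^ s + q `^ s) / (lam / 2 * s + 1) < 1 by rewrite ltr_pdivrMr// mul1r.
have h0 : 0 <= (p `^ s + q `^ s) / (lam / 2 * s + 1) by rewrite divr_ge0// ltW.
rewrite /contraction; move: b0 b1 h0 h1.
set b := 2^-1 `^ _; set k := _ / _ => b0 b1 h0 h1.
by apply/andP; split; nra.
Qed.

Lemma phase_close_collision_step mu nu (s D : R) :
  0 < lam / 2 * s + 1 ->
  (forall xi, phase_close mu nu xi (D * `|xi| `^ s)) ->
  forall xi, phase_close (collision_step mu) (collision_step nu) xi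
    (contraction s * D * `|xi| `^ s).
Proof.
have avg (P1 Q1 P2 Q2 A B : R) : P1 - Q1 <= A -> P2 - Q2 <= B ->
  (1 - 2^-1) * P1 + 2^-1 * P2 - ((1 - 2^-1) * Q1 + 2^-1 * Q2) <=
  2^-1 * A + 2^-1 * B by lra.
move=> c0 h xi th; rewrite !phase_mixture !phase_dilation.
have hc eta : phase_close (conv p q mu) (conv p q nu) eta
    ((p `^ s + q `^ s) * D * `|eta| `^ s).
  apply: phase_close_le (phase_close_conv (h (p * eta)) (h (q * eta))).
  rewrite !normrM (gtr0_norm p0) (gtr0_norm q0) !powRM ?(ltW p0) ?(ltW q0)//.
  by rewrite le_eqVlt; apply/orP; left; apply/eqP; ring.
have hr := @phase_close_relax _ _ _ _ s _ (negbT (gt_eqF c0)) hc xi th.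
have t0 : 0 < 2 `^ (lam / 2) :> R by rewrite powR_gt0.
have hd := h (xi / 2 `^ (lam / 2)) th.
have E : `|xi / 2 `^ (lam / 2)| `^ s = `|xi| `^ s * (2 * 2^-1 `^ (lam / 2 * s + 1)).
  rewrite normrM powRM// normfV (gtr0_norm t0).
  rewrite -[(2 `^ (lam / 2))^-1]powR_inv1 ?(ltW t0)// -powRrM mulN1r powRN powR_dilation invrK.
  rewrite powRD ?powRr1 ?invr_ge0//; first by congr (_ * _); field.
  by rewrite invr_eq0 pnatr_eq0 implybT.
rewrite E in hd.
apply: le_trans (avg _ _ _ _ _ _ hd hr) _; rewrite le_eqVlt; apply/orP; left; apply/eqP.
rewrite /contraction.
set b := 2^-1 `^ _; set c := lam / 2 * s + 1; set X := `|xi| `^ s.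
by field; rewrite gt_eqF.
Qed.

End relaxed_collision.

(** * Passing to weak limits *)

Section lower_semicontinuity.
Context {R : realType}.
Implicit Types mu : borel_probability R.

Lemma cos_lipschitz (x y : R) : `|cos x - cos y| <= `|x - y|.
Proof.
wlog xy : x y / x <= y.
  move=> h; have [/h //|/ltW yx] := leP x y.
  by rewrite distrC [leRHS]distrC; exact: h.
have dc (z : R) : z \in `]x, y[%R -> is_derive z 1 cos (- sin z).
  by move=> _; exact: is_derive_cos.
have [|c _ e] := @MVT_segment R cos (fun z => - sin z) x y xy dc.
  by apply: continuous_subspaceT => z; exact: continuous_cos.
rewrite distrC e normrM [leRHS]distrC ler_piMl// normrN.
by rewrite ler_norml sin_geN1 sin_le1.
Qed.

Lemma powR_lipschitz (s k a b : R) : 1 <= s -> 0 <= b <= a -> a <= k ->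
  a `^ s - b `^ s <= s * k `^ (s - 1) * (a - b).
Proof.
move=> s1 /andP[b0 ba] ak.
have k0 : 0 <= k by apply: le_trans ak; exact: le_trans ba.
have mono c : 0 <= c -> c <= k -> c `^ (s - 1) <= k `^ (s - 1).
  by move=> c0 ck; apply: (ge0_ler_powR _ _ _ ck); rewrite ?nnegrE// subr_ge0.
move: b0; rewrite le_eqVlt => /predU1P[b0|b0].
  rewrite -b0 in ba *; rewrite powR0 ?subr0; last by apply/eqP; lra.
  rewrite (@powRS1 _ a)// [a * _]mulrC ler_wpM2r//.
  apply: le_trans (mono _ ba ak) _.
  by rewrite ler_peMl// powR_ge0.
have [ba'|ba'] := eqVneq b a; first by rewrite ba' !subrr mulr0.
have {}ba' : b < a by rewrite lt_neqAle ba' ba.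
have d (x : R) : x \in `]b, a[%R -> is_derive x 1 (fun y => y `^ s) (s * x `^ (s - 1)).
  by rewrite in_itv/= => /andP[bx _]; apply: is_derive1_powR; exact: lt_trans bx.
have [|c] := MVT ba' d.
  apply: continuous_in_subspaceT => x /set_mem/=; rewrite in_itv/= => /andP[bx _].
  have x0 : 0 < x by exact: lt_le_trans bx.
  exact: is_derive_continuous (is_derive1_powR s x0).
rewrite in_itv/= => /andP[bc ca] ->; rewrite ler_wpM2r ?subr_ge0//.
rewrite ler_wpM2l//; first by lra.
by apply: mono; [apply: ltW; exact: lt_trans bc|apply: le_trans ak; exact: ltW].
Qed.

(** For s >= 1 these are bounded Lipschitz functions, hence covered by [helly], and they increase
    with k to the full power. *)
Definition truncated_power (s k : R) (v : R) : R := (Num.min `|v| k) `^ s.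

Lemma truncated_power_le s k v : 0 <= s -> 0 <= k -> truncated_power s k v <= `|v| `^ s.
Proof.
move=> s0 k0; apply: (ge0_ler_powR s0); rewrite ?nnegrE ?le_min ?normr_ge0//.
by rewrite ge_min lexx.
Qed.

Lemma truncated_power_mono s k l v : 0 <= s -> 0 <= k <= l ->
  truncated_power s k v <= truncated_power s l v.
Proof.
move=> s0 /andP[k0 kl].
have h : Num.min `|v| k <= Num.min `|v| l by rewrite le_min2.
by apply: (ge0_ler_powR s0 _ _ h); rewrite nnegrE le_min normr_ge0//= (le_trans k0).
Qed.

Lemma truncated_power_bound s k v : 0 <= s -> 0 <= k -> `|truncated_power s k v| <= k `^ s.
Proof.
move=> s0 k0; rewrite ger0_norm ?powR_ge0//.
apply: (ge0_ler_powR s0); rewrite ?nnegrE ?le_min ?normr_ge0//.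
by rewrite ge_min lexx orbT.
Qed.

Lemma truncated_power_lipschitz s k x y : 1 <= s -> 0 <= k ->
  `|truncated_power s k x - truncated_power s k y| <= s * k `^ (s - 1) * `|x - y|.
Proof.
move=> s1 k0.
wlog xy : x y / `|y| <= `|x|.
  move=> h; have [/h //|/ltW yx] := leP `|y| `|x|.
  by rewrite distrC [`|x - y|]distrC; exact: h.
have m0 z : 0 <= Num.min `|z| k by rewrite le_min normr_ge0.
have mle : Num.min `|y| k <= Num.min `|x| k.
  by rewrite le_min !ge_min xy lexx orbT.
rewrite ger0_norm; last first.
  rewrite subr_ge0; apply: (ge0_ler_powR _ _ _ mle); rewrite ?nnegrE//; lra.
have mk : Num.min `|x| k <= k by rewrite ge_min lexx orbT.
apply: le_trans (powR_lipschitz s1 _ mk) _; first by rewrite m0.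
rewrite ler_wpM2l//; first by rewrite mulr_ge0 ?powR_ge0//; lra.
apply: le_trans (_ : `|x| - `|y| <= _); last exact: lerB_dist.
rewrite /Num.min; case: ltP => xk; case: ltP => yk; lra.
Qed.

Lemma cvg_phase (U : set_system nat) (mu_ : nat -> borel_probability R) mu xi th :
  (forall (phi : R -> R) (K M : R),
     measurable_fun setT phi -> (forall x, `|phi x| <= M) ->
     (forall x y, `|phi x - phi y| <= K * `|x - y|) ->
     \int[mu_ n]_v phi v @[n --> U] --> \int[mu]_v phi v) ->
  phase (mu_ n) xi th @[n --> U] --> phase mu xi th.
Proof.
move=> hmu; apply: (hmu _ `|xi| 1) => [|x|x y]; first exact: measurable_cos_affine.
  exact: normr_cos_le1.
apply: le_trans (cos_lipschitz _ _) _.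
by rewrite opprD addrACA subrr addr0 -mulrBr normrM.
Qed.

(** At a fixed truncation level the bound passes to the weak limit; monotone convergence then
    removes the truncation. *)
Lemma moment_lim (U : set_system nat) (mu_ : nat -> borel_probability R) mu (s m : R) :
  ProperFilter U -> 1 <= s ->
  (forall (phi : R -> R) (K M : R),
     measurable_fun setT phi -> (forall x, `|phi x| <= M) ->
     (forall x y, `|phi x - phi y| <= K * `|x - y|) ->
     \int[mu_ n]_v phi v @[n --> U] --> \int[mu]_v phi v) ->
  (forall n, has_moment s (mu_ n) /\ moment s (mu_ n) <= m) ->
  has_moment s mu /\ moment s mu <= m.
Proof.
move=> PU s1 cv hm; have s0 : 0 <= s by lra.
have mt k : measurable_fun setT (truncated_power s k).
  apply: (measurableT_comp (measurable_powR s)).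
  by apply: measurable_minr => //; exact: normr_measurable.
have tk (k : nat) : \int[mu]_v truncated_power s k%:R v <= m.
  have c := cv _ _ _ (mt k%:R) (fun x => truncated_power_bound x s0 (ler0n _ k))
    (fun x y => truncated_power_lipschitz x y s1 (ler0n _ k)).
  apply: (ler_cvg_to c (cvg_cst m)); apply: filterE => n.
  have [i le_m] := hm n; apply: le_trans le_m.
  apply: Rintegral_le => // [|v]; last exact: truncated_power_le.
  exact: (bounded_integrable _ (mt _) (fun x => truncated_power_bound x s0 (ler0n _ k))).
have le : (\int[mu]_v (`|v| `^ s)%:E <= m%:E)%E.
  have -> : (\int[mu]_v (`|v| `^ s)%:E =
      \int[mu]_v limn (fun k : nat => (truncated_power s k%:R v)%:E))%E.
    apply: eq_integral => v _; apply/esym/cvg_lim => //.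
    apply: cvg_near_cst; near=> k; congr EFin.
    rewrite /truncated_power min_l//; near: k; exact: nbhs_infty_ger.
  rewrite monotone_convergence//.
  - apply: lime_le.
      apply: ereal_nondecreasing_is_cvgn => i j ij.
      apply: ge0_le_integral => //.
      + by move=> v _; rewrite lee_fin powR_ge0.
      + exact/measurable_EFinP.
      + exact/measurable_EFinP.
      + by move=> v _; rewrite lee_fin truncated_power_mono// ler0n ler_nat.
    apply: nearW => k; rewrite ge0_EFin_Rintegral ?lee_fin//.
    exact: (bounded_integrable _ (mt _) (fun x => truncated_power_bound x s0 (ler0n _ k))).
  - by move=> k; exact/measurable_EFinP.
  - by move=> k v _; rewrite lee_fin powR_ge0.
  - by move=> v _ i j ij; rewrite lee_fin truncated_power_mono// ler0n ler_nat.
have hs : has_moment s mu.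
  by apply/M_spaceP; apply: le_lt_trans le _; rewrite ltry.
by split=> //; rewrite -lee_fin -ge0_EFin_Rintegral.
Unshelve. all: by end_near. Qed.

End lower_semicontinuity.

(** * Exponents and the sign of [Spq] *)

Section exponents.
Context {R : realType}.
Variables p q delta : R.
Hypotheses (p0 : 0 < p) (q0 : 0 < q) (d0 : 0 < delta) (S0 : Spq p q delta < 0).

Let lam := p ^+ 2 + q ^+ 2 - 1.

(** After division by x^2 this is [powR_le_affine] for x^u and the exponent t. *)
Lemma powR_convex_exponent (x u t : R) : 0 < x -> 0 <= t <= 1 ->
  x `^ (2 + t * u) <= t * x `^ (2 + u) + (1 - t) * x ^+ 2.
Proof.
move=> x0 /andP[t0 t1].
have x2 : x `^ 2 = x ^+ 2 by rewrite powR_mulrn// ltW.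
have E v : x `^ (2 + v) = x ^+ 2 * x `^ v.
  by rewrite powRD ?x2// (gt_eqF x0) implybT.
rewrite !E (_ : t * _ + _ = x ^+ 2 * (t * x `^ u + (1 - t))); last by ring.
rewrite ler_pM2l ?exprn_gt0//.
have [->|t0'] := eqVneq t 0; first by rewrite !mul0r powRr0 add0r subr0.
have [->|t1'] := eqVneq t 1; first by rewrite !mul1r subrr addr0.
rewrite mulrC powRrM; apply: powR_le_affine; first exact: powR_ge0.
by rewrite !lt_neqAle eq_sym t0' t0 t1' t1.
Qed.

Lemma SpqE (u : R) : p `^ (2 + u) + q `^ (2 + u) = lam / 2 * (2 + u) + 1 + Spq p q u.
Proof. by rewrite /Spq /lam; field. Qed.

(* An order at most 3, at which normalized laws are at finite Fourier distance. *)
Definition low_exponent : R := 2 + Num.min delta 1.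

Lemma low_exponent_itv : 2 < low_exponent <= 3.
Proof.
by rewrite /low_exponent /Num.min; case: (ltP delta 1) => d1; rewrite ltrDl ?ltr01 ?d0/=; lra.
Qed.

Lemma low_exponent_le : low_exponent <= 2 + delta.
Proof. by rewrite lerD2l ge_min lexx. Qed.

Lemma Spq_low_exponent : Spq p q (Num.min delta 1) < 0.
Proof.
rewrite /Num.min; case: (ltP delta 1) => [//|d1].
have t01 : 0 <= delta^-1 <= 1 by rewrite invr_ge0 ltW//= invf_le1.
have hp := powR_convex_exponent delta p0 t01; have hq := powR_convex_exponent delta q0 t01.
rewrite mulVf ?gt_eqF// in hp hq.
have : Spq p q 1 <= delta^-1 * Spq p q delta.
  have e : delta^-1 * delta = 1 by rewrite mulVf// gt_eqF.
  have ep : delta^-1 * delta * p ^+ 2 = p ^+ 2 by rewrite e mul1r.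
  have eq : delta^-1 * delta * q ^+ 2 = q ^+ 2 by rewrite e mul1r.
  rewrite /Spq; move: hp hq e ep eq; move: (delta^-1) (p `^ (2 + delta)) (q `^ (2 + delta)).
  by move: (p `^ (2 + 1)) (q `^ (2 + 1)) => a b i c d hp hq e ep eq; lra.
move=> /le_lt_trans; apply; by rewrite pmulr_rlt0// invr_gt0.
Qed.

Lemma contraction_low_exponent :
  p `^ low_exponent + q `^ low_exponent < lam / 2 * low_exponent + 1.
Proof. by rewrite SpqE -/lam -/low_exponent; have := Spq_low_exponent; lra. Qed.

(** The room between p^s + q^s and lam s / 2 + 1, with s = 2 + delta, is the absolute value of
    [Spq]. For delta <= 1 all of it is left, which gives the stated constant; for larger delta half
    of it is spent on the eps of [moment_conv_gt1]. *)
Lemma moment_conv_ineq : exists kappa K : R,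
  [/\ 0 <= kappa, kappa < lam / 2 * (2 + delta) + 1, 0 <= K,
      (forall mu, centered mu 1 -> has_moment (2 + delta) mu ->
        has_moment (2 + delta) (conv p q mu) /\
        moment (2 + delta) (conv p q mu) <= kappa * moment (2 + delta) mu + K) &
      delta <= 1 -> K / (lam / 2 * (2 + delta) + 1 - kappa) =
        (p ^+ 2 * q `^ delta + q ^+ 2 * p `^ delta) / `|Spq p q delta|].
Proof.
have k0 : 0 <= p `^ (2 + delta) + q `^ (2 + delta) by rewrite addr_ge0 ?powR_ge0.
have E := SpqE delta.
have [d1|d1] := leP delta 1.
  exists (p `^ (2 + delta) + q `^ (2 + delta)), (p ^+ 2 * q `^ delta + q ^+ 2 * p `^ delta).
  split=> //.
  - by rewrite E gtrDl.
  - by rewrite addr_ge0// mulr_ge0 ?powR_ge0 ?sqr_ge0.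
  - by move=> mu; apply: moment_conv_le1 => //; rewrite d0.
  - by move=> _; congr (_ / _); rewrite ltr0_norm// E; ring.
have e0 : 0 < - Spq p q delta / 2 by rewrite divr_gt0// oppr_gt0.
have s2 : 2 <= 2 + delta by rewrite lerDl ltW.
have [K K0 hK] := moment_conv_gt1 p0 q0 s2 e0.
exists (p `^ (2 + delta) + q `^ (2 + delta) + - Spq p q delta / 2), K; split=> //.
- by rewrite addr_ge0// ltW.
- by rewrite E; have := S0; lra.
Qed.

End exponents.

(** * Convergence of the iterated collision step *)

Section fixed_point.
Context {R : realType}.
Variables p q delta : R.
Hypotheses (p0 : 0 < p) (q0 : 0 < q) (d0 : 0 < delta) (S0 : Spq p q delta < 0).

Let lam := p ^+ 2 + q ^+ 2 - 1.

Lemma Rintegral_dirac (a : R) (f : R -> R) : measurable_fun setT f ->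
  (\d_a : borel_probability R).-integrable setT (EFin \o f) /\
  \int[\d_a]_v f v = f a.
Proof.
move=> mf; split; last by rewrite /Rintegral integral_dirac// ?diracT ?mul1e//;
  exact/measurable_EFinP.
apply/integrableP; split; first exact/measurable_EFinP.
rewrite integral_dirac//= ?diracT ?mul1e ?ltry//.
by apply/measurable_EFinP; exact: measurableT_comp.
Qed.

(** The fair coin on 1 and -1, from which the iteration starts. *)
Lemma exists_centered_moments : exists mu : borel_probability R,
  centered mu 1 /\ forall s, has_moment s mu.
Proof.
pose d1 : borel_probability R := \d_(1 : R).
pose d2 : borel_probability R := \d_(-1 : R).
have key f : measurable_fun setT f ->
    (mixture d1 d2 half01).-integrable setT (EFin \o f) /\
    \int[mixture d1 d2 half01]_v f v = (f 1 + f (-1)) / 2.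
  move=> mf; have [i1 e1] := Rintegral_dirac 1 mf; have [i2 e2] := Rintegral_dirac (-1) mf.
  have [i e] := Rintegral_mixture half01 i1 i2; split=> //.
  by rewrite e e1 e2; field.
exists (mixture d1 d2 half01); split=> [|s].
  have [a b] := key (fun v => v) (@measurable_id _ _ _).
  have [|c d] := key (fun v => v ^+ 2); first exact: measurable_funX.
  split=> //; first by rewrite b subrr mul0r.
  by rewrite d; field.
by have [] := key _ (measurable_powR_norm s).
Qed.

Lemma exists_ultra_infty : exists2 U : set_system nat, UltraFilter U & \oo `<=` U.
Proof. by have [U [UU h]] := @ultraFilterLemma nat \oo _; exists U. Qed.

Lemma exists_fixed_point : exists g : borel_probability R,
  [/\ centered g 1, has_moment (2 + delta) g &
      forall xi th, phase (collision_step p q g) xi th = phase g xi th].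
Proof.
have [kappa [K [k0 kc K0 hconv _]]] := moment_conv_ineq p0 q0 d0 S0.
have c0 : 0 < lam / 2 * (2 + delta) + 1 by exact: le_lt_trans kc.
have [mu0 [mu0c mu0m]] := exists_centered_moments.
(* The second entry is the level at which a gain kappa m + K equals (lam s / 2 + 1) m, for s = 2 +
   delta; any level above it is invariant. *)
pose m := Num.max (moment (2 + delta) mu0) (K / (lam / 2 * (2 + delta) + 1 - kappa)).
pose mu_ n := iter n (collision_step p q) mu0.
have muc n : centered (mu_ n) 1.
  elim: n => [//|n IH]; exact: centered_collision_step.
have mum n : has_moment (2 + delta) (mu_ n) /\ moment (2 + delta) (mu_ n) <= m.
  elim: n => [|n [IH1 IH2]]; first by split=> //; rewrite le_max lexx.
  have [h1 h2] := hconv _ (muc n) IH1.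
  apply: (moment_collision_step kc c0 k0 IH1 h1 h2) => //.
  rewrite mulrC -ler_pdivrMr; last by rewrite subr_gt0.
  by rewrite le_max lexx orbT.
pose s := low_exponent delta.
have /andP[s2 s3] := low_exponent_itv d0.
have s23 : 2 <= s <= 3 by rewrite s3 ltW.
have mus n : has_moment s (mu_ n).
  have [h _] := mum n; apply: integrable_lower_moment h.
  by rewrite (low_exponent_le delta) andbT; apply: le_trans (ltW s2).
have contr := contraction_low_exponent p0 q0 d0 S0.
have cs0 : 0 < lam / 2 * s + 1.
  by apply: le_lt_trans contr; rewrite addr_ge0 ?powR_ge0.
have /andP[r0 r1] := contraction_lt1 contr.
set r := contraction p q _ in r0 r1.
pose D0 := 3 * (moment s (mu_ 0%N) + moment s (mu_ 1%N)).
have D00 : 0 <= D0 by rewrite mulr_ge0// addr_ge0// moment_ge0.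
have clo0 := phase_close_centered s23 (muc 0%N) (muc 1%N) (mus 0%N) (mus 1%N).
(* The sum of the geometric series r^n D0 of successive distances. *)
pose D := D0 / (1 - r).
have D0' : 0 <= D by rewrite divr_ge0// subr_ge0 ltW.
have DE : D0 + r * D = D.
  have : D * (1 - r) = D0 by rewrite divfK// subr_eq0 gt_eqF.
  lra.
have step mu nu B : (forall xi, phase_close mu nu xi (B * `|xi| `^ s)) ->
    forall xi, phase_close (collision_step p q mu) (collision_step p q nu) xi
      (r * B * `|xi| `^ s).
  by move=> h; exact: (phase_close_collision_step p0 q0 cs0 h).
have clo n : forall xi, phase_close (mu_ 0%N) (mu_ n) xi (D * `|xi| `^ s).
  elim: n => [|n IH] xi th.
    by rewrite subrr mulr_ge0// powR_ge0.
  have h1 := clo0 xi th; have h2 := step _ _ _ IH xi th.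
  have -> : D * `|xi| `^ s = D0 * `|xi| `^ s + r * D * `|xi| `^ s.
    by rewrite -mulrDl DE.
  by rewrite -[leLHS](subrKA (phase (mu_ 1%N) xi th)); exact: lerD.
have clon n k : forall xi, phase_close (mu_ n) (mu_ (n + k)%N) xi (r ^+ n * D * `|xi| `^ s).
  elim: n => [|n IH] xi; first by rewrite expr0 mul1r; exact: clo.
  rewrite (_ : r ^+ n.+1 * D = r * (r ^+ n * D)); last by rewrite exprS mulrA.
  exact: step.
have [U UU ooU] := exists_ultra_infty.
have [g hg] := helly UU (tight_centered muc (fun=> lexx 1)).
have PU : ProperFilter U by exact: ultra_proper.
have cphase xi th : phase (mu_ n) xi th @[n --> U] --> phase g xi th.
  exact: cvg_phase.
(* The Cauchy estimate with its later index sent to infinity along U, which contains the tails of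
   nat. *)
have clog n xi : phase_close (mu_ n) g xi (r ^+ n * D * `|xi| `^ s).
  move=> th; rewrite lerBlDr -lerBlDl.
  apply: (ler_cvg_to (cvg_cst _) (cphase xi th)); apply: ooU.
  exists n => // k /= nk; have := clon n (k - n)%N xi th.
  by rewrite subnKC//; lra.
have s1 : 1 <= 2 + delta by have := d0; lra.
have [gm _] := moment_lim PU s1 hg mum.
exists g; split=> //.
- have gs : has_moment s g.
    apply: integrable_lower_moment gm.
    by rewrite (low_exponent_le delta) andbT; apply: le_trans (ltW s2).
  have := clog 0%N; rewrite expr0 mul1r => h.
  by apply: (centered_of_phase_close _ (muc 0%N) (mus 0%N) gs h); rewrite s2.
- move=> xi th; apply/eqP; rewrite -subr_eq0 -normr_le0.
  pose C := 2 * (D * `|xi| `^ s).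
  (* Both measures are within r^(n+1) D times the power of xi from the iterate of rank n + 1. *)
  have bnd n : `|phase (collision_step p q g) xi th - phase g xi th| <= C * r ^+ n.
    have h1 := phase_close_norm (step _ _ _ (clog n) xi) th.
    have h2 := phase_close_norm (clog n.+1 xi) th.
    have -> : phase (collision_step p q g) xi th - phase g xi th =
      (phase (mu_ n.+1) xi th - phase g xi th) -
      (phase (mu_ n.+1) xi th - phase (collision_step p q g) xi th).
      by rewrite [RHS]addrC opprB subrKA.
    apply: le_trans (ler_normB _ _) _; apply: le_trans (lerD h2 h1) _.
    rewrite exprS /C.
    have x0 : 0 <= r ^+ n * D * `|xi| `^ s
      by apply: mulr_ge0 (powR_ge0 _ _); apply: mulr_ge0 => //; exact: exprn_ge0.
    have := ler_wpM2r x0 (ltW r1); lra.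
  have cv : C * r ^+ n @[n --> \oo] --> C * 0.
    by apply: cvgMr; apply: cvg_expr; rewrite ger0_norm.
  rewrite mulr0 in cv.
  apply: (ler_cvg_to (cvg_cst _) cv); exact: nearW.
Qed.

End fixed_point.

(** * Fixed points are stationary *)

Section stationary_of_fixed_point.
Context {R : realType}.
Variables p q : R.
Hypotheses (p0 : 0 < p) (q0 : 0 < q).
Implicit Types g : borel_probability R.

Let lam := p ^+ 2 + q ^+ 2 - 1.

Lemma C1c_derive (phi : R -> R) : C1c phi ->
  forall x : R, is_derive x 1 phi ((phi^`())%classic x).
Proof. by move=> [d _ _] x; apply: DeriveDef => //; rewrite derive1E. Qed.

Lemma C1c_continuous (phi : R -> R) : C1c phi -> continuous phi.
Proof. by move=> h x; exact: is_derive_continuous (C1c_derive h x). Qed.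

Lemma C1c_bounded (phi : R -> R) : C1c phi -> exists M : R, forall v,
  `|phi v| <= M /\ `|(phi^`())%classic v * v| <= M.
Proof.
move=> h; have [_ cd cK] := h; have cphi := C1c_continuous h.
set K := closure _ in cK.
pose G v := Num.max `|phi v| `|(phi^`())%classic v * v|.
have cG : continuous G.
  move=> v.
  have c1 : {for v, continuous (fun v => `|phi v|)}.
    by apply: continuous_comp; [exact: cphi|exact: norm_continuous].
  have c2 : {for v, continuous (fun v => `|(phi^`())%classic v * v|)}.
    apply: continuous_comp; last exact: norm_continuous.
    by apply: cvgM; [exact: cd|exact: cvg_id].
  exact: (continuous_max c1 c2).
have /compact_bounded [B [_ hB]] : compact (G @` K).
  by apply: continuous_compact => //; exact: continuous_subspaceT.
have out v : ~ K v -> phi v = 0 /\ (phi^`())%classic v = 0.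
  move=> Kv.
  have nv : \forall x \near v, phi x = 0.
    have : nbhs v (~` K)
      by apply: open_nbhs_nbhs; split => //; apply: closed_openC; exact: closed_closure.
    apply: filterS => x Kx; apply/eqP; apply: contra_notT Kx => phix.
    exact: subset_closure.
  split; first exact: nbhs_singleton nv.
  rewrite derive1E (near_eq_derive (g := cst 0)) ?derive_cst//.
exists (Num.max 0 (`|B| + 1)) => v.
have [Kv|Kv] := pselect (K v); last first.
  by have [-> ->] := out v Kv; rewrite mul0r normr0 le_max lexx.
have := hB (`|B| + 1) _ (G v) (ex_intro2 _ _ v Kv erefl).
have -> : B < `|B| + 1 by apply: le_lt_trans (ler_norm B) _; rewrite ltrDl.
move=> /(_ isT); rewrite /= ger0_norm; last by rewrite /G le_max normr_ge0.
by rewrite /G ge_max => /andP[h1 h2]; rewrite !le_max h1 h2 !orbT.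
Qed.

(** Stationarity of g says that the integral of [generator phi] against g equals that of phi against
    [conv p q g]. *)
Definition generator (phi : R -> R) (v : R) : R :=
  phi v + lam / 2 * ((phi^`())%classic v * v).

Section generator.
Variable phi : R -> R.
Hypothesis hphi : C1c phi.

Lemma continuous_generator : continuous (generator phi).
Proof.
move=> v; have [_ cd _] := hphi; apply: cvgD; first exact: C1c_continuous.
by apply: cvgMr; apply: cvgM; [exact: cd|exact: cvg_id].
Qed.

Lemma generator_bounded : exists M, forall v, `|generator phi v| <= M.
Proof.
have [M hM] := C1c_bounded hphi; exists (M + `|lam / 2| * M) => v.
have [h1 h2] := hM v.
by rewrite (le_trans (ler_normD _ _))// lerD// normrM ler_wpM2l.
Qed.

(** Along the weight, the integrand is the derivative in x of x phi (c x^(lam / 2) z), so only the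
    values at 1/2 and 1 remain. *)
Lemma Rintegral_generator_weight (c z : R) :
  \int[unif]_x generator phi (c * (weight (lam / 2) x * z)) =
  2 * (phi (c * z) - 2^-1 * phi (c * (2^-1 `^ (lam / 2) * z))).
Proof.
have [M hM] := generator_bounded.
have d (x : R) : 0 < x -> is_derive x 1 (fun y => c * (y `^ (lam / 2) * z))
    (c * (lam / 2 * x `^ (lam / 2 - 1) * z)).
  move=> x0.
  have -> : (fun y : R => c * (y `^ (lam / 2) * z)) = (fun y => (c * z) * y `^ (lam / 2)).
    by apply/funext => y; ring.
  have dd := is_deriveZ (c * z) (is_derive1_powR (lam / 2) x0).
  by apply: is_derive_eq dd _; rewrite /GRing.scale/=; ring.
pose f (x : R) := generator phi (c * (x `^ (lam / 2) * z)).
pose F (x : R) := x * phi (c * (x `^ (lam / 2) * z)).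
have h1 (x : R) : 2^-1 <= x <= 1 -> {for x, continuous f}.
  move=> /andP[x1 _]; have x0 : 0 < x by lra.
  apply: (@continuous_comp _ _ _ (fun y => c * (y `^ (lam / 2) * z)) (generator phi)).
    exact: is_derive_continuous (d x x0).
  exact: continuous_generator.
have h2 (x : R) : 2^-1 <= x <= 1 -> `|f x| <= M by move=> _; exact: hM.
have h3 (x : R) : 2^-1 <= x <= 1 -> is_derive x 1 F (f x).
  move=> /andP[x1 _]; have x0 : 0 < x by lra.
  have dx := d x x0.
  have dphi := @is_derive1_comp R phi _ x _ _ (C1c_derive hphi _) dx.
  have dm := is_deriveM (is_derive_id x (1 : R)) dphi.
  apply: is_derive_eq dm _; rewrite /f /generator /GRing.scale/=.
  have xE : x `^ (lam / 2) = x * x `^ (lam / 2 - 1).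
    by rewrite -{2}[x]powRr1 ?(ltW x0)// -powRD ?subrKC// (gt_eqF x0) implybT.
  by rewrite [in X in _ = _ + _ * (_ * X)]xE; ring.
by rewrite (Rintegral_unif_FTC h1 h2 h3) /F powR1 !mul1r.
Qed.

Variable g : borel_probability R.
Hypothesis hg : forall xi th, phase (collision_step p q g) xi th = phase g xi th.

Let mgen (c : R) : measurable_fun setT (fun v : R => generator phi (c * v)).
Proof.
apply: continuous_measurable_fun => v; apply: continuous_comp.
  exact: mulrl_continuous.
exact: continuous_generator.
Qed.

Let mphi (c : R) : measurable_fun setT (fun v : R => phi (c * v)).
Proof.
apply: continuous_measurable_fun => v; apply: continuous_comp.
  exact: mulrl_continuous.
exact: C1c_continuous.
Qed.

(** The failure of stationarity on v -> phi (c v), whose generator is v -> generator phi (c v). *)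
Let defect (c : R) : R :=
  \int[g]_v generator phi (c * v) - \int[conv p q g]_z phi (c * z).

(** In the first integral g is replaced by its image under [collision_step]. The relaxed half yields
    the gain term at c minus half the gain term at the dilated c; the dilated half yields the
    matching generator term. *)
Let defect_half c : defect c = 2^-1 * defect (c * 2^-1 `^ (lam / 2)).
Proof.
have [M hM] := generator_bounded; have [N hN] := C1c_bounded hphi.
have hN1 c' v : `|phi (c' * v)| <= N by have [] := hN (c' * v).
have hM1 c' v : `|generator phi (c' * v)| <= M by exact: hM.
have same := phase_inj hg.
rewrite /defect; have -> : \int[g]_v generator phi (c * v) =
    \int[collision_step p q g]_v generator phi (c * v).
  rewrite /Rintegral; congr fine; apply: eq_measure_integral => A mA _.
  exact/esym/same.
have gi c' (P : borel_probability R) :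
    P.-integrable setT (EFin \o (fun v => generator phi (c' * v))).
  by apply: (bounded_integrable _ (mgen c') (hM1 c')).
have pi c' (P : borel_probability R) :
    P.-integrable setT (EFin \o (fun v => phi (c' * v))).
  by apply: (bounded_integrable _ (mphi c') (hN1 c')).
rewrite (Rintegral_mixture half01 (gi c _) (gi c _)).2.
rewrite (Rintegral_relax_bounded (lam / 2) (conv p q g) (mgen c) (hM1 c)).1.
rewrite (@eq_Rintegral _ _ _ (conv p q g) setT (fun z => 2 * (phi (c * z) -
  2^-1 * phi (c * (2^-1 `^ (lam / 2) * z))))); last first.
  by move=> z _; exact: Rintegral_generator_weight.
have [|_ ->] := @Rintegral_dilation R (2 `^ (lam / 2)) g (fun v => generator phi (c * v)) (mgen c).
  rewrite (_ : (fun v => _) = (fun v => generator phi ((c / 2 `^ (lam / 2)) * v))) //.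
  by apply/funext => v; congr generator; ring.
have E : c * 2^-1 `^ (lam / 2) = c / 2 `^ (lam / 2).
  have -> : 2^-1 = 2 `^ (-1) :> R by rewrite powR_inv1.
  by rewrite -powRrM mulN1r powRN.
rewrite RintegralZl//; last first.
  have := integrable_addR (pi c (conv p q g))
    (integrable_mulR (- 2^-1) (pi (c * 2^-1 `^ (lam / 2)) (conv p q g))).
  by apply: eq_integrable => // z _ /=; congr EFin; rewrite mulrA mulNr.
have -> : \int[conv p q g]_z (phi (c * z) - 2^-1 * phi (c * (2^-1 `^ (lam / 2) * z))) =
   \int[conv p q g]_z phi (c * z) - 2^-1 * (\int[conv p q g]_z phi (c * 2^-1 `^ (lam / 2) * z)).
  have i2 := integrable_mulR 2^-1 (pi (c * 2^-1 `^ (lam / 2)) (conv p q g)).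
  rewrite -(RintegralZl 2^-1 measurableT (pi _ (conv p q g))).
  rewrite -(RintegralB measurableT (pi c (conv p q g)) i2).
  by apply: eq_Rintegral => z _; rewrite mulrA.
have -> : \int[g]_v generator phi (c * (v / 2 `^ (lam / 2))) =
   \int[g]_v generator phi (c * 2^-1 `^ (lam / 2) * v).
  by apply: eq_Rintegral => v _; rewrite E; congr generator; ring.
by field.
Qed.

(** The defect is bounded uniformly in c and equals half of its value at another dilation; iterating
    forces it to vanish. *)
Lemma fixed_point_generator :
  \int[g]_v generator phi v = \int[conv p q g]_z phi z.
Proof.
have [M hM] := generator_bounded; have [N hN] := C1c_bounded hphi.
have bnd c : `|defect c| <= M + N.
  apply: le_trans (ler_normB _ _) _; apply: lerD; apply: norm_Rintegral_le => //.
  by move=> z; have [] := hN (c * z).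
have it n : forall c, `|defect c| <= (M + N) * 2^-1 ^+ n.
  elim: n => [|n IH] c; first by rewrite expr0 mulr1.
  rewrite defect_half normrM ger0_norm ?invr_ge0// exprS mulrCA ler_wpM2l//.
have : `|defect 1| <= 0.
  have cv : (M + N) * 2^-1 ^+ n @[n --> \oo] --> (M + N) * 0.
    apply: cvgMr; apply: cvg_expr; rewrite ger0_norm ?invr_ge0//; exact: half_lt1.
  rewrite mulr0 in cv.
  by apply: (ler_cvg_to (cvg_cst _) cv); apply: nearW => n; exact: it.
rewrite normr_le0 subr_eq0 => /eqP.
have e (f : R -> R) : (fun v => f (1 * v)) = f by apply/funext => v; rewrite mul1r.
by rewrite (e phi) (e (generator phi)).
Qed.

End generator.

Lemma fixed_point_stationary g :
  (forall xi th, phase (collision_step p q g) xi th = phase g xi th) ->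
  stationary p q g.
Proof.
move=> hg phi hphi; have [N hN] := C1c_bounded hphi.
have cphi := C1c_continuous hphi; have [_ cd _] := hphi.
have mphi : measurable_fun setT phi by exact: continuous_measurable_fun.
have hN1 v : `|phi v| <= N by have [] := hN v.
have mdv : measurable_fun setT (fun v => (phi^`())%classic v * v).
  apply: continuous_measurable_fun => v.
  by apply: cvgM; [exact: cd|exact: cvg_id].
have hN2 v : `|(phi^`())%classic v * v| <= N by have [] := hN v.
rewrite (collision_conv _ _ mphi hN1) -(fixed_point_generator hphi hg).
have i1 := bounded_integrable g mphi hN1; have i2 := bounded_integrable g mdv hN2.
have i3 := integrable_mulR (lam / 2) i2.
rewrite /generator (RintegralD _ i1 i3)// RintegralZl//.
by rewrite /lam; field.
Qed.

End stationary_of_fixed_point.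

(** * Dilations of a stationary solution solve the equation *)

Section quadratic_remainder.
Context {R : realType}.

(** An error bound of this form survives integration in a parameter, and it also differentiates the
    squared positive part across its kink. *)
Lemma is_derive_quadratic (f : R -> R) (x df C : R) :
  (forall u, `|f (u + x) - f x - df * u| <= C * u ^+ 2) -> is_derive x 1 f df.
Proof.
move=> fC.
have C0 : 0 <= C by have := le_trans (normr_ge0 _) (fC 1); rewrite expr1n mulr1.
have cv : h^-1 *: (f (h *: 1 + x) - f x) @[h --> 0^'] --> df.
  apply/cvgrPdist_le => e e0.
  have e1 : 0 < e / (C + 1) by rewrite divr_gt0// ltr_wpDl.
  near=> h.
  have h0 : h != 0 by near: h; exact: nbhs_dnbhs_neq.
  have hC : `|h| <= e / (C + 1) by near: h; exact: dnbhs0_le.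
  rewrite /GRing.scale/= mulr1.
  have -> : df - h^-1 * (f (h + x) - f x) = - (h^-1 * (f (h + x) - f x - df * h)).
    by field.
  rewrite normrN normrM normfV ler_pdivrMl ?normr_gt0//.
  apply: le_trans (fC h) _; rewrite -[h ^+ 2]real_normK ?num_real//.
  rewrite expr2 mulrCA ler_wpM2l//.
  rewrite ler_pdivlMr ?ltr_wpDl// in hC.
  apply: le_trans hC; rewrite mulrC ler_wpM2l//; lra.
by apply: DeriveDef; [apply/cvg_ex; exists df|exact: cvg_lim].
Unshelve. all: by end_near. Qed.

Lemma is_derive_sqr_pos (x : R) :
  is_derive x 1 (fun y : R => Num.max 0 y ^+ 2) (2 * Num.max 0 x).
Proof.
apply: (@is_derive_quadratic _ _ _ 1) => u; rewrite mul1r.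
have : Num.max 0 (u + x) = 0 /\ u + x <= 0 \/ Num.max 0 (u + x) = u + x /\ 0 <= u + x.
  by case: (leP 0 (u + x)) => h; [right|left]; split => //; exact: ltW.
have : Num.max 0 x = 0 /\ x <= 0 \/ Num.max 0 x = x /\ 0 <= x.
  by case: (leP 0 x) => h; [right|left]; split => //; exact: ltW.
by case=> -[-> hx]; case=> -[-> hux]; rewrite ler_norml; apply/andP; split; nra.
Qed.

End quadratic_remainder.

Section phase_derivative.
Context {R : realType}.
Variable mu : borel_probability R.
Hypothesis mu2 : mu.-integrable setT (EFin \o (fun v : R => v ^+ 2)).

Let int1 := integrable_id mu2.

Lemma measurable_idM_sin (xi th : R) :
  measurable_fun setT (fun v : R => v * sin (xi * v + th)).
Proof.
apply: continuous_measurable_fun => v; apply: cvgM; first exact: cvg_id.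
apply: (@continuous_comp _ _ _ (fun v => xi * v + th) sin).
  by apply: cvgD; [exact: mulrl_continuous|exact: cvg_cst].
exact: continuous_sin.
Qed.

Lemma normr_sin_le1 (x : R) : `|sin x| <= 1.
Proof. by rewrite ler_norml sin_geN1 sin_le1. Qed.

Lemma integrable_idM_sin xi th :
  mu.-integrable setT (EFin \o (fun v : R => v * sin (xi * v + th))).
Proof.
apply: (integrable_dominated (measurable_idM_sin xi th) int1) => v.
by rewrite normrM -[leRHS]mulr1 ler_wpM2l// normr_sin_le1.
Qed.

(** Second-order Taylor under the integral: the second moment makes the error quadratic in the
    increment. *)
Lemma is_derive_phase (xi th : R) : is_derive xi 1 (fun xi => phase mu xi th)
  (- \int[mu]_v (v * sin (xi * v + th))).
Proof.
(* 3 for the Taylor remainder at s = 2 and 1/2 for the quadratic term of the polynomial, rounded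
   up. *)
pose C : R := 4 * (\int[mu]_v (v ^+ 2)).
apply: (@is_derive_quadratic _ _ _ _ C) => u.
have i1 := integrable_cos_affine mu (u + xi) th.
have i2 := integrable_mulR (-1) (integrable_cos_affine mu xi th).
have i3 := integrable_mulR u (integrable_idM_sin xi th).
have i12 := integrable_addR i1 i2; have i := integrable_addR i12 i3.
have -> : phase mu (u + xi) th - phase mu xi th - - (\int[mu]_v (v * sin (xi * v + th))) * u =
  \int[mu]_v (cos ((u + xi) * v + th) + -1 * cos (xi * v + th) + u * (v * sin (xi * v + th))).
  rewrite (RintegralD _ i12 i3)// (RintegralD _ i1 i2)//.
  rewrite (RintegralZl _ _ (integrable_idM_sin xi th))//.
  by rewrite (RintegralZl _ _ (integrable_cos_affine mu xi th))// /phase; ring.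
apply: le_trans (le_normr_Rintegral _ i) _ => //.
have -> : C * u ^+ 2 = \int[mu]_v (4 * u ^+ 2 * v ^+ 2).
  by rewrite RintegralZl// /C; ring.
apply: Rintegral_le; [exact: (integrable_norm i)|exact: integrable_mulR|] => v.
have s23 : 2 <= (2 : R) <= 3 by rewrite lexx/= ler_nat.
have := @cosD_taylor_powR R (u * v) (xi * v + th) 2 s23.
rewrite powR_mulrn// real_normK ?num_real// exprMn => h.
have -> : (u + xi) * v + th = u * v + (xi * v + th) by ring.
have c1 := normr_cos_le1 (xi * v + th).
set X := cos (u * v + _) in h *; set c := cos (xi * v + th) in c1 h *.
set s := sin _ in h *.
rewrite (_ : _ + _ + _ = (X - (c * (1 - u ^+ 2 * v ^+ 2 / 2) - s * (u * v))) -
   c * (u ^+ 2 * v ^+ 2 / 2)); last by field.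
apply: le_trans (ler_normB _ _) _.
have w0 : 0 <= u ^+ 2 * v ^+ 2 by rewrite mulr_ge0 ?sqr_ge0.
have : `|c * (u ^+ 2 * v ^+ 2 / 2)| <= u ^+ 2 * v ^+ 2 / 2.
  by rewrite normrM [X in _ * X]ger0_norm ?divr_ge0// ler_piMl ?divr_ge0.
lra.
Qed.

End phase_derivative.

Section convolution_phase.
Context {R : realType}.
Variables p q : R.

Lemma phase_convE mu xi th : phase (conv p q mu) xi th =
  \int[mu]_v phase mu (q * xi) (p * xi * v + th).
Proof.
rewrite phase_conv.
pose f (vw : R * R) := cos (xi * (p * vw.1 + q * vw.2) + th).
have mf : measurable_fun setT f.
  apply: measurableT_comp (@measurable_cos_affine _ xi th) _.
  exact: measurable_collide.
have f1 x : `|f x| <= 1 by exact: normr_cos_le1.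
rewrite (Rintegral_prod12 mu mu mf f1); apply: eq_Rintegral => v _.
by apply: eq_Rintegral => w _; rewrite /f/=; congr cos; ring.
Qed.

Lemma continuous_phase_shift mu (xi a b : R) :
  continuous (fun v => phase mu xi (a * v + b)).
Proof.
have -> : (fun v => phase mu xi (a * v + b)) =
    (fun v => phase mu xi 0 * cos (a * v + b) + phase mu xi (pi / 2) * sin (a * v + b)).
  by apply/funext => v; rewrite !phase_fourier cos0 sin0 cos_pihalf sin_pihalf; ring.
move=> v; apply: cvgD; apply: cvgMr.
  exact: continuous_cos_affine.
apply: (@continuous_comp _ _ _ (fun v => a * v + b) sin).
  by apply: cvgD; [exact: mulrl_continuous|exact: cvg_cst].
exact: continuous_sin.
Qed.

Lemma phase_conv_dilation c mu xi th :
  phase (conv p q (dist_dilation c mu)) xi th = phase (conv p q mu) (xi / c) th.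
Proof.
have m (xi' a b : R) : measurable_fun setT (fun v : R => phase mu xi' (a * v + b)).
  by apply: continuous_measurable_fun; exact: continuous_phase_shift.
rewrite !phase_convE.
under eq_Rintegral do rewrite phase_dilation.
rewrite (Rintegral_dilation _ _).2; [| |].
- by apply: eq_Rintegral => v _; congr phase; ring.
- exact: m.
- apply: (@bounded_integrable _ _ _ mu _ 1) => [|v]; last exact: normr_phase_le1.
  apply: (eq_measurable_fun (fun v => phase mu (q * xi / c) (p * xi / c * v + th))) => //.
  by move=> v _; congr phase; ring.
Qed.

End convolution_phase.

(** * Truncated cosines as test functions *)

Section cutoff.
Context {R : realType}.

(** Squaring the positive part makes it continuously differentiable at the edge of its support,
    which is the regularity required by [C1c]. *)
Definition cutoff (n : nat) (v : R) : R := Num.max 0 (1 - (v / n.+1%:R) ^+ 2) ^+ 2.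

Definition cutoff_cos xi th n (v : R) : R := cos (xi * v + th) * cutoff n v.

Lemma is_derive_cutoff_cos xi th n (v : R) : is_derive v 1 (cutoff_cos xi th n)
  (- xi * sin (xi * v + th) * cutoff n v - cos (xi * v + th) *
    (4 * Num.max 0 (1 - (v / n.+1%:R) ^+ 2) * v / n.+1%:R ^+ 2)).
Proof.
pose N : R := n.+1%:R.
have N0 : N != 0 by rewrite pnatr_eq0.
have d1 : is_derive v (1 : R) (fun v : R => 1 - (v / N) ^+ 2) (- (2 * v / N ^+ 2)).
  apply: (@is_derive_quadratic _ _ _ _ (N^-1 ^+ 2)) => u.
  rewrite (_ : 1 - _ - _ - _ = - (N^-1 ^+ 2 * u ^+ 2)); last by field.
  by rewrite normrN ger0_norm// mulr_ge0// sqr_ge0.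
have d2 := @is_derive1_comp R _ _ v _ _ (is_derive_sqr_pos _) d1.
have da : is_derive v (1 : R) (fun v : R => xi * v + th) xi.
  by apply: (@is_derive_quadratic _ _ _ _ 0) => u; rewrite mul0r normr_le0; apply/eqP; ring.
have d3 := @is_derive1_comp R cos _ v _ _ (is_derive_cos _) da.
have d := is_deriveM d3 d2.
by apply: is_derive_eq d _; rewrite /GRing.scale/= /cutoff -/N; field.
Qed.

Lemma cutoff_itv n (v : R) : 0 <= cutoff n v <= 1.
Proof.
rewrite /cutoff sqr_ge0/= -[leRHS](expr1n _ 2) lerXn2r ?nnegrE ?le_max ?lexx//.
by rewrite ge_max ler01 lerBlDr lerDl sqr_ge0.
Qed.

Lemma cutoff_cos_bound xi th n (v : R) : `|cutoff_cos xi th n v| <= 1.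
Proof.
have /andP[h0 h1] := cutoff_itv n v.
rewrite normrM [X in _ * X]ger0_norm// -[leRHS]mulr1.
by apply: ler_pM => //; exact: normr_cos_le1.
Qed.

Lemma derive_cutoff_cos xi th n : ((cutoff_cos xi th n)^`())%classic = (fun v : R =>
  - xi * sin (xi * v + th) * cutoff n v - cos (xi * v + th) *
    (4 * Num.max 0 (1 - (v / n.+1%:R) ^+ 2) * v / n.+1%:R ^+ 2)).
Proof.
by apply/funext => v; rewrite derive1E; have [_ ->] := is_derive_cutoff_cos xi th n v.
Qed.

Lemma C1c_cutoff_cos xi th n : C1c (cutoff_cos xi th n).
Proof.
split.
- by move=> v; have [] := is_derive_cutoff_cos xi th n v.
- rewrite derive_cutoff_cos => v.
  have c0 : {for v, continuous (fun v : R => v / n.+1%:R)} by exact: mulrr_continuous.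
  have c1 : {for v, continuous (fun v : R => Num.max 0 (1 - (v / n.+1%:R) ^+ 2))}.
    have c2 : {for v, continuous (fun v : R => 1 - (v / n.+1%:R) ^+ 2)}.
      apply: cvgB; first exact: cvg_cst.
      by rewrite expr2; under eq_fun do rewrite expr2; exact: cvgM.
    by apply: (continuous_max _ c2); exact: cvg_cst.
  have cs : {for v, continuous (fun v : R => sin (xi * v + th))}.
    apply: (@continuous_comp _ _ _ (fun v => xi * v + th) sin).
      by apply: cvgD; [exact: mulrl_continuous|exact: cvg_cst].
    exact: continuous_sin.
  apply: cvgB; apply: cvgM.
  + by apply: cvgM => //; exact: cvg_cst.
  + by rewrite /cutoff expr2; under eq_fun do rewrite expr2; exact: cvgM.
  + exact: continuous_cos_affine.
  + apply: cvgM; last exact: cvg_cst.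
    by apply: cvgM; last exact: cvg_id; apply: cvgM; first exact: cvg_cst.
- pose N : R := n.+1%:R.
  apply: (@subclosed_compact _ _ `[- N, N]%classic); first exact: closed_closure.
    exact: segment_compact.
  rewrite closureE; apply: smallest_sub; first exact: itv_closed.
  move=> v /=; rewrite in_itv/= -ler_norml; apply: contra_neqT; rewrite -ltNge => h.
  rewrite /cutoff_cos /cutoff max_l ?expr0n ?mulr0// subr_le0 -[leLHS](expr1n _ 2).
  rewrite -[leRHS]real_normK ?num_real// lerXn2r ?nnegrE//.
  by rewrite normrM normfV normr_nat ler_pdivlMr ?ltr0n// mul1r ltW.
Qed.

(** A bound free of n, integrable for a law with second moment, for dominated convergence. With w =
    (v / N)^2, differentiating the cutoff produces 4 w max (0, 1 - w), and w max (0, 1 - w) is at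
    most 1. *)
Lemma derive_cutoff_cos_bound xi th n (v : R) :
  `|((cutoff_cos xi th n)^`())%classic v * v| <= `|xi| * `|v| + 4.
Proof.
rewrite derive_cutoff_cos.
have /andP[h0 h1] := cutoff_itv n v.
pose N : R := n.+1%:R.
have N0 : N != 0 by rewrite pnatr_eq0.
set m := Num.max _ _.
have m0 : 0 <= m by rewrite le_max lexx.
have m1 : m * (v / N) ^+ 2 <= 1.
  rewrite /m -/N; move: (_ ^+ 2) (sqr_ge0 (v / N)) => w w0.
  by case: (leP 0 (1 - w)) => h; nra.
rewrite -/N (_ : (_ - _) * v = - xi * v * (sin (xi * v + th) * cutoff n v) +
  - (4 * (cos (xi * v + th) * (m * (v / N) ^+ 2)))); last by field.
apply: le_trans (ler_normD _ _) _; apply: lerD.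
  rewrite normrM [`|- xi * v|]normrM normrN -[leRHS]mulr1 ler_wpM2l ?mulr_ge0//.
  rewrite normrM [`|cutoff n v|]ger0_norm//.
  by rewrite -[leRHS]mulr1 ler_pM// normr_sin_le1.
rewrite normrN normrM ger0_norm// -[leRHS]mulr1 ler_wpM2l// normrM.
rewrite -[leRHS]mulr1 ler_pM//; first exact: normr_cos_le1.
by rewrite ger0_norm// mulr_ge0 ?sqr_ge0.
Qed.

Let cvg_div (v : R) : v / n.+1%:R @[n --> \oo] --> 0.
Proof.
rewrite -[X in _ --> X](mulr0 v); apply: cvgMr; exact: cvg_harmonic.
Qed.

Let cvg_max (v : R) : Num.max 0 (1 - (v / n.+1%:R) ^+ 2) @[n --> \oo] --> (1 : R).
Proof.
have c : {for (0 : R), continuous (fun y : R => Num.max 0 (1 - y ^+ 2))}.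
  apply: (@continuous_max _ _ (cst 0) (fun y : R => 1 - y ^+ 2) 0).
    exact: cvg_cst.
  by apply: cvgB; [exact: cvg_cst|exact: exprn_continuous].
have := @continuous_cvg _ _ _ \oo _ _ _ _ c (@cvg_div v).
by rewrite [X in _ --> X]/= expr0n/= subr0 max_r//; apply.
Qed.

Lemma cvg_cutoff (v : R) : cutoff n v @[n --> \oo] --> (1 : R).
Proof.
have := @continuous_cvg _ _ _ \oo _ _ _ _ (@exprn_continuous _ 2 (1 : R)) (@cvg_max v).
by rewrite [X in _ --> X]/= expr1n; apply.
Qed.

Lemma cvg_cutoff_cos xi th v : cutoff_cos xi th n v @[n --> \oo] --> cos (xi * v + th).
Proof. by rewrite -[X in _ --> X]mulr1; apply: cvgMr; exact: cvg_cutoff. Qed.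

Lemma cvg_derive_cutoff_cos xi th v :
  ((cutoff_cos xi th n)^`())%classic v * v @[n --> \oo] -->
  - xi * (v * sin (xi * v + th)).
Proof.
have -> : - xi * (v * sin (xi * v + th)) = - xi * v * sin (xi * v + th) * 1 -
    4 * cos (xi * v + th) * (1 * 0 ^+ 2) by ring.
rewrite (_ : (fun n => _) = (fun n => - xi * v * sin (xi * v + th) * cutoff n v -
    4 * cos (xi * v + th) * (Num.max 0 (1 - (v / n.+1%:R) ^+ 2) * (v / n.+1%:R) ^+ 2))).
  apply: cvgB; apply: cvgMr; first exact: cvg_cutoff.
  apply: cvgM; first exact: cvg_max.
  by apply: (@continuous_cvg _ _ _ \oo _ _ _ _ (@exprn_continuous _ 2 (0 : R)) (@cvg_div v)).
apply/funext => n; rewrite derive_cutoff_cos.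
have N0 : n.+1%:R != 0 :> R by rewrite pnatr_eq0.
by move: (n.+1%:R) N0 => N N0; field.
Qed.

End cutoff.

(** * From stationarity to a Fourier flow *)

Section stationary_flow.
Context {R : realType}.
Variables p q : R.
Let lam := p ^+ 2 + q ^+ 2 - 1.
Variables (h : borel_probability R).
Hypothesis h2 : h.-integrable setT (EFin \o (fun v : R => v ^+ 2)).
Hypothesis hs : stationary p q h.

(** By [is_derive_phase] the left side is lam / 2 times xi times the derivative of the phase in xi:
    a transport term, which dilating in time turns into a time derivative. *)
Lemma stationary_phase xi th :
  lam / 2 * (- xi * \int[h]_v (v * sin (xi * v + th))) =
  phase (conv p q h) xi th - phase h xi th.
Proof.
have int1 := integrable_id h2.
have mc n : measurable_fun setT (cutoff_cos xi th n).
  apply: continuous_measurable_fun => v.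
  exact: is_derive_continuous (is_derive_cutoff_cos _ _ _ _).
have cr (mu : borel_probability R) :
    \int[mu]_v cutoff_cos xi th n v @[n --> \oo] --> phase mu xi th.
  apply: (@bounded_cvg_Rintegral _ _ _ mu _ _ 1) => // [n v|v].
    exact: cutoff_cos_bound.
  exact: cvg_cutoff_cos.
have cl : \int[h]_v (((cutoff_cos xi th n)^`())%classic v * v) @[n --> \oo] -->
    - xi * \int[h]_v (v * sin (xi * v + th)).
  rewrite -RintegralZl//; last exact: integrable_idM_sin.
  have [||||_ //] := @dominated_cvg_Rintegral _ _ _ h
    (fun n v => ((cutoff_cos xi th n)^`())%classic v * v)
    (fun v => - xi * (v * sin (xi * v + th))) (fun v => `|xi| * `|v| + 4).
  - move=> n; apply: continuous_measurable_fun => v.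
    by have [_ cd _] := C1c_cutoff_cos xi th n; apply: cvgM; [exact: cd|exact: cvg_id].
  - by move=> v; exact: cvg_derive_cutoff_cos.
  - apply: integrable_addR; last exact: integrable_cstR.
    exact: integrable_mulR (integrable_norm int1).
  - by move=> n v; exact: derive_cutoff_cos_bound.
have e n := hs (C1c_cutoff_cos xi th n).
have l1 : 2^-1 * lam * (\int[h]_v (((cutoff_cos xi th n)^`())%classic v * v)) @[n --> \oo] -->
    2^-1 * lam * (- xi * \int[h]_v (v * sin (xi * v + th))) by exact: cvgMr.
have l2 : \int[conv p q h]_v cutoff_cos xi th n v - \int[h]_v cutoff_cos xi th n v @[n --> \oo]
    --> phase (conv p q h) xi th - phase h xi th by exact: cvgB.
rewrite (_ : lam / 2 = 2^-1 * lam); last exact: mulrC.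
rewrite (_ : (fun n => _) = (fun n => \int[conv p q h]_v cutoff_cos xi th n v -
    \int[h]_v cutoff_cos xi th n v)) in l1; last first.
  apply/funext => n.
  by rewrite -(collision_conv _ _ (mc n) (cutoff_cos_bound xi th n)) -e.
exact: norm_cvg_unique l1 l2.
Qed.

(** The unscaled flow whose rescaling by sqrt E is constantly h. *)
Definition dilation_flow (t : R) := dist_dilation (expR (lam / 2 * t))^-1 h.

Lemma phase_dilation_flow t xi th :
  phase (dilation_flow t) xi th = phase h (xi * expR (lam / 2 * t)) th.
Proof. by rewrite phase_dilation invrK. Qed.

Lemma stationary_flow : fourier_flow p q dilation_flow.
Proof.
move=> xi th.
have d (t : R) : is_derive t 1 (fun s => phase (dilation_flow s) xi th)
    (phase (conv p q (dilation_flow t)) xi th - phase (dilation_flow t) xi th).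
  rewrite phase_conv_dilation invrK phase_dilation_flow -stationary_phase.
  rewrite (_ : (fun s => _) = (fun s => phase h (xi * expR (lam / 2 * s)) th)); last first.
    by apply/funext => s; exact: phase_dilation_flow.
  have d1 := is_deriveZ xi (is_derive_expRM (lam / 2) t).
  have d2 := @is_derive1_comp R _ _ t _ _ (is_derive_phase h2 (xi * expR (lam / 2 * t)) th) d1.
  by apply: is_derive_eq d2 _; rewrite /GRing.scale/=; ring.
split; last by move=> t _; exact: d.
by apply: cvg_at_right_filter; exact: is_derive_continuous (d 0).
Qed.

End stationary_flow.

(** * Exponential decay and uniqueness *)

Section convergence.
Context {R : realType}.
Variables p q : R.
Hypotheses (p0 : 0 < p) (q0 : 0 < q).
Let lam := p ^+ 2 + q ^+ 2 - 1.

Lemma sqrt_energy t : Num.sqrt (energy p q t) = expR (lam / 2 * t).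
Proof.
rewrite (_ : energy p q t = expR (lam / 2 * t) ^+ 2).
  by rewrite sqrtr_sqr ger0_norm// expR_ge0.
by rewrite expr2 -expRD /energy; congr expR; rewrite /lam; field.
Qed.

Lemma scaledE f t : scaled p q f t = dist_dilation (expR (lam / 2 * t)) (f t).
Proof. by rewrite /scaled sqrt_energy. Qed.

Lemma phase_scaled f t xi th :
  phase (scaled p q f t) xi th = phase (f t) (xi / expR (lam / 2 * t)) th.
Proof. by rewrite scaledE phase_dilation. Qed.

Section stationary.
Variable g : borel_probability R.
Hypothesis g2 : g.-integrable setT (EFin \o (fun v : R => v ^+ 2)).
Hypothesis gs : stationary p q g.

Lemma scaled_contract f (u D : R) : fourier_flow p q f -> 0 <= D ->
  (forall xi, phase_close (f 0) g xi (D * `|xi| `^ (2 + u))) ->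
  forall t xi, 0 <= t -> phase_close (scaled p q f t) g xi
    (D * expR (Spq p q u * t) * `|xi| `^ (2 + u)).
Proof.
move=> ff D0 init t xi t0 th.
set e := expR (lam / 2 * t).
have e0 : 0 < e by exact: expR_gt0.
have init' xi' : phase_close (f 0) (dilation_flow p q g 0) xi' (D * `|xi'| `^ (2 + u)).
  by move=> th'; rewrite phase_dilation_flow mulr0 expR0 mulr1; exact: init.
have := fourier_flow_contract p0 q0 ff (stationary_flow g2 gs) D0 init' (xi / e) t0 th.
rewrite phase_scaled -/e phase_dilation_flow -/e divfK ?gt_eqF//.
congr (_ <= _).
rewrite normrM (@ger0_norm _ e^-1) ?invr_ge0 ?ltW// powRM ?invr_ge0// ?ltW//.
have key : e^-1 `^ (2 + u) * expR ((p `^ (2 + u) + q `^ (2 + u) - 1) * t) =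
    expR (Spq p q u * t).
  by rewrite /e -expRN -expRM -expRD SpqE; congr expR; rewrite /lam; field.
by rewrite -key; ring.
Qed.

End stationary.

Lemma le0_of_expR_decay (a B S : R) : S < 0 ->
  (forall t, 0 <= t -> a <= B * expR (S * t)) -> a <= 0.
Proof.
move=> S0 h; rewrite leNgt; apply/negP => a0.
have B0 : 0 < B by have := h 0 (lexx _); rewrite mulr0 expR0 mulr1; exact: lt_le_trans.
(* At this time - S t = B / a, and 1 + x <= exp x turns the assumed decay into a + B <= B. *)
pose t := B / (a * - S).
have t0 : 0 <= t by rewrite divr_ge0 ?mulr_ge0 ?oppr_ge0// ltW.
have := h t t0; rewrite -[S * t]opprK expRN ler_pdivlMr ?expR_gt0//.
have := expR_ge1Dx (- (S * t)).
have -> : - (S * t) = B / a by rewrite /t; field; lra.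
move=> h1; have : a * (1 + B / a) <= a * expR (B / a) by rewrite ler_wpM2l// ltW.
by rewrite mulrDr mulr1 mulrCA divff ?gt_eqF// mulr1; lra.
Qed.

(** The rescaled flow of h stays at h, so the decaying bound on its distance to g applies at every
    time to the same pair of measures. *)
Lemma stationary_unique (delta : R) g h : 0 < delta -> Spq p q delta < 0 ->
  centered g 1 -> centered h 1 ->
  has_moment (2 + delta) g -> has_moment (2 + delta) h ->
  stationary p q g -> stationary p q h -> same_measure h g.
Proof.
move=> d0 S0 cg ch mg mh sg sh.
pose u := Num.min delta 1.
have u0 : 0 < u by rewrite lt_min d0 ltr01.
have S1 : Spq p q u < 0 by exact: Spq_low_exponent.
have u23 : 2 <= 2 + u <= 3.
  by have /andP[/ltW h1 h2] := low_exponent_itv d0; rewrite h1.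
have low mu : has_moment (2 + delta) mu -> has_moment (2 + u) mu.
  by apply: integrable_lower_moment; rewrite lerD2l ge_min lexx andbT addr_ge0// ltW.
have close := phase_close_centered u23 ch cg (low _ mh) (low _ mg).
set D := 3 * _ in close.
have D0 : 0 <= D by rewrite mulr_ge0// addr_ge0// moment_ge0.
have init xi : phase_close (dilation_flow p q h 0) g xi (D * `|xi| `^ (2 + u)).
  by move=> th; rewrite phase_dilation_flow mulr0 expR0 mulr1; exact: close.
have contr := scaled_contract (centered_int2 cg) sg (stationary_flow (centered_int2 ch) sh) D0 init.
apply: phase_inj => xi th; apply/eqP; rewrite -subr_eq0 -normr_le0.
apply: (@le0_of_expR_decay _ (D * `|xi| `^ (2 + u)) _ S1) => t t0.
have := phase_close_norm (contr t xi t0) th.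
by rewrite phase_scaled phase_dilation_flow divfK ?gt_eqF ?expR_gt0// mulrAC.
Qed.

Lemma fourier_dist_decay (delta : R) f (f0 g : borel_probability R) :
  0 < delta -> Spq p q delta < 0 ->
  fourier_flow p q f -> (forall xi th, phase (f 0) xi th = phase f0 xi th) ->
  g.-integrable setT (EFin \o (fun v : R => v ^+ 2)) -> stationary p q g ->
  forall t, 0 <= t ->
  (fourier_dist (2 + delta) (scaled p q f t) g <=
   fourier_dist (2 + delta) f0 g * (expR (- `|Spq p q delta| * t))%:E)%E.
Proof.
move=> d0 S0 ff f00 g2 gs t t0.
have s0 : 2 + delta != 0 by rewrite gt_eqF// addr_gt0.
have := fourier_dist_ge0 (2 + delta) f0 g.
case E : (fourier_dist (2 + delta) f0 g) => [D| |] // _; last first.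
  (* An infinite initial distance makes the right-hand side infinite. *)
  by rewrite gt0_mulye ?leey// lte_fin expR_gt0.
have [D0 close] : 0 <= D /\ forall xi, phase_close f0 g xi (D * `|xi| `^ (2 + delta)).
  by apply/fourier_distP => //; rewrite E.
rewrite ltr0_norm// opprK -EFinM; apply/fourier_distP => //.
split; first by rewrite mulr_ge0// expR_ge0.
move=> xi; apply: scaled_contract => // xi' th; rewrite f00; exact: close.
Qed.

End convergence.

(** * Propagation of moments *)

Section euler_estimate.
Context {R : realType}.
Variables p q : R.
Variable f : R -> borel_probability R.
Hypothesis ff : fourier_flow p q f.

Let drift t xi th := phase (conv p q (f t)) xi th - phase (f t) xi th.

Lemma fourier_flow_MVT xi th (a b : R) : 0 <= a -> a < b -> exists2 c, a < c < b &
  phase (f b) xi th - phase (f a) xi th = drift c xi th * (b - a).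
Proof.
move=> a0 ab; have [c0 d] := ff xi th.
have cont x : 0 < x -> {for x, continuous (fun t => phase (f t) xi th)}.
  by move=> x0; exact: is_derive_continuous (d x x0).
have b0 : 0 < b by exact: le_lt_trans ab.
have [||c] := @MVT R (fun t => phase (f t) xi th) (fun t => drift t xi th) a b ab.
- by move=> x; rewrite in_itv/= => /andP[ax _]; apply: d; exact: le_lt_trans ax.
- apply/continuous_within_itvP => //; split.
  + by move=> x; rewrite in_itv/= => /andP[ax _]; apply: cont; exact: le_lt_trans ax.
  + move: a0; rewrite le_eqVlt => /predU1P[<-//|a0].
    by apply: cvg_at_right_filter; exact: cont.
  + by apply: cvg_at_left_filter; exact: cont.
by rewrite in_itv/= => abc e; exists c.
Qed.

Lemma fourier_flow_lipschitz xi th (a b : R) : 0 <= a -> a <= b ->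
  `|phase (f b) xi th - phase (f a) xi th| <= 2 * (b - a).
Proof.
move=> a0; rewrite le_eqVlt => /predU1P[<-|ab]; first by rewrite !subrr normr0 mulr0.
have [c _ ->] := fourier_flow_MVT xi th a0 ab.
rewrite normrM (@ger0_norm _ (b - a)) ?subr_ge0 ?(ltW ab)// ler_wpM2r ?subr_ge0 ?(ltW ab)//.
rewrite (natrD _ 1 1); apply: le_trans (ler_normB _ _) _.
by apply: lerD; exact: normr_phase_le1.
Qed.

(** By the mean value theorem the increment is h times the drift at a time c in ]t, t + h[. Phases
    are 2-Lipschitz in time, uniformly in the frequency, so the drift varies by at most (2 + 2) (c -
    t) through [conv] and 2 (c - t) through the loss. *)
Lemma fourier_flow_euler (t h xi th : R) : 0 <= t -> 0 <= h ->
  `|phase (f (t + h)) xi th -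
    ((1 - h) * phase (f t) xi th + h * phase (conv p q (f t)) xi th)| <= 6 * h ^+ 2.
Proof.
move=> t0; rewrite le_eqVlt => /predU1P[<-|h0].
  by rewrite addr0 subr0 mul1r mul0r addr0 subrr normr0 expr0n mulr0.
have th0 : t < t + h by rewrite ltrDl.
have [c /andP[tc cth] e] := fourier_flow_MVT xi th t0 th0.
have lip (b eta tt : R) : t <= b -> phase (f b) eta tt - phase (f t) eta tt <= 2 * (b - t).
  by move=> tb; apply: le_trans (ler_norm _) _; exact: fourier_flow_lipschitz.
have close (eta : R) : phase_close (f c) (f t) eta (2 * (c - t)).
  by move=> tt; apply: lip; exact: ltW.
have h1 := phase_close_norm (phase_close_conv (close (p * xi)) (close (q * xi))) th.
have h2 := phase_close_norm (close xi) th.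
have -> : phase (f (t + h)) xi th -
    ((1 - h) * phase (f t) xi th + h * phase (conv p q (f t)) xi th) =
  h * ((phase (conv p q (f c)) xi th - phase (conv p q (f t)) xi th) -
       (phase (f c) xi th - phase (f t) xi th)).
  by have -> : phase (f (t + h)) xi th = phase (f t) xi th + drift c xi th * h;
     [move: e; rewrite (_ : t + h - t = h); [lra|ring]|rewrite /drift; ring].
rewrite normrM (gtr0_norm h0) expr2 mulrCA ler_wpM2l// ?(ltW h0)//.
apply: le_trans (ler_normB _ _) _; apply: le_trans (lerD h1 h2) _.
lra.
Qed.

End euler_estimate.

(** * The renormalized Euler scheme *)

Section euler_scheme.
Context {R : realType}.
Variables p q : R.
Hypotheses (p0 : 0 < p) (q0 : 0 < q).
Let lam := p ^+ 2 + q ^+ 2 - 1.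
Variables (h : R) (h01 : 0 <= h <= 1).

(* The standard deviation after one Euler step of size [h] from a normalized
   distribution. *)
Definition euler_scale : R := Num.sqrt (1 + h * lam).

Let scale_gt0 : 0 < 1 + h * lam.
Proof.
have /andP[h0 h1] := h01; have p20 : 0 < p ^+ 2 by rewrite exprn_gt0.
have q20 : 0 < q ^+ 2 by rewrite exprn_gt0.
have -> : 1 + h * lam = (1 - h) + h * (p ^+ 2 + q ^+ 2) by rewrite /lam; ring.
move: h0; rewrite le_eqVlt => /predU1P[<-|h0]; first by rewrite subr0 mul0r addr0.
by apply: ltr_wpDl; [rewrite subr_ge0|rewrite mulr_gt0// addr_gt0].
Qed.

Lemma euler_scale_gt0 : 0 < euler_scale.
Proof. by rewrite sqrtr_gt0. Qed.

Lemma euler_scale_sqr : euler_scale ^+ 2 = 1 + h * lam.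
Proof. by rewrite sqr_sqrtr// ltW. Qed.

Lemma euler_scale_le : euler_scale <= expR (lam / 2 * h).
Proof.
rewrite -ler_sqr ?nnegrE ?expR_ge0 ?(ltW euler_scale_gt0)//.
rewrite euler_scale_sqr expr2 -expRD.
apply: le_trans (expR_ge1Dx _) _; rewrite le_eqVlt; apply/orP; left; apply/eqP.
by congr expR; field.
Qed.

Definition euler_step mu : borel_probability R :=
  dist_dilation euler_scale (mixture mu (conv p q mu) h01).

Lemma centered_euler_step mu : centered mu 1 -> centered (euler_step mu) 1.
Proof.
move=> cm.
have := centered_dilation euler_scale (centered_mixture h01 cm (centered_conv p q cm)).
rewrite euler_scale_sqr !mulr1.
rewrite (_ : _ / _ = 1)// -[RHS](divff (lt0r_neq0 scale_gt0)).
by congr (_ / _); rewrite /lam; ring.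
Qed.

(** Before rescaling the moment is at most c (1 + h lam s / 2). Bernoulli's inequality bounds the
    rescaling factor (1 + h lam)^(s / 2) below by 1 + h lam s / 2, so the level c is kept with no
    error in h. *)
Lemma moment_euler_step (s kappa K c : R) mu : 2 <= s ->
  0 <= kappa -> K <= (lam / 2 * s + 1 - kappa) * c ->
  has_moment s mu -> has_moment s (conv p q mu) ->
  moment s (conv p q mu) <= kappa * moment s mu + K ->
  moment s mu <= c ->
  has_moment s (euler_step mu) /\ moment s (euler_step mu) <= c.
Proof.
move=> s2 k0 Kc hmu hconv mconv mc.
have /andP[h0 h1] := h01.
have c0 : 0 <= c by apply: le_trans mc; exact: moment_ge0.
have [hm me] := moment_mixture h01 hmu hconv.
have [hd ->] := moment_dilation euler_scale_gt0 hm; split=> //.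
rewrite me ler_pdivrMr ?powR_gt0 ?euler_scale_gt0//.
have b : 1 + s / 2 * (h * lam) <= euler_scale `^ s.
  have -> : euler_scale `^ s = (1 + h * lam) `^ (s / 2).
    rewrite -euler_scale_sqr -powR_mulrn ?(ltW euler_scale_gt0)// -powRrM.
    by congr (_ `^ _); field.
  by apply: powR_bernoulli; [exact: ltW|rewrite ler_pdivlMr// mul1r].
apply: le_trans (ler_wpM2l c0 b).
have m1 : (1 - h) * moment s mu <= (1 - h) * c by rewrite ler_wpM2l// subr_ge0.
have m2 : h * moment s (conv p q mu) <= h * (kappa * c + K).
  rewrite ler_wpM2l//; apply: le_trans mconv _.
  by rewrite lerD2r ler_wpM2l.
have m3 := ler_wpM2l h0 Kc.
lra.
Qed.

Lemma phase_close_euler_step f t sig mu e : fourier_flow p q f -> 0 <= t ->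
  (forall xi, phase_close (dist_dilation sig (f t)) mu xi e) ->
  forall xi, phase_close (dist_dilation (euler_scale * sig) (f (t + h)))
    (euler_step mu) xi ((1 + h) * e + 6 * h ^+ 2).
Proof.
move=> ff t0 he xi th; have /andP[h0 h1] := h01.
set eta := xi / euler_scale.
have h2 := fourier_flow_euler ff (eta / sig) th t0 h0.
(* [conv] doubles a bound that is uniform in the frequency, so the error becomes (1 - h) e + 2 h e =
   (1 + h) e, plus the one-step error. *)
have h3 : phase (conv p q (f t)) (eta / sig) th - phase (conv p q mu) eta th <= e + e.
  rewrite -phase_conv_dilation; exact: phase_close_conv (he _) (he _) th.
have h4 := he eta th; rewrite phase_dilation in h4.
rewrite !phase_dilation phase_mixture -/eta.
have -> : xi / (euler_scale * sig) = eta / sig by rewrite invfM mulrA.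
have m1 := ler_wpM2l h0 h3.
have h1' : 0 <= 1 - h by lra.
have m2 := ler_wpM2l h1' h4.
have := le_trans (ler_norm _) h2.
lra.
Qed.

Definition euler n mu := iter n euler_step mu.

(** The bound solves the recursion e -> (1 + h) e + 6 h^2 started at 0. *)
Lemma phase_close_euler f mu n : fourier_flow p q f ->
  (forall xi th, phase (f 0) xi th = phase mu xi th) ->
  forall xi, phase_close (dist_dilation (euler_scale ^+ n) (f (n%:R * h))) (euler n mu) xi
    (6 * h * ((1 + h) ^+ n - 1)).
Proof.
move=> ff f0; have /andP[h0 h1] := h01.
elim: n => [|n IH] xi th.
  by rewrite phase_dilation divr1 mul0r f0 !subrr mulr0.
rewrite exprS (_ : n.+1%:R * h = n%:R * h + h); last by rewrite -natr1 mulrDl mul1r.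
have nh : 0 <= n%:R * h by rewrite mulr_ge0.
apply: le_trans (phase_close_euler_step ff nh IH xi th) _.
by rewrite le_eqVlt; apply/orP; left; apply/eqP; rewrite [(1 + h) ^+ _.+1]exprS; ring.
Qed.

End euler_scheme.

(** * Moment bounds for the solution *)

Section moment_propagation.
Context {R : realType}.
Variables p q : R.
Hypotheses (p0 : 0 < p) (q0 : 0 < q).
Let lam := p ^+ 2 + q ^+ 2 - 1.

Lemma moment_same_measure s (mu nu : borel_probability R) : same_measure mu nu ->
  has_moment s mu -> has_moment s nu /\ moment s nu = moment s mu.
Proof.
move=> mn hm.
have e (f : R -> \bar R) : (\int[nu]_v f v = \int[mu]_v f v)%E.
  by apply: eq_measure_integral => A mA _; exact/esym/mn.
split; last by rewrite /moment /Rintegral e.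
have /integrableP[mf fi] := hm; apply/integrableP; split=> //.
by rewrite e.
Qed.

Variables (s kappa K c : R).
Hypotheses (s2 : 2 <= s) (kappa0 : 0 <= kappa).
Hypothesis Kc : K <= (lam / 2 * s + 1 - kappa) * c.
Hypothesis conv_moment : forall mu, centered mu 1 -> has_moment s mu ->
  has_moment s (conv p q mu) /\ moment s (conv p q mu) <= kappa * moment s mu + K.

Lemma moment_euler (h : R) (h01 : 0 <= h <= 1) mu n : centered mu 1 ->
  has_moment s mu -> moment s mu <= c ->
  [/\ centered (euler p q h01 n mu) 1, has_moment s (euler p q h01 n mu) &
      moment s (euler p q h01 n mu) <= c].
Proof.
move=> cm hm mc; elim: n => [//|n [IH1 IH2 IH3]].
have [i1 i2] := conv_moment IH1 IH2.
have [j1 j2] := moment_euler_step p0 q0 h01 s2 kappa0 Kc IH2 i1 i2 IH3.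
by split=> //; exact: centered_euler_step.
Qed.

(** With t fixed and the number of steps growing, the Euler measures have a weak limit that keeps
    the moment bound and has the phases of [f t]; equality of phases then identifies the two
    measures. *)
Lemma fourier_flow_moment f mu : fourier_flow p q f ->
  (forall xi th, phase (f 0) xi th = phase mu xi th) ->
  centered mu 1 -> has_moment s mu -> moment s mu <= c ->
  forall t, 0 <= t ->
  has_moment s (f t) /\ moment s (f t) <= c * expR (lam / 2 * t) `^ s.
Proof.
move=> ff f0 cm hm mc t t0.
have c0 : 0 <= c by apply: le_trans mc; exact: moment_ge0.
set E := expR (lam / 2 * t).
have E0 : 0 < E by exact: expR_gt0.
pose m := Num.bound t.
have tm : t < m%:R by have := archi_boundP t0.
(* More than t steps, so that the step size is at most 1. *)
pose N n := (n.+1 + m)%N.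
have N0 n : 0 < (N n)%:R :> R by rewrite ltr0n.
pose h n := t / (N n)%:R.
have h01 n : 0 <= h n <= 1.
  rewrite divr_ge0//= ler_pdivrMr// mul1r; apply: le_trans (ltW tm) _.
  by rewrite ler_nat leq_addl.
have hE n : (N n)%:R * h n = t by rewrite mulrC divfK// gt_eqF.
pose sig n := euler_scale p q (h n) ^+ N n.
have sig0 n : 0 < sig n by rewrite exprn_gt0//; exact: euler_scale_gt0.
have sigE n : sig n <= E.
  rewrite /E -(hE n) mulrCA expRM_natl lerXn2r ?nnegrE ?expR_ge0//.
    exact/ltW/euler_scale_gt0.
  exact: euler_scale_le.
(* Undoes the renormalizations accumulated over all steps, to compare with [f t] itself. *)
pose mu_ n := dist_dilation (sig n)^-1 (euler p q (h01 n) (N n) mu).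
have muc n : centered (mu_ n) (1 / (sig n)^-1 ^+ 2).
  by apply: centered_dilation; have [] := moment_euler (h01 n) (N n) cm hm mc.
have mucE n : 1 / (sig n)^-1 ^+ 2 <= E ^+ 2.
  rewrite div1r exprVn invrK lerXn2r ?nnegrE//; exact: ltW.
have mum n : has_moment s (mu_ n) /\ moment s (mu_ n) <= c * E `^ s.
  have [_ h1 h2] := moment_euler (h01 n) (N n) cm hm mc.
  have sv : 0 < (sig n)^-1 by rewrite invr_gt0.
  have [h3 ->] := moment_dilation sv h1; split=> //.
  have -> : (sig n)^-1 `^ s = (sig n `^ s)^-1.
    by rewrite -powR_inv1 ?ltW// -powRrM mulN1r powRN.
  rewrite invrK; apply: ler_pM => //; [exact: moment_ge0|exact: powR_ge0|].
  by apply: ge0_ler_powR => //; rewrite ?nnegrE ?ltW// (lt_le_trans _ s2).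
(* The scheme error 6 h ((1 + h)^N - 1) with N h = t, where (1 + h)^N <= e^t and h <= t / (n +
   1). *)
have close n xi : phase_close (f t) (mu_ n) xi (6 * t * expR t * n.+1%:R^-1).
  move=> th.
  have := phase_close_euler (h01 n) (N n) ff f0 (xi * sig n) th.
  rewrite !phase_dilation mulfK ?gt_eqF// invrK (hE n).
  move=> hh; apply: le_trans hh _; have /andP[h0 h1] := h01 n.
  have e1 : (1 + h n) ^+ N n - 1 <= expR t.
    rewrite lerBlDr ler_wpDr// -[X in expR X](hE n) expRM_natl lerXn2r ?nnegrE ?expR_ge0//.
      by rewrite addr_ge0.
    exact: expR_ge1Dx.
  have e2 : h n <= t * n.+1%:R^-1.
    by rewrite ler_wpM2l// lef_pV2 ?posrE// ler_nat leq_addr.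
  have e3 : 0 <= (1 + h n) ^+ N n - 1.
    by rewrite subr_ge0 exprn_ege1// lerDl.
  rewrite -mulrA -[leRHS]mulrA -[leRHS]mulrA ler_wpM2l//.
  by rewrite [expR t * _]mulrC mulrA ler_pM.
have [U UU ooU] := exists_ultra_infty.
have [g hg] := helly UU (tight_centered muc mucE).
have PU : ProperFilter U by exact: ultra_proper.
have s1 : 1 <= s by apply: le_trans s2; rewrite ler1n.
have [gm gc] := moment_lim PU s1 hg mum.
have same : same_measure g (f t).
  apply: phase_inj => xi th; apply/eqP; rewrite -subr_eq0 -normr_le0 distrC.
  have cv1 : `|phase (f t) xi th - phase (mu_ n) xi th| @[n --> U] -->
      `|phase (f t) xi th - phase g xi th|.
    by apply: cvg_norm; apply: cvgB; [exact: cvg_cst|exact: cvg_phase].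
  have cv2 : 6 * t * expR t * n.+1%:R^-1 @[n --> U] --> 6 * t * expR t * 0.
    apply: cvg_trans (_ : _ @ \oo --> _); last by apply: cvgMr; exact: cvg_harmonic.
    by move=> A; exact: ooU.
  rewrite mulr0 in cv2; apply: (ler_cvg_to cv1 cv2); apply: nearW => n.
  exact: phase_close_norm (close n xi) th.
by have [h1 ->] := moment_same_measure same gm.
Qed.

End moment_propagation.

Theorem theorem3p5 (R : realType) (p q delta : R)
    (q_gt0 : 0 < q) (qp : q < p) (delta_gt0 : 0 < delta)
    (S_lt0 : Spq p q delta < 0) :
  exists ginf : borel_probability R,
    [/\ normalized_stationary p q delta ginf,
        forall h : borel_probability R,
          normalized_stationary p q delta h -> same_measure h ginf &
        forall (a : R) (f0 : borel_probability R)
               (f : R -> borel_probability R),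
          2 < a ->
          normalized f0 ->
          (abs_moment (2 + delta) f0 < +oo)%E ->
          weak_solution p q a f0 f ->
          (exists c : R,
             (forall t : R, 0 <= t ->
                (abs_moment (2 + delta) (scaled p q f t) <= c%:E)%E) /\
             (delta <= 1 ->
                c = fine (abs_moment (2 + delta) f0)
                    + (p ^+ 2 * q `^ delta + q ^+ 2 * p `^ delta)
                      / `|Spq p q delta|)) /\
          (forall t : R, 0 <= t ->
             (fourier_dist (2 + delta) (scaled p q f t) ginf <=
              fourier_dist (2 + delta) f0 ginf
                * (expR (- `|Spq p q delta| * t))%:E)%E)].
Proof.
have p_gt0 : 0 < p by exact: lt_trans qp.
have [ginf [cg mg fg]] := exists_fixed_point p_gt0 q_gt0 delta_gt0 S_lt0.
have sg := fixed_point_stationary fg.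
exists ginf; split.
- by split=> //; [exact/normalizedP|exact/M_spaceP].
- move=> h [/normalizedP ch /M_spaceP mh sh].
  exact: (stationary_unique p_gt0 q_gt0 delta_gt0).
move=> a f0 f _ /normalizedP c0 m0 /weak_solution_flow[ff f00].
split; last exact: (fourier_dist_decay p_gt0 q_gt0 delta_gt0 S_lt0 ff f00 (centered_int2 cg)).
have mf0 : has_moment (2 + delta) f0 by exact/M_spaceP.
have s2 : 2 <= 2 + delta by rewrite lerDl ltW.
have [kappa [K [k0 kd K0 hconv KE]]] := moment_conv_ineq p_gt0 q_gt0 delta_gt0 S_lt0.
set d := _ + 1 in kd KE.
have dk : 0 < d - kappa by rewrite subr_gt0.
(* The added term is the smallest level satisfying [Kc]; the initial moment is added so that c also
   dominates it. *)
pose c := moment (2 + delta) f0 + K / (d - kappa).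
have Kd0 : 0 <= K / (d - kappa) by rewrite divr_ge0// ltW.
have Kc : K <= (d - kappa) * c.
  rewrite mulrDr [X in _ + X]mulrC divfK ?gt_eqF// lerDr.
  by rewrite mulr_ge0 ?moment_ge0// ltW.
have m0c : moment (2 + delta) f0 <= c by rewrite lerDl.
have fm := fourier_flow_moment p_gt0 q_gt0 s2 k0 Kc hconv ff f00 c0 mf0 m0c.
exists c; split=> [t t0|d1]; last by rewrite (abs_moment_EFin m0)/= /c KE.
have [h1 h2] := fm t t0.
(* Rescaling divides by exactly the growth factor that [fm] allows for the unscaled solution. *)
have [h3 h4] := moment_dilation (expR_gt0 ((p ^+ 2 + q ^+ 2 - 1) / 2 * t)) h1.
rewrite scaledE (abs_moment_EFin (iffRL (M_spaceP _ _) h3)) lee_fin.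
rewrite -/(moment _ _) h4 ler_pdivrMr ?powR_gt0 ?expR_gt0//.
Qed.
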